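(* Let $\alpha_0\le\alpha<p$. Let $\phi,\psi\in\mathcal{T}^\alpha_p(\mathbb{R}^3\times[0,\infty))$ be solutions of the integral equation $$\phi(\xi,t)=e^{-\delta_p|\xi|^p t}\phi_0(\xi)+\int_0^t e^{-\delta_p|\xi|^p(t-\tau)}\,\mathcal{B}(\phi)(\xi,\tau)\,d\tau ,\qquad (\xi,t)\in\mathbb{R}^3\times[0,\infty),$$ with initial data $\phi_0,\psi_0\in\mathcal{M}^\alpha$ respectively (for $\psi$, with $\psi,\psi_0$ in place of $\phi,\phi_0$). Then for all $t\ge0$ $$\left\| e^{\delta_p|\cdot|^p t}\big(\phi(\cdot,t)-\psi(\cdot,t)\big)\right\|_{\mathcal{M}^\alpha}\le e^{\lambda_\alpha t}\,\|\phi_0-\psi_0\|_{\mathcal{M}^\alpha}.$$ In particular, for given initial datum in $\mathcal{M}^\alpha$, the integral equation has at most one solution in $\mathcal{T}^\alpha_p(\mathbb{R}^3\times[0,\infty))$.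
   Context: Constants: $0<p\le 2$ and $\delta_p\ge 0$ are fixed. Kernel: $b=b(\cos\theta)\ge 0$ is a measurable function of the deviation angle, with $\theta$ restricted to $[0,\pi/2]$ (i.e. $b(\cos\theta)=0$ for $\theta\in(\pi/2,\pi]$). There is a fixed $\alpha_0\in(0,2]$ with $\int_0^{\pi/2} b(\cos\theta)\sin\theta\,\sin^{\alpha_0}(\theta/2)\,d\theta<\infty$; $b(\cos\theta)\sin\theta$ is not assumed to be integrable on $[0,\pi/2]$. Set $$\lambda_\alpha=2\pi\int_0^{\pi/2}b(\cos\theta)\sin\theta\left[\cos^\alpha\left(\tfrac{\theta}{2}\right)+\sin^\alpha\left(\tfrac{\theta}{2}\right)-1\right]d\theta ,$$ which satisfies $0\le\lambda_\alpha<\infty$. Function spaces: $\mathcal{K}$ is the set of $\phi:\mathbb{R}^3\to\mathbb{C}$ of the form $\phi(\xi)=\int_{\mathbb{R}^3}e^{-iv\cdot\xi}\,df(v)$ with $f$ a Borel probability measure on $\mathbb{R}^3$. Write $$\|\phi-\psi\|_{\alpha}=\sup_{\xi\in\mathbb{R}^3\setminus\{0\}}\frac{|\phi(\xi)-\psi(\xi)|}{|\xi|^{\alpha}},\qquad \|h\|_{\mathcal{M}^\alpha}=\int_{\mathbb{R}^3}\frac{|h(\xi)|}{|\xi|^{3+\alpha}}\,d\xi,$$ $\mathcal{M}^\alpha=\{\phi\in\mathcal{K}:\|\phi-1\|_{\mathcal{M}^\alpha}<\infty\}$, a metric space with the distance $\mathrm{dis}_\alpha(\phi,\psi)=\|\phi-\psi\|_{\mathcal{M}^\alpha}+\|\phi-\psi\|_\alpha$.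 Operator: $\mathcal{B}(\phi)(\xi)=\int_{\mathbb{S}^2} b\big(\tfrac{\xi}{|\xi|}\cdot\sigma\big)\,[\phi(\xi^+)\phi(\xi^-)-\phi(0)\phi(\xi)]\,d\sigma$ for $\xi\neq0$, with $\xi^{\pm}=(\xi\pm|\xi|\sigma)/2$, and $\mathcal{B}(\phi)(0)=0$; $\mathcal{B}(\phi)(\xi,t)=\mathcal{B}(\phi(\cdot,t))(\xi)$. When the integral is not absolutely convergent it is understood in polar coordinates of $\sigma$ about the axis $\xi/|\xi|$ (with $\cos\theta=\sigma\cdot\xi/|\xi|$), integrating first over the azimuthal angle and then over $\theta$. Solution spaces: $\mathcal{T}^\alpha(\mathbb{R}^3\times[0,\infty))$ is the set of $\phi\in C([0,\infty);\mathcal{M}^\alpha)$ such that, for every $\xi\in\mathbb{R}^3$, $\phi(\xi,\cdot)\in C([0,\infty))$ and $\partial_t\phi(\xi,\cdot)$ exists and belongs to $C((0,\infty))$. $\mathcal{T}^\alpha_p(\mathbb{R}^3\times[0,\infty))$ is the set of $\phi\in\mathcal{T}^\alpha(\mathbb{R}^3\times[0,\infty))$ satisfying $\sup_{\xi\in\mathbb{R}^3}e^{\delta_p|\xi|^pt}|\phi(\xi,t)|\le1$ for each $t\ge0$. *)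

(* Defs.v *)
From HB Require Import structures.
From mathcomp Require Import all_boot all_order all_algebra.
From mathcomp Require Import all_classical all_reals all_analysis.
From mathcomp.real_closed Require Import complex.

Set Implicit Arguments.
Unset Strict Implicit.
Unset Printing Implicit Defensive.

Import Order.TTheory GRing.Theory Num.Theory.
Import numFieldTopology.Exports numFieldNormedType.Exports.

Local Open Scope classical_set_scope.
Local Open Scope ring_scope.
Local Open Scope complex_scope.

(* Complex numbers are [R[i]]; [Normc.normc : R[i] -> R] is the real-valued
   modulus.  The library norm on a product type is the max norm, so the
   Euclidean norm on R^3 is defined here. *)

Section EuclideanSpace.
Context {R : realType}.

Definition R3 : Type :=
  (measurableTypeR R * measurableTypeR R * measurableTypeR R)%type.

Definition vec3 (a b c : R) : R3 := (a, b, c).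

Definition dot (u v : R3) : R :=
  u.1.1 * v.1.1 + u.1.2 * v.1.2 + u.2 * v.2.

Definition cross (u v : R3) : R3 :=
  vec3 (u.1.2 * v.2 - u.2 * v.1.2)
       (u.2 * v.1.1 - u.1.1 * v.2)
       (u.1.1 * v.1.2 - u.1.2 * v.1.1).

Definition scale3 (a : R) (u : R3) : R3 :=
  vec3 (a * u.1.1) (a * u.1.2) (a * u.2).

Definition enorm (u : R3) : R := Num.sqrt (dot u u).

Definition lebesgue3 : {measure set R3 -> \bar R} :=
  ((@lebesgue_measure R \x @lebesgue_measure R) \x @lebesgue_measure R)%E.

End EuclideanSpace.
Arguments R3 : clear implicits.

Definition Cintegral d (T : measurableType d) (R : realType)
    (mu : {measure set T -> \bar R}) (D : set T) (f : T -> R[i]) : R[i] :=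
  (\int[mu]_(x in D) complex.Re (f x)) +i* (\int[mu]_(x in D) complex.Im (f x)).

Definition cexpi (R : realType) (x : R) : R[i] := cos x +i* sin x.

Section Sphere.
Context {R : realType}.

(* A unit vector orthogonal to the unit vector [e]; together with [e] and
   [cross e (ortho e)] it forms an orthonormal frame. *)
Definition ortho (e : R3 R) : R3 R :=
  if (e.1.1 == 0) && (e.1.2 == 0) then vec3 1 0 0
  else scale3 (Num.sqrt (e.1.1 ^+ 2 + e.1.2 ^+ 2))^-1 (vec3 (- e.1.2) e.1.1 0).

(* The point of the unit sphere with polar angle [theta] and azimuth [w] about
   the axis [e]. *)
Definition sphere_point (e : R3 R) (theta w : R) : R3 R :=
  scale3 (cos theta) e
  + scale3 (sin theta)
      (scale3 (cos w) (ortho e) + scale3 (sin w) (cross e (ortho e))).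

(* The integral over S^2 against the surface measure, in polar coordinates
   about the axis [e], azimuthal angle first.  By Fubini it is the surface
   integral, whatever [e] is, when [F] is absolutely integrable; otherwise the
   axis and the order of integration matter. *)
Definition sphere_integral (e : R3 R) (F : R3 R -> R[i]) : R[i] :=
  Cintegral (@lebesgue_measure R) `[0, pi] (fun theta =>
    (sin theta)%:C * Cintegral (@lebesgue_measure R) `[0, 2 * pi] (fun w =>
      F (sphere_point e theta w))).

End Sphere.

Section BoltzmannFourier.
Context {R : realType}.
Implicit Types (phi psi h : R3 R -> R[i]) (b : R -> R) (p delta alpha : R).

Definition lambda b alpha : R :=
  2 * pi * \int[@lebesgue_measure R]_(theta in `[0, pi / 2])
    (b (cos theta) * sin theta *
     (cos (theta / 2) `^ alpha + sin (theta / 2) `^ alpha - 1)).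

Definition charfun (f : probability (R3 R) R) (xi : R3 R) : R[i] :=
  Cintegral f setT (fun v => cexpi (- dot v xi)).

Definition in_K phi : Prop :=
  exists f : probability (R3 R) R, forall xi, phi xi = charfun f xi.

(* ||h||_alpha *)
Definition supnorm alpha h : \bar R :=
  ereal_sup [set (Normc.normc (h xi) / enorm xi `^ alpha)%:E
            | xi in [set xi : R3 R | xi != 0]].

(* ||h||_{M^alpha}; the integrand takes the value 0 at the (null) origin since
   [0^-1 = 0]. *)
Definition Mnorm alpha h : \bar R :=
  (\int[lebesgue3]_xi (Normc.normc (h xi) / enorm xi `^ (3 + alpha)%R)%:E)%E.

Definition in_M alpha phi : Prop :=
  in_K phi /\ (Mnorm alpha (fun xi => phi xi - 1)%R < +oo)%E.

Definition dis alpha phi psi : \bar R :=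
  (Mnorm alpha (fun xi => phi xi - psi xi)%R
   + supnorm alpha (fun xi => phi xi - psi xi)%R)%E.

Definition xi_plus (xi sigma : R3 R) : R3 R :=
  scale3 2^-1 (xi + scale3 (enorm xi) sigma).

Definition xi_minus (xi sigma : R3 R) : R3 R :=
  scale3 2^-1 (xi - scale3 (enorm xi) sigma).

Definition Bop b phi (xi : R3 R) : R[i] :=
  if xi == 0 then 0 else
  let e := scale3 (enorm xi)^-1 xi in
  sphere_integral e (fun sigma =>
    (b (dot e sigma))%:C *
    (phi (xi_plus xi sigma) * phi (xi_minus xi sigma) - phi 0 * phi xi)).

(* Time-dependent functions are total in the time variable, but only their
   values at times t >= 0 are ever constrained or used. *)

Definition M_continuous alpha (phi : R3 R -> R -> R[i]) : Prop :=
  (forall t, 0 <= t -> in_M alpha (phi^~ t)) /\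
  (forall t0, 0 <= t0 ->
     dis alpha (phi^~ t) (phi^~ t0)
       @[t --> within `[0, +oo[ (nbhs t0)] --> 0%E).

(* [R[i]^o] carries the usual topology of the complex plane. *)
Definition is_time_derivative (u : R -> R[i]^o) (t : R) (d : R[i]^o) : Prop :=
  ((h^-1)%:C * (u (t + h) - u t) : R[i]^o) @[h --> 0^'] --> d.

Definition in_T alpha (phi : R3 R -> R -> R[i]) : Prop :=
  M_continuous alpha phi /\
  forall xi,
    {within `[0, +oo[, continuous (phi xi : R -> R[i]^o)} /\
    exists dphi : R -> R[i]^o,
      (forall t, 0 < t -> is_time_derivative (phi xi) t (dphi t)) /\
      {within `]0, +oo[, continuous dphi}.

Definition in_Tp p delta alpha (phi : R3 R -> R -> R[i]) : Prop :=
  in_T alpha phi /\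
  forall t, 0 <= t ->
    (ereal_sup [set (expR (delta * enorm xi `^ p * t)
                     * Normc.normc (phi xi t))%:E | xi in [set: R3 R]]
     <= 1)%E.

Definition is_solution p delta b phi0 (phi : R3 R -> R -> R[i]) : Prop :=
  forall (xi : R3 R) (t : R), 0 <= t ->
    phi xi t =
      (expR (- (delta * enorm xi `^ p * t)))%:C * phi0 xi
      + Cintegral (@lebesgue_measure R) `[0, t] (fun tau =>
          (expR (- (delta * enorm xi `^ p * (t - tau))))%:C
          * Bop b (phi^~ tau) xi).

End BoltzmannFourier.

(* Main.v *)
From HB Require Import structures.
Require Import Defs.
From mathcomp Require Import all_boot all_order all_algebra.
From mathcomp Require Import all_classical all_reals all_analysis.
From mathcomp.real_closed Require Import complex.
From mathcomp Require Import measurable_realfun ring lra.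

(** The weighted difference [v = exp (delta |xi|^p t) (phi - psi)] is estimated in
    the norm of M^alpha by a Gronwall argument.

    In the variable [exp (delta |xi|^p t) phi] the integral equation is a plain
    integral in time ([duhamel_increment]), and in polar coordinates about
    [xi / |xi|] the collision operator is the integral over the deviation angle [t]
    of the kernel times an azimuthal average ([Bop_azimuthal]). Two facts about
    the maps [xi |-> xi+] and [xi |-> xi-] carry the estimate.
    - Averaged over the azimuth they are, up to sign, rotations followed by
      dilations of ratio [cos (t / 2)] and [sin (t / 2)] ([half_angle_vec]). The
      average over such rotations preserves Lebesgue measure ([rotate_average]),
      so that integrals against [|xi|^(-3-alpha)] pick up the factors
      [cos (t / 2) ^ alpha] and [sin (t / 2) ^ alpha] ([gain_plus], [gain_minus]).
    - [|xi|^p <= |xi+|^p + |xi-|^p] for [p <= 2]. Hence the exponential weight at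
      [xi] splits over [xi+] and [xi-], and as the weighted solutions are bounded by
      [1], the weighted difference of two gain terms is at most [|v(xi+)| + |v(xi-)|]
      ([gap_size_plus_minus]).

    If the kernel were integrable, gain and loss could be separated: the gain
    would contribute [cos ^ alpha + sin ^ alpha] to the growth rate and the loss
    [-1], which is the bracket in [lambda]. The kernel is only integrable against
    [sin (t / 2) ^ alpha], so it is truncated ([cutoff]). On the truncated part the
    separation is legitimate ([collision_difference]), and the resulting rate never
    exceeds [lambda], because the bracket is nonnegative ([cutoff_balance]). The
    remaining part is small, by cancellation within each azimuthal average: as the
    azimuth varies, [xi+] runs over a circle about [cos (t / 2) ^ 2 xi], and what is
    of first order in its radius is odd under the half-turn and integrates to [0].
    The other terms are values of [|phi - 1|] and second differences of a
    characteristic function ([normc_azimuthal_le]), and the changes of variables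
    above bound their total by [16 pi] times the integral of the kernel against
    [sin (t / 2) ^ alpha] times the norm of [phi - 1] ([azimuthal_integral_le]). This
    tends to [0] as the level of truncation increases ([cutoff_tail]).

    The norms are first taken over a ball. As [|xi+|] and [|xi-|] are at most [|xi|],
    the estimates do not leave it, and the exponential weight is bounded there.
    They give a differential inequality from the right for the norm ([mass_step]),
    which [dini_gronwall] integrates ([mass_growth]). The radius then tends to
    infinity ([ball_exhaustion]).

    For uniqueness, the bound gives [phi = psi] almost everywhere at each time;
    the two functions of [xi] are characteristic functions, hence continuous, and
    so they are equal ([ae_dense], [charfun_eq_of_cvg]). *)

Import Order.TTheory GRing.Theory Num.Theory.
Import numFieldTopology.Exports numFieldNormedType.Exports.
Local Open Scope classical_set_scope.
Local Open Scope ring_scope.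

Set Implicit Arguments.
Unset Strict Implicit.

(** * Measurability and Tonelli's theorem *)

(** Fixing the codomain to [measurableTypeR R] lets measurability goals be solved
    by matching on the syntax of the function. *)
Notation mreal := (@measurable_fun _ _ _ (measurableTypeR _) setT).

Section MeasurabilityToolbox.
Context d (T : measurableType d) (R : realType).
Implicit Types (f g : T -> R) (F G : T -> \bar R).

Lemma mreal_add f g : mreal f -> mreal g -> mreal (fun x => f x + g x).
Proof. exact: measurable_funD. Qed.

Lemma mreal_opp f : mreal f -> mreal (fun x => - f x).
Proof. exact: measurable_funN. Qed.

Lemma mreal_mul f g : mreal f -> mreal g -> mreal (fun x => f x * g x).
Proof. exact: measurable_funM. Qed.

Lemma mreal_exprn f n : mreal f -> mreal (fun x => f x ^+ n).
Proof. exact: measurable_funX. Qed.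

Lemma mreal_comp (h : R -> R) f : measurable_fun setT h -> mreal f ->
  mreal (fun x => h (f x)).
Proof. exact: measurableT_comp. Qed.

Lemma mreal_inv f : mreal f -> mreal (fun x => (f x)^-1).
Proof.
apply: mreal_comp.
pose g (x : R) : R := if x == 0 then 0 else x^-1.
have -> : GRing.inv = g.
  by apply/funext => x; rewrite /g; case: eqP => // ->; rewrite invr0.
apply: measurable_fun_if => //.
- exact: measurable_fun_eqr.
- have -> : [set: R] `&` (fun x : R => x == 0) @^-1` [set false] = ~` [set 0].
    by rewrite setTI; apply/seteqP; split => x /=; [move/eqP|move/eqP/negbTE].
  apply: open_continuous_measurable_fun.
    by rewrite openC; exact: closed_eq.
  by move=> x; rewrite inE/= => /eqP x0; exact: inv_continuous.
Qed.

Lemma mreal_cos f : mreal f -> mreal (fun x => cos (f x)).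
Proof.
by apply: mreal_comp; apply: continuous_measurable_fun; exact: continuous_cos.
Qed.

Lemma mreal_sin f : mreal f -> mreal (fun x => sin (f x)).
Proof.
by apply: mreal_comp; apply: continuous_measurable_fun; exact: continuous_sin.
Qed.

Lemma mreal_tan f : mreal f -> mreal (fun x => tan (f x)).
Proof.
move=> mf; rewrite /tan; apply: mreal_mul; first exact: mreal_sin.
by apply: mreal_inv; exact: mreal_cos.
Qed.

Lemma mreal_sqrt f : mreal f -> mreal (fun x => Num.sqrt (f x)).
Proof.
by apply: mreal_comp; apply: continuous_measurable_fun; exact: sqrt_continuous.
Qed.

Lemma mreal_expR f : mreal f -> mreal (fun x => expR (f x)).
Proof. by apply: mreal_comp; exact: measurable_expR. Qed.

Lemma mreal_powR f a : mreal f -> mreal (fun x => f x `^ a).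
Proof. by apply: (mreal_comp (h := @powR R ^~ a)); exact: measurable_powR. Qed.

Lemma mreal_norm f : mreal f -> mreal (fun x => `|f x|).
Proof. by apply: mreal_comp; exact: normr_measurable. Qed.

Lemma mreal_max f g : mreal f -> mreal g -> mreal (fun x => Num.max (f x) (g x)).
Proof. exact: measurable_maxr. Qed.

Lemma mreal_indic d' (T' : measurableType d') (D : set T') (f : T -> T') :
  measurable D -> measurable_fun setT f -> mreal (fun x => \1_D (f x) : R).
Proof. by move=> mD mf; apply: (measurableT_comp _ mf); exact: measurable_indic. Qed.

Lemma mreal_if (h : T -> bool) f g : measurable_fun setT h ->
  mreal f -> mreal g -> mreal (fun x => if h x then f x else g x).
Proof. exact: measurable_fun_ifT. Qed.

Lemma mbool_eq f g : mreal f -> mreal g -> measurable_fun setT (fun x => f x == g x).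
Proof. exact: measurable_fun_eqr. Qed.

Lemma mbool_le f g : mreal f -> mreal g -> measurable_fun setT (fun x => f x <= g x).
Proof. exact: measurable_fun_ler. Qed.

Lemma mbool_lt f g : mreal f -> mreal g -> measurable_fun setT (fun x => f x < g x).
Proof. exact: measurable_fun_ltr. Qed.

Lemma mereal_EFin f : mreal f -> measurable_fun setT (fun x => (f x)%:E).
Proof. by move=> mf; exact/measurable_EFinP. Qed.

Lemma mreal_fine F : measurable_fun setT F -> mreal (fun x => fine (F x)).
Proof. by move=> mF; exact: measurableT_comp mF. Qed.

Lemma mereal_mul F G : measurable_fun setT F -> measurable_fun setT G ->
  measurable_fun setT (fun x => F x * G x)%E.
Proof. exact: emeasurable_funM. Qed.

Lemma mereal_add F G : measurable_fun setT F -> measurable_fun setT G ->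
  measurable_fun setT (fun x => F x + G x)%E.
Proof. exact: emeasurable_funD. Qed.

End MeasurabilityToolbox.

Section MeasurabilityToolbox2.
Context d d1 d2 (T : measurableType d) (T1 : measurableType d1)
  (T2 : measurableType d2) (R : realType).

Lemma meas_fst (f : T -> T1 * T2) : measurable_fun setT f ->
  measurable_fun setT (fun x => (f x).1).
Proof. by move=> mf; exact: (measurableT_comp measurable_fst). Qed.

Lemma meas_snd (f : T -> T1 * T2) : measurable_fun setT f ->
  measurable_fun setT (fun x => (f x).2).
Proof. by move=> mf; exact: (measurableT_comp measurable_snd). Qed.

Lemma meas_pair (f : T -> T1) (g : T -> T2) : measurable_fun setT f ->
  measurable_fun setT g -> measurable_fun setT (fun x => (f x, g x)).
Proof. exact: measurable_fun_pair. Qed.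

(** The domain [D] is absorbed in the integrand, so that the measurability half
    of Tonelli's theorem applies. *)
Lemma meas_integral (m : {sigma_finite_measure set T1 -> \bar R})
  (D : set T1) (F : T -> T1 -> \bar R) : measurable D ->
  measurable_fun setT (fun p : T * T1 => F p.1 p.2) ->
  (forall x y, (0 <= F x y)%E) ->
  measurable_fun setT (fun x => \int[m]_(y in D) F x y)%E.
Proof.
move=> mD mF F0.
pose G (p : T * T1) := (F p.1 p.2 * (\1_D p.2)%:E)%E.
have -> : (fun x => \int[m]_(y in D) F x y)%E = (fun x => \int[m]_y G (x, y))%E.
  apply/funext => x; rewrite integral_mkcond; apply: eq_integral => y _.
  by rewrite epatch_indic.
apply: measurable_fun_fubini_tonelli_F => //.
- apply: mereal_mul => //; apply: mereal_EFin.
  exact: mreal_indic.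
- by move=> p; rewrite /G mule_ge0// lee_fin.
Qed.

Lemma tonelli_total (m1 : {sigma_finite_measure set T1 -> \bar R})
  (m2 : {sigma_finite_measure set T2 -> \bar R})
  (A : set T1) (B : set T2) (F : T1 -> T2 -> \bar R) :
  measurable A -> measurable B ->
  measurable_fun setT (fun p : T1 * T2 => F p.1 p.2) ->
  (forall x y, (0 <= F x y)%E) ->
  (\int[m1]_(x in A) \int[m2]_(y in B) F x y =
   \int[m2]_(y in B) \int[m1]_(x in A) F x y)%E.
Proof.
move=> mA mB mF F0.
pose G (p : T1 * T2) := (F p.1 p.2 * (\1_B p.2)%:E * (\1_A p.1)%:E)%E.
have mG : measurable_fun setT G.
  apply: mereal_mul; [apply: mereal_mul => //|]; apply: mereal_EFin.
  - exact: mreal_indic.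
  - exact: mreal_indic.
have G0 p : (0 <= G p)%E by rewrite /G !mule_ge0// lee_fin.
have m1c x : measurable_fun setT (fun y => (F x y)).
  exact: (measurableT_comp mF (pair1_measurable x)).
have m2c y : measurable_fun setT (fun x => (F x y)).
  exact: (measurableT_comp mF (pair2_measurable y)).
transitivity (\int[m1]_x \int[m2]_y G (x, y))%E.
  rewrite integral_mkcond; apply: eq_integral => x _.
  rewrite epatch_indic integral_mkcond /G/=.
  rewrite -ge0_integralZr//.
  - by apply: eq_integral => y _; rewrite epatch_indic.
  - rewrite epatch_indic; apply: mereal_mul => //.
    by apply: mereal_EFin; exact: mreal_indic.
  - by move=> y _; rewrite epatch_indic mule_ge0// lee_fin.
rewrite (@fubini_tonelli _ _ _ _ _ m1 m2 _ mG G0).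
rewrite [RHS]integral_mkcond; apply: eq_integral => y _.
rewrite epatch_indic /G/= -ge0_integralZr//; last exact: measurable_funTS.
rewrite [RHS]integral_mkcond; apply: eq_integral => x _.
by rewrite epatch_indic.
Qed.

(** Nonnegativity is asked on [A] and [B] only: integrands carry factors such as
    a radius, which is negative outside its range. *)
Lemma tonelli (m1 : {sigma_finite_measure set T1 -> \bar R})
  (m2 : {sigma_finite_measure set T2 -> \bar R})
  (A : set T1) (B : set T2) (F : T1 -> T2 -> \bar R) :
  measurable A -> measurable B ->
  measurable_fun setT (fun p : T1 * T2 => F p.1 p.2) ->
  (forall x y, A x -> B y -> (0 <= F x y)%E) ->
  (\int[m1]_(x in A) \int[m2]_(y in B) F x y =
   \int[m2]_(y in B) \int[m1]_(x in A) F x y)%E.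
Proof.
move=> mA mB mF F0.
pose G x y := (F x y * (\1_A x * \1_B y)%:E)%E.
transitivity (\int[m1]_(x in A) \int[m2]_(y in B) G x y)%E.
  apply: eq_integral => x xA; apply: eq_integral => y yB.
  by rewrite /G !indicE xA yB mulr1 mule1.
rewrite (@tonelli_total m1 m2 A B G mA mB); last 2 first.
- apply: mereal_mul => //; apply: mereal_EFin; apply: mreal_mul.
    by apply: mreal_indic => //; exact: measurable_fst.
  by apply: mreal_indic => //; exact: measurable_snd.
- move=> x y; rewrite /G !indicE -natrM mulnb.
  have [/andP[]|_] := boolP ((x \in A) && (y \in B)); last by rewrite mule0.
  by rewrite !inE => Ax By; rewrite mule1 F0.
apply: eq_integral => y yB; apply: eq_integral => x xA.
by rewrite /G !indicE xA yB mulr1 mule1.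
Qed.

End MeasurabilityToolbox2.

Section SigmaFinite.
Context d1 d2 (T1 : measurableType d1) (T2 : measurableType d2) (R : realType).
Variables (m1 : {sigma_finite_measure set T1 -> \bar R})
  (m2 : {sigma_finite_measure set T2 -> \bar R}).

Lemma prod_measure_sigma_finite : sigma_finite setT (m1 \x m2)%E.
Proof.
have /sigma_finiteP[F [TF ndF Foo]] := sigma_finiteT m1.
have /sigma_finiteP[G [TG ndG Goo]] := sigma_finiteT m2.
exists (fun n => F n `*` G n).
  rewrite -setXTT TF TG; apply/seteqP; split => [[x y] /= [[n _ Fnx] [k _ Gky]]|].
    exists (maxn n k) => //; split.
    - by move: x Fnx; exact/subsetPset/ndF/leq_maxl.
    - by move: y Gky; exact/subsetPset/ndG/leq_maxr.
  by move=> [x y] [n _ []/= ? ?]; split; exists n.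
move=> k; have [? ?] := Foo k; have [? ?] := Goo k.
split; first exact: measurableX.
by rewrite product_measure1E// lte_mul_pinfty// ge0_fin_numE.
Qed.

(** An alias of the product measure that carries its sigma-finiteness, so that
    products can be iterated. *)
Definition prod_measure := (m1 \x m2)%E.
HB.instance Definition _ := Measure.on prod_measure.
HB.instance Definition _ := Measure_isSigmaFinite.Build _ _ _ prod_measure
  prod_measure_sigma_finite.

End SigmaFinite.

Section MeasurabilityR3.
Context d (T : measurableType d) (R : realType).
Notation RR := (measurableTypeR R).
Implicit Types (f g : T -> R3 R) (a b c : T -> R).

Lemma meas_vec3 a b c : mreal a -> mreal b -> mreal c ->
  measurable_fun setT (fun x => vec3 (a x) (b x) (c x)).
Proof. by move=> ma mb mc; apply: meas_pair => //; exact: meas_pair. Qed.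

Lemma mreal_dot f g : measurable_fun setT f -> measurable_fun setT g ->
  mreal (fun x => dot (f x) (g x)).
Proof.
move=> mf mg; rewrite /dot.
apply: mreal_add; [apply: mreal_add|]; apply: mreal_mul;
  by do ?[apply: meas_fst|apply: meas_snd].
Qed.

Lemma mreal_enorm f : measurable_fun setT f -> mreal (fun x => enorm (f x)).
Proof. by move=> mf; apply: mreal_sqrt; exact: mreal_dot. Qed.

Lemma meas_scale3 a f : mreal a -> measurable_fun setT f ->
  measurable_fun setT (fun x => scale3 (a x) (f x)).
Proof.
move=> ma mf; apply: meas_vec3; apply: mreal_mul => //;
  by do ?[apply: meas_fst|apply: meas_snd].
Qed.

Lemma meas_cross f g : measurable_fun setT f -> measurable_fun setT g ->
  measurable_fun setT (fun x => cross (f x) (g x)).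
Proof.
move=> mf mg; apply: meas_vec3; apply: mreal_add; try apply: mreal_opp;
  apply: mreal_mul; by do ?[apply: meas_fst|apply: meas_snd].
Qed.

Lemma meas_add3 f g : measurable_fun setT f -> measurable_fun setT g ->
  measurable_fun setT (fun x => f x + g x).
Proof.
move=> mf mg.
have h : measurable_fun setT (fun x => vec3 ((f x).1.1 + (g x).1.1)
    ((f x).1.2 + (g x).1.2) ((f x).2 + (g x).2)).
  apply: meas_vec3; apply: mreal_add; by do ?[apply: meas_fst|apply: meas_snd].
exact: h.
Qed.

Lemma meas_opp3 f : measurable_fun setT f -> measurable_fun setT (fun x => - f x).
Proof.
move=> mf.
have h : measurable_fun setT (fun x => vec3 (- (f x).1.1) (- (f x).1.2) (- (f x).2)).
  apply: meas_vec3; apply: mreal_opp; by do ?[apply: meas_fst|apply: meas_snd].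
exact: h.
Qed.

Lemma meas_if3 (h : T -> bool) f g : measurable_fun setT h ->
  measurable_fun setT f -> measurable_fun setT g ->
  measurable_fun setT (fun x => if h x then f x else g x).
Proof. exact: measurable_fun_ifT. Qed.

Lemma meas_ortho f : measurable_fun setT f -> measurable_fun setT (fun x => Defs.ortho (f x)).
Proof.
move=> mf; apply: meas_if3.
- by apply: measurable_and; apply: mbool_eq; try exact: measurable_cst;
    do ?[apply: meas_fst|apply: meas_snd].
- exact: measurable_cst.
- apply: meas_scale3.
    apply: mreal_inv; apply: mreal_sqrt; apply: mreal_add; apply: mreal_exprn;
      by do ?[apply: meas_fst|apply: meas_snd].
  apply: meas_vec3; last exact: measurable_cst.
    by apply: mreal_opp; do ?[apply: meas_fst|apply: meas_snd].
  by do ?[apply: meas_fst|apply: meas_snd].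
Qed.

Lemma meas_sphere_point f a b : measurable_fun setT f -> mreal a -> mreal b ->
  measurable_fun setT (fun x => sphere_point (f x) (a x) (b x)).
Proof.
move=> mf ma mb; apply: meas_add3; apply: meas_scale3 => //; try exact: mreal_cos.
  exact: mreal_sin.
apply: meas_add3; apply: meas_scale3.
- exact: mreal_cos.
- exact: meas_ortho.
- exact: mreal_sin.
- by apply: meas_cross => //; exact: meas_ortho.
Qed.

End MeasurabilityR3.

(** Measurability by recursion on the syntax of the function. *)
Ltac mfun := repeat match goal with
  | |- measurable_fun _ (fun x => ?c) => exact (@measurable_cst _ _ _ _ _ c)
  | |- measurable_fun _ (fun x => x) => exact (@measurable_id _ _ _)
  | |- measurable_fun _ ?f =>
      match goal with H : measurable_fun _ ?g |- _ => constr_eq f g; exact H end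
  | |- measurable_fun _ (fun x => (@?f x) + (@?g x)) => refine (@mreal_add _ _ _ f g _ _)
  | |- measurable_fun _ (fun x => (@?f x) * (@?g x)) => refine (@mreal_mul _ _ _ f g _ _)
  | |- measurable_fun _ (fun x => - (@?f x)) => refine (@mreal_opp _ _ _ f _)
  | |- measurable_fun _ (fun x => (@?f x) ^+ ?n) => refine (@mreal_exprn _ _ _ f n _)
  | |- measurable_fun _ (fun x => (@?f x) + (@?g x)) => refine (@meas_add3 _ _ _ f g _ _)
  | |- measurable_fun _ (fun x => - (@?f x)) => refine (@meas_opp3 _ _ _ f _)
  | |- measurable_fun _ (fun x => vec3 (@?f x) (@?g x) (@?h x)) => refine (@meas_vec3 _ _ _ f g h _ _ _)
  | |- measurable_fun _ (fun x => dot (@?f x) (@?g x)) => refine (@mreal_dot _ _ _ f g _ _)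
  | |- measurable_fun _ (fun x => enorm (@?f x)) => refine (@mreal_enorm _ _ _ f _)
  | |- measurable_fun _ (fun x => scale3 (@?f x) (@?g x)) => refine (@meas_scale3 _ _ _ f g _ _)
  | |- measurable_fun _ (fun x => cross (@?f x) (@?g x)) => refine (@meas_cross _ _ _ f g _ _)
  | |- measurable_fun _ (fun x => Defs.ortho (@?f x)) => refine (@meas_ortho _ _ _ f _)
  | |- measurable_fun _ (fun x => sphere_point (@?e x) (@?f x) (@?g x)) =>
      refine (@meas_sphere_point _ _ _ e f g _ _ _)
  | |- measurable_fun _ (fun x => (@?f x)^-1) => refine (@mreal_inv _ _ _ f _)
  | |- measurable_fun _ (fun x => cos (@?f x)) => refine (@mreal_cos _ _ _ f _)
  | |- measurable_fun _ (fun x => sin (@?f x)) => refine (@mreal_sin _ _ _ f _)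
  | |- measurable_fun _ (fun x => tan (@?f x)) => refine (@mreal_tan _ _ _ f _)
  | |- measurable_fun _ (fun x => Num.sqrt (@?f x)) => refine (@mreal_sqrt _ _ _ f _)
  | |- measurable_fun _ (fun x => expR (@?f x)) => refine (@mreal_expR _ _ _ f _)
  | |- measurable_fun _ (fun x => (@?f x) `^ ?a) => refine (@mreal_powR _ _ _ f a _)
  | |- measurable_fun _ (fun x => `|@?f x|) => refine (@mreal_norm _ _ _ f _)
  | |- measurable_fun _ (fun x => Num.max (@?f x) (@?g x)) => refine (@mreal_max _ _ _ f g _ _)
  | |- measurable_fun _ (fun x => (@?f x)%:E) => refine (@mereal_EFin _ _ _ f _)
  | |- measurable_fun _ (fun x => fine (@?f x)) => refine (@mreal_fine _ _ _ f _)
  | |- measurable_fun _ (fun x => ((@?f x) * (@?g x))%E) => refine (@mereal_mul _ _ _ f g _ _)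
  | |- measurable_fun _ (fun x => ((@?f x) + (@?g x))%E) => refine (@mereal_add _ _ _ f g _ _)
  | |- measurable_fun _ (fun x => \1_?D (@?f x)) => refine (@mreal_indic _ _ _ _ _ D f _ _)
  | |- measurable_fun _ (fun x => ((@?f x), (@?g x))) => refine (@meas_pair _ _ _ _ _ _ f g _ _)
  | |- measurable_fun _ (fun x => (@?f x).1) => refine (@meas_fst _ _ _ _ _ _ f _)
  | |- measurable_fun _ (fun x => (@?f x).2) => refine (@meas_snd _ _ _ _ _ _ f _)
  | |- measurable_fun _ (fun x => ?f (@?g x)) =>
      match goal with H : measurable_fun _ ?h |- _ => constr_eq f h;
        refine (measurableT_comp (f := f) (g := g) H _) end
  | |- measurable_fun _ (fun x => (@?f x) == (@?g x)) => refine (@mbool_eq _ _ _ f g _ _)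
  | |- measurable_fun _ (fun x => (@?f x) <= (@?g x)) => refine (@mbool_le _ _ _ f g _ _)
  | |- measurable_fun _ (fun x => (@?f x) < (@?g x)) => refine (@mbool_lt _ _ _ f g _ _)
  | |- measurable_fun _ (fun x => (@?f x) && (@?g x)) => apply: measurable_and
  | |- measurable_fun _ (fun x => if _ then _ else _) => apply: mreal_if
  | |- measurable_fun _ (fun x => (\int[?m]_(y in ?D) @?f x y)%E) =>
      refine (@meas_integral _ _ _ _ _ m D f _ _ _)
  end; try (exact: measurable_itv).

(** Nonnegativity by recursion on the syntax of the expression. *)
Ltac epos := repeat (intros; cbv beta; match goal with
  | |- is_true (_ <= (\int[_]_(x in _) _)%E)%E => apply: integral_ge0
  | |- is_true (_ <= (_ * _)%E)%E => apply: mule_ge0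
  | |- is_true (_ <= (_ + _)%E)%E => apply: adde_ge0
  | |- is_true (_ <= _%:E)%E => rewrite lee_fin
  | |- is_true (0 <= `|_|) => exact: normr_ge0
  | |- is_true (0 <= _ * _) => apply: mulr_ge0
  | |- is_true (0 <= _ + _) => apply: addr_ge0
  | |- is_true (0 <= _ ^+ 2) => exact: sqr_ge0
  | |- is_true (0 <= _^-1) => rewrite invr_ge0
  | |- is_true (0 <= expR _) => exact: expR_ge0
  | |- is_true (0 <= _ `^ _) => exact: powR_ge0
  | |- is_true (0 <= Num.sqrt _) => exact: sqrtr_ge0
  | |- is_true (0 <= enorm _) => exact: sqrtr_ge0
  | H : _ |- is_true (_ <= _)%E => exact: H
  end); auto.

Lemma ge0Zl d (T : measurableType d) (R : realType) (m : {measure set T -> \bar R})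
  (D : set T) (k : \bar R) (f : T -> \bar R) : measurable D -> measurable_fun setT f ->
  (forall x, 0 <= f x)%E -> (0 <= k)%E ->
  (\int[m]_(x in D) (k * f x) = k * \int[m]_(x in D) f x)%E.
Proof.
by move=> mD mf f0 k0; rewrite ge0_integralZl//; exact: measurable_funTS.
Qed.

(** * One-dimensional substitution *)

Section OneDimensionalSubstitution.
Import HBNNSimple.
Context (R : realType).
Notation mu := (@lebesgue_measure R).
Notation RR := (measurableTypeR R).

(** Two measures that agree on bounded intervals coincide, so the image under
    [T] of the measure of density [d] is Lebesgue measure. That measure is
    realized as the area of the region [E] below the graph of [d]. *)
Lemma ge0_integral_subst (T d : RR -> RR) :
  mreal T -> mreal d -> (forall x, 0 <= d x) ->
  (forall a b : R, (a < b)%R ->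
    \int[mu]_x (d x * \1_(`]a, b]%classic : set R) (T x))%:E = (b - a)%:E)%E ->
  forall f : RR -> \bar R, measurable_fun setT f -> (forall x, 0 <= f x)%E ->
  (\int[mu]_x f x = \int[mu]_x ((d x)%:E * f (T x)))%E.
Proof.
move=> mT md d0 Tab f mf f0.
pose E := [set p : RR * RR | (0 < p.2 <= d p.1)].
have mE : measurable E.
  have -> : E = setT `&` (fun p : RR * RR => (0 < p.2) && (p.2 <= d p.1)) @^-1` [set true].
    by rewrite setTI; apply/seteqP; split.
  have mE' : measurable_fun setT (fun p : RR * RR => (0 < p.2) && (p.2 <= d p.1)).
    by mfun.
  exact: mE'.
pose m2 : {measure set (RR * RR) -> \bar R} := (mu \x mu)%E.
pose mr : {measure set (RR * RR) -> \bar R} := mrestr m2 mE.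
have mTf : mreal (fun p : RR * RR => T p.1) by mfun.
pose nu0 : {measure set RR -> \bar R} := pushforward mr (fun p : RR * RR => T p.1).
pose nu := nu0 mTf.
have nuE A : measurable A -> (nu A = \int[mu]_x (d x * \1_A (T x))%:E)%E.
  move=> mA; rewrite /nu/= /pushforward /mr/= /mrestr /m2/= /product_measure1.
  apply: eq_integral => x _ /=.
  have -> : xsection ((fun p : RR * RR => T p.1) @^-1` A `&` E) x =
      if T x \in A then [set` `]0, d x]] else set0.
    apply/seteqP; split => z; rewrite /xsection/= inE/=.
      by case=> Tx Ez; rewrite mem_set//= in_itv.
    case: ifPn => //; rewrite inE => Ax; rewrite /= in_itv/= => h; by split.
  rewrite indicE; case: ifPn => _; last by rewrite measure0 mulr0.
  rewrite mulr1 lebesgue_measure_itv/= lte_fin.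
  have [_|d0'] := ltP 0 (d x); first by rewrite oppr0 adde0.
  by congr (_%:E); apply/eqP; rewrite eq_le d0' d0.
have muE A : measurable A -> (mu A = \int[mu]_x (d x * \1_A (T x))%:E)%E.
  move=> mA; rewrite -nuE//; apply: lebesgue_measure_unique => // X [[a b]] _ <-.
  have [ab|ba] := ltP a b.
    by rewrite nuE// Tab// lebesgue_measure_itv/= lte_fin ab.
  by rewrite set_itv_ge ?measure0// bnd_simp -leNgt.
pose h := nnsfun_approx measurableT mf.
have md' : measurable_fun setT (fun x => (d x)%:E) by mfun.
have mh n : mreal (h n : RR -> RR) by exact: (@measurable_funP _ _ RR R setT (h n)).
have mhT n : measurable_fun setT (fun x => (h n (T x))%:E).
  have mhn := mh n.
  by mfun.
transitivity (limn (fun n => \int[mu]_x (h n x)%:E))%E.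
  rewrite -monotone_convergence//.
  - by apply: eq_integral => x _; apply/esym/cvg_lim => //; exact: cvg_nnsfun_approx.
  - by move=> n; exact/measurable_EFinP.
  - by move=> n x _; rewrite lee_fin.
  - by move=> x _ a b ab; rewrite lee_fin; exact/lefP/nd_nnsfun_approx.
transitivity (limn (fun n => \int[mu]_x ((d x)%:E * (h n (T x))%:E)))%E; last first.
  rewrite -monotone_convergence//.
  - apply: eq_integral => x _; apply/cvg_lim => //.
    by apply: cvgeZl => //; exact: cvg_nnsfun_approx.
  - by move=> n; exact: emeasurable_funM.
  - by move=> n x _; rewrite mule_ge0 ?lee_fin.
  - move=> x _ a b ab; rewrite lee_wpmul2l ?lee_fin//.
    exact/lefP/nd_nnsfun_approx.
congr (limn _); apply/funext => n.
have mpre r : measurable (h n @^-1` [set r]) by exact: measurable_sfunP.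
under eq_integral do rewrite fimfunE -fsumEFin//.
rewrite ge0_integral_fsum//; last 2 first.
- by move=> r; apply/measurable_EFinP/measurable_funM.
- by move=> r x _; rewrite nnfun_muleindic_ge0.
under [RHS]eq_integral.
  move=> x _; rewrite fimfunE -fsumEFin// ge0_mule_fsumr; last first.
    by move=> r; rewrite nnfun_muleindic_ge0.
  over.
have mi r : mreal (fun x => \1_(h n @^-1` [set r]) (T x) : R).
  exact: mreal_indic.
rewrite ge0_integral_fsum//; last 2 first.
- move=> r; apply: mereal_mul; first by mfun.
  by apply: mereal_EFin; apply: mreal_mul => //; exact: measurable_cst.
- by move=> r x _; rewrite mule_ge0 ?lee_fin// -lee_fin nnfun_muleindic_ge0.
apply: eq_fsbigr => r rn.
have r0 : 0 <= r by move: rn; rewrite inE/= => -[x _ <-].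
rewrite integralZl_indic_nnsfun// integral_indic// setIT.
rewrite [X in (_ * X)%E = _](muE _ (mpre r)).
rewrite -ge0_integralZl//; last 2 first.
- by apply: mereal_EFin; apply: mreal_mul.
- by move=> x _; rewrite lee_fin mulr_ge0.
by apply: eq_integral => x _; rewrite -!EFinM mulrCA.
Qed.

Lemma ge0_integral_affine (a c : R) (f : RR -> \bar R) : a != 0 ->
  measurable_fun setT f -> (forall x, 0 <= f x)%E ->
  (\int[mu]_x f x = `|a|%:E * \int[mu]_x f (a * x + c)%R)%E.
Proof.
move=> a0 mf f0.
have mT : mreal (fun x : RR => a * x + c : RR) by mfun.
rewrite (@ge0_integral_subst (fun x => a * x + c) (cst `|a|))//; last first.
  move=> p q pq.
  pose D : set RR := if 0 < a then [set` `](p - c) / a, (q - c) / a]]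
           else [set` `[(q - c) / a, (p - c) / a[].
  have DE x : \1_(`]p, q]%classic : set R) (a * x + c) = \1_D x :> R.
    rewrite !indicE; congr (_%:R); congr nat_of_bool.
    apply/idP/idP; rewrite !inE/= /D in_itv/=; case: ifPn => a0'/=; rewrite in_itv/=.
    - by rewrite ltr_pdivrMr// ler_pdivlMr// (mulrC x) ltrBlDr lerBrDr.
    - have {}a0' : a < 0 by rewrite lt_neqAle a0 leNgt.
      by rewrite ler_ndivrMr// ltr_ndivlMr// (mulrC x) lerBrDr ltrBlDr andbC.
    - by rewrite ltr_pdivrMr// ler_pdivlMr// (mulrC x) ltrBlDr lerBrDr.
    - have {}a0' : a < 0 by rewrite lt_neqAle a0 leNgt.
      by rewrite ler_ndivrMr// ltr_ndivlMr// (mulrC x) lerBrDr ltrBlDr andbC.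
  under eq_integral do rewrite DE EFinM.
  have mD : measurable D by rewrite /D; case: ifP => _; exact: measurable_itv.
  rewrite /cst ge0_integralZl ?lee_fin//; last first.
    by apply: mereal_EFin; exact: mreal_indic.
  rewrite integral_indic// setIT /D; case: ifPn => a0'.
    rewrite [X in (_ * X)%E](lebesgue_measure_itv (Interval _ _))/= lte_fin ltr_pM2r ?invr_gt0// ltrD2r pq.
    by rewrite -EFinB -EFinM gtr0_norm//; congr EFin; field.
  have {}a0' : a < 0 by rewrite lt_neqAle a0 leNgt.
  rewrite [X in (_ * X)%E](lebesgue_measure_itv (Interval _ _))/= lte_fin ltr_nM2r ?invr_lt0// ltrD2r pq.
  by rewrite -EFinB -EFinM ltr0_norm//; congr EFin; field.
rewrite /cst ge0_integralZl// ?lee_fin//.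
exact: (measurableT_comp mf mT).
Qed.

Lemma ge0_integral_tan (f : RR -> \bar R) :
  measurable_fun setT f -> (forall x, 0 <= f x)%E ->
  (\int[mu]_x f x =
   \int[mu]_(x in `](- (pi / 2))%R, (pi / 2)%R[) (((cos x) ^- 2)%:E * f (tan x)))%E.
Proof.
move=> mf f0.
pose D : set RR := [set` `]- (pi / 2), pi / 2[].
have mD : measurable D by exact: measurable_itv.
pose d (x : RR) : RR := (cos x) ^- 2 * \1_D x.
have md : mreal d by rewrite /d; mfun; exact: mD.
have mt : mreal (fun x : RR => tan x : RR) by mfun.
have d0 x : 0 <= d x by rewrite /d mulr_ge0// invr_ge0 sqr_ge0.
rewrite (@ge0_integral_subst tan d)//; last first.
  move=> a b ab.
  have ab' : atan a < atan b by rewrite lt_atan.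
  have cpos x : x \in `[atan a, atan b] -> 0 < cos x.
    rewrite in_itv/= => /andP[ax xb]; apply: cos_gt0_pihalf.
    by rewrite (lt_le_trans (atan_gtNpi2 a) ax) (le_lt_trans xb (atan_ltpi2 b)).
  transitivity (\int[mu]_(x in `]atan a, atan b]) ((cos x) ^- 2)%:E)%E.
    rewrite [RHS]integral_mkcond; apply: eq_integral => x _.
    rewrite epatch_indic /d -EFinM -mulrA; congr (_%:E); congr (_ * _).
    rewrite !indicE -natrM mulnb; congr (_%:R); congr nat_of_bool.
    apply/idP/idP.
      move=> /andP[]; rewrite !inE/= /D/= !in_itv/= => xD /andP[ax xb].
      rewrite -(tanK (x := x)) ?in_itv//=.
      by rewrite lt_atan//= le_atan.
    rewrite !inE/= /D/= !in_itv/= => /andP[ax xb].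
    have xD : - (pi / 2) < x < pi / 2.
      by rewrite (lt_trans (atan_gtNpi2 a) ax) (le_lt_trans xb (atan_ltpi2 b)).
    have aI : atan a \in `]- (pi / 2), pi / 2[ by rewrite in_itv/= atan_gtNpi2 atan_ltpi2.
    have bI : atan b \in `]- (pi / 2), pi / 2[ by rewrite in_itv/= atan_gtNpi2 atan_ltpi2.
    have xI : x \in `]- (pi / 2), pi / 2[ by rewrite in_itv/=.
    apply/andP; split; rewrite inE/= in_itv//=.
    by rewrite -{1}(atanK a) -(atanK b) ltr_tan// ax/= leNgt ltr_tan// -leNgt.
  rewrite integral_itv_obnd_cbnd; last first.
    apply/measurable_EFinP; apply: measurable_funTS.
    by have : mreal (fun x : RR => (cos x) ^- 2 : RR) by mfun.
  rewrite (@continuous_FTC2 R (fun x : R => cos x ^- 2) tan)//.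
  - by rewrite !atanK.
  - apply: continuous_in_subspaceT => x; rewrite inE/= => xab.
    have cx := cpos _ xab.
    apply: cvgV; first by rewrite expf_neq0// gt_eqF.
    by apply: (@continuous_comp R R R cos (fun y => y ^+ 2));
      [exact: continuous_cos|exact: exprn_continuous].
  - split.
    + move=> x xab; apply: derivable_tan; rewrite gt_eqF// cpos//.
      exact: subset_itv_oo_cc.
    + apply: cvg_at_right_filter; apply: continuous_tan.
      by rewrite gt_eqF// cpos// in_itv/= lexx ltW.
    + apply: cvg_at_left_filter; apply: continuous_tan.
      by rewrite gt_eqF// cpos// in_itv/= lexx ltW.
  - move=> x xab.
    have cx : cos x != 0 by rewrite gt_eqF// cpos//; exact: subset_itv_oo_cc.
    by rewrite derive1E; have /@derive_val := is_derive_tan cx.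
rewrite [RHS]integral_mkcond; apply: eq_integral => x _.
by rewrite epatch_indic /d EFinM muleAC.
Qed.

End OneDimensionalSubstitution.

(** The measure [lebesgue3] again, in a form that carries its sigma-finiteness. *)
Definition leb3 (R : realType) : {sigma_finite_measure set (R3 R) -> \bar R} :=
  prod_measure (prod_measure (@lebesgue_measure R) (@lebesgue_measure R))
    (@lebesgue_measure R).

(** * Polar coordinates *)

Section PolarCoordinates.
Context (R : realType).
Notation mu := (@lebesgue_measure R).
Notation RR := (measurableTypeR R).

Lemma mpos : measurable ([set` `]0%R, +oo[] : set RR).
Proof. exact: measurable_itv. Qed.

Lemma ge0_integral_affine_set (a c : R) (D D' : set RR) (f : RR -> \bar R) : a != 0 ->
  measurable D -> measurable D' -> (forall x, D' x <-> D (a * x + c)) ->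
  measurable_fun setT f -> (forall x, 0 <= f x)%E ->
  (\int[mu]_(x in D) f x = `|a|%:E * \int[mu]_(x in D') f (a * x + c)%R)%E.
Proof.
move=> a0 mD mD' DD' mf f0.
rewrite integral_mkcond (eq_integral (fun x => (f x * (\1_D x)%:E)%E)); last first.
  by move=> x _; rewrite epatch_indic.
have mfD : measurable_fun setT (fun x => f x * (\1_D x)%:E)%E.
  by mfun; exact: mD.
rewrite (ge0_integral_affine c a0 mfD); last by move=> x; rewrite mule_ge0// lee_fin.
congr (_ * _)%E; rewrite [RHS]integral_mkcond; apply: eq_integral => x _.
rewrite epatch_indic; congr (_ * _%:E)%E; rewrite !indicE; congr (_%:R); congr nat_of_bool.
by apply/idP/idP; rewrite !inE => /DD'.
Qed.

(** Two one-dimensional substitutions, [x = y * tan t] at fixed height [y] and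
    [y = r * cos t] at fixed angle, replace the Jacobian of the plane. *)
Lemma polar_halfplane (f : RR * RR -> \bar R) :
  measurable_fun setT f -> (forall p, 0 <= f p)%E ->
  (\int[mu]_(y in `]0%R, +oo[) \int[mu]_x f (x, y) =
   \int[mu]_(r in `]0%R, +oo[) \int[mu]_(t in `]0%R, pi[)
     (r%:E * f (r * cos t, r * sin t)%R))%E.
Proof.
move=> mf f0.
have mpi2 : measurable ([set` `]- (pi / 2), pi / 2[] : set RR) by exact: measurable_itv.
have mfy (y : RR) : measurable_fun setT (fun x : RR => f (x, y)) by mfun.
transitivity (\int[mu]_(y in `]0%R, +oo[) \int[mu]_(t in `](- (pi / 2))%R, (pi / 2)%R[)
   ((`|y| * (cos t) ^- 2)%:E * f (y * tan t, y)%R))%E.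
  apply: eq_integral => y; rewrite inE/= in_itv/= andbT => y0.
  rewrite (@ge0_integral_affine _ y 0 (fun x => f (x, y)))// ?gt_eqF//.
  under eq_integral do rewrite addr0.
  have mfy' : measurable_fun setT (fun x : RR => f (y * x, y)%R) by mfun.
  rewrite (ge0_integral_tan mfy')// -ge0_integralZl//.
  - by apply: eq_integral => t _; rewrite muleA -EFinM.
  - by apply: measurable_funTS; mfun.
  - by move=> t _; rewrite mule_ge0// lee_fin invr_ge0 sqr_ge0.
rewrite [LHS](@tonelli _ _ _ _ R mu mu); last 4 first.
- exact: mpos.
- exact: mpi2.
- by mfun.
- by move=> x y _ _; rewrite mule_ge0// lee_fin mulr_ge0// invr_ge0 sqr_ge0.
transitivity (\int[mu]_(t in `](- (pi / 2))%R, (pi / 2)%R[) \int[mu]_(r in `]0%R, +oo[)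
   (r%:E * f (r * sin t, r * cos t)%R))%E.
  apply: eq_integral => t; rewrite inE/= in_itv/= => tI.
  have ct : 0 < cos t by exact: cos_gt0_pihalf.
  rewrite (@ge0_integral_affine_set (cos t) 0 _ [set` `]0%R, +oo[])// ?gt_eqF//; last 3 first.
  - by move=> x; rewrite /= !in_itv/= !andbT addr0 pmulr_rgt0.
  - by mfun.
  - by move=> x; rewrite mule_ge0// lee_fin mulr_ge0// invr_ge0 sqr_ge0.
  rewrite -ge0_integralZl// ?lee_fin//; last 2 first.
  - by apply: measurable_funTS; mfun.
  - by move=> x _; rewrite mule_ge0// lee_fin mulr_ge0// invr_ge0 sqr_ge0.
  apply: eq_integral => r; rewrite inE/= in_itv/= andbT => r0.
  rewrite addr0 muleA -EFinM.
  have -> : `|cos t| * (`|cos t * r| * cos t ^- 2) = r.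
    by rewrite normrM !gtr0_norm//; field; rewrite gt_eqF.
  congr (_ * f (_, _))%E; last by rewrite mulrC.
  by rewrite /tan; field; rewrite gt_eqF.
rewrite [LHS](@tonelli _ _ _ _ R mu mu); last 4 first.
- exact: mpi2.
- exact: mpos.
- by mfun.
- by move=> t r _; rewrite /= in_itv/= andbT => r0; rewrite mule_ge0// lee_fin ltW.
apply: eq_integral => r; rewrite inE/= in_itv/= andbT => r0.
have mpi : measurable ([set` `]0, pi[] : set RR) by exact: measurable_itv.
rewrite [RHS](@ge0_integral_affine_set (-1) (pi / 2) _ [set` `]- (pi / 2), pi / 2[])//; last 3 first.
- by move=> x; rewrite /= !in_itv/= mulN1r; split => /andP[? ?]; apply/andP; split; lra.
- by mfun.
- by move=> t; rewrite mule_ge0// lee_fin ltW.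
rewrite normrN normr1 mul1e; apply: eq_integral => t _.
by rewrite mulN1r addrC cosB sinB cos_pihalf sin_pihalf !mul0r !mul1r add0r subr0.
Qed.

(** The lower half-plane is carried to the upper one by the antipodal map. *)
Lemma polar_plane (f : RR * RR -> \bar R) :
  measurable_fun setT f -> (forall p, 0 <= f p)%E ->
  (\int[mu]_y \int[mu]_x f (x, y) =
   \int[mu]_(r in `]0%R, +oo[) \int[mu]_(t in `[0%R, (2 * pi)%R])
     (r%:E * f (r * cos t, r * sin t)%R))%E.
Proof.
move=> mf f0.
have mneg : measurable ([set` `]-oo, 0[] : set RR) by exact: measurable_itv.
have mF : measurable_fun setT (fun y : RR => \int[mu]_x f (x, y))%E.
  by apply: meas_integral => //; mfun.
have F0 y : (0 <= \int[mu]_x f (x, y))%E by exact: integral_ge0.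
have TE : setT = [set` `]-oo, 0[] `|` [set` `[0, +oo[] :> set RR.
  by apply/seteqP; split => // y _ /=; rewrite !in_itv/= andbT; case: (ltP y 0); [left|right].
rewrite [LHS](_ : _ = \int[mu]_(y in [set` `]-oo, 0%R[] `|` [set` `[0%R, +oo[])
    \int[mu]_x f (x, y))%E; last by rewrite -TE.
rewrite ge0_integral_setU//; last 2 first.
- exact: measurable_funTS.
- apply/disj_setPRL => y /=; rewrite !in_itv/= andbT => y0; apply/negP.
  by rewrite -leNgt.
rewrite -(@integral_itv_obnd_cbnd _ 0); last exact: measurable_funTS.
have half (g : RR * RR -> \bar R) : measurable_fun setT g -> (forall p, 0 <= g p)%E ->
    (\int[mu]_(y in `]0%R, +oo[) \int[mu]_x g (x, y) =
     \int[mu]_(r in `]0%R, +oo[) \int[mu]_(t in `[0%R, pi])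
       (`|r|%:E * g (r * cos t, r * sin t)%R))%E.
  move=> mg g0; rewrite (polar_halfplane mg g0); apply: eq_integral => r.
  rewrite inE/= in_itv/= andbT => r0.
  under [RHS]eq_integral do rewrite gtr0_norm//.
  by rewrite [RHS]integral_itv_bndoo//; apply: measurable_funTS; mfun.
have -> : (\int[mu]_(y in `]-oo, 0%R[) \int[mu]_x f (x, y) =
    \int[mu]_(y in `]0%R, +oo[) \int[mu]_x f (- x, - y)%R)%E.
  rewrite (@ge0_integral_affine_set (-1) 0 _ [set` `]0, +oo[])//; last first.
    by move=> x; rewrite /= !in_itv/= andbT; split => ?; lra.
  rewrite normrN normr1 mul1e; apply: eq_integral => y _.
  rewrite (@ge0_integral_affine R (-1) 0)//; last by mfun.
  rewrite normrN normr1 mul1e; apply: eq_integral => x _.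
  by rewrite !mulN1r !addr0.
have mfN : measurable_fun setT (fun p : RR * RR => f (- p.1, - p.2)%R) by mfun.
rewrite (half f mf f0) (half _ mfN)//.
rewrite -ge0_integralD//=; last 4 first.
- by move=> r _; apply: integral_ge0 => t _; rewrite mule_ge0.
- by apply: measurable_funTS; mfun => //= r t; rewrite mule_ge0.
- by move=> r _; apply: integral_ge0 => t _; rewrite mule_ge0.
- by apply: measurable_funTS; mfun => //= r t; rewrite mule_ge0.
apply: eq_integral => r; rewrite inE/= in_itv/= andbT => r0.
have -> : [set` `[0, 2 * pi]] = [set` `[0, pi]] `|` [set` `]pi, 2 * pi]] :> set RR.
  apply/seteqP; split => t /=; rewrite !in_itv/=.
    by move=> /andP[t0 t2]; case: (leP t pi) => tp; [left; rewrite t0|right].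
  have := pi_gt0 R.
  by move=> ? [|] /andP[? ?]; apply/andP; split; lra.
rewrite [RHS]ge0_integral_setU//; last 3 first.
- by apply: measurable_funTS; mfun.
- by move=> t _; rewrite mule_ge0// lee_fin ltW.
- apply/disj_setPRL => t /=; rewrite !in_itv/= => /andP[pt _]; apply/negP.
  by rewrite negb_and -!ltNge pt orbT.
rewrite gtr0_norm// addeC; congr (_ + _)%E.
rewrite (@integral_itv_obnd_cbnd _ pi); last by apply: measurable_funTS; mfun.
rewrite [RHS](@ge0_integral_affine_set 1 pi _ [set` `[0, pi]])//; last 3 first.
- by move=> x; rewrite /= !in_itv/= mul1r; split => /andP[? ?]; apply/andP; split; lra.
- by mfun.
- by move=> t; rewrite mule_ge0// lee_fin ltW.
rewrite normr1 mul1e; apply: eq_integral => t _.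
by rewrite mul1r cosDpi sinDpi !mulrN.
Qed.


(** When [k != 0] a linear map of determinant [+-1] is a composite of two maps
    that each move one coordinate, and these are affine substitutions. *)
Lemma ge0_integral_linear2_aux (k l m n : R) (f : RR * RR -> \bar R) : k != 0 ->
  `|k * n - l * m| = 1 -> measurable_fun setT f -> (forall p, 0 <= f p)%E ->
  (\int[mu]_y \int[mu]_x f (k * x + l * y, m * x + n * y)%R =
   \int[mu]_y \int[mu]_x f (x, y))%E.
Proof.
move=> k0 det mf f0; pose e := (k * n - l * m) / k.
have e0 : e != 0.
  rewrite mulf_neq0 ?invr_eq0//; apply/eqP => h.
  by move: det; rewrite h normr0 => /eqP; rewrite eq_sym oner_eq0.
transitivity (\int[mu]_y (`|k|^-1%:E * \int[mu]_X f (X, m / k * X + e * y)%R))%E.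
  apply: eq_integral => y _.
  rewrite [X in _ = (_ * X)%E](@ge0_integral_affine R k (l * y))//; last by mfun.
  rewrite muleA -EFinM mulVf ?normr_eq0// mul1e; apply: eq_integral => x _.
  by congr (f (_, _)); rewrite /e; field.
rewrite ge0_integralZl//; last 2 first.
- by mfun => //; mfun.
- by move=> y _; exact: integral_ge0.
rewrite (@tonelli _ _ _ _ R mu mu setT setT)//; last by mfun.
rewrite -ge0_integralZl//; last 2 first.
- by mfun => //; mfun.
- by move=> y _; exact: integral_ge0.
rewrite [RHS](@tonelli _ _ _ _ R mu mu setT setT)//; last by mfun.
apply: eq_integral => X _.
rewrite [RHS](@ge0_integral_affine R e (m / k * X))//; last by mfun.
congr (_%:E * _)%E; first by rewrite /e normrM det normfV mul1r.
by apply: eq_integral => y _; rewrite addrC.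
Qed.

Lemma ge0_integral_linear2 (k l m n : R) (f : RR * RR -> \bar R) :
  `|k * n - l * m| = 1 -> measurable_fun setT f -> (forall p, 0 <= f p)%E ->
  (\int[mu]_y \int[mu]_x f (k * x + l * y, m * x + n * y)%R =
   \int[mu]_y \int[mu]_x f (x, y))%E.
Proof.
move=> det mf f0; have [k0|k0] := eqVneq k 0; last exact: ge0_integral_linear2_aux.
have l0 : l != 0.
  apply/eqP => l0; move: det; rewrite k0 l0 !mul0r subr0 normr0 => /eqP.
  by rewrite eq_sym oner_eq0.
rewrite [LHS](@tonelli _ _ _ _ R mu mu setT setT); [|exact: measurableT|exact: measurableT|by mfun|by move=> *; exact: f0].
transitivity (\int[mu]_x \int[mu]_y f (l * y + k * x, n * y + m * x)%R)%E.
  by apply: eq_integral => x _; apply: eq_integral => y _; rewrite addrC (addrC (n * y)).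
by apply: ge0_integral_linear2_aux => //; rewrite distrC.
Qed.

Implicit Types (e xi : R3 R) (H : R3 R -> \bar R).

Lemma leb3E H : measurable_fun setT H -> (forall x, 0 <= H x)%E ->
  (\int[leb3 R]_x H x = \int[mu]_z \int[mu]_y \int[mu]_x H (vec3 x y z))%E.
Proof.
move=> mH H0.
rewrite [LHS](@fubini_tonelli2 _ _ (RR * RR)%type RR R (prod_measure mu mu) mu H mH H0).
apply: eq_integral => z _; rewrite /fubini_G.
have mHz : measurable_fun setT (fun p : RR * RR => H (p, z)) by mfun.
exact: (@fubini_tonelli2 _ _ _ _ R mu mu (fun p => H (p, z)) mHz).
Qed.

Definition frame e (v : R3 R) : R3 R :=
  scale3 v.1.1 (Defs.ortho e) + (scale3 v.1.2 (cross e (Defs.ortho e)) + scale3 v.2 e).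

Lemma unit_param e : dot e e = 1 ->
  exists k l m n : R, [/\ k ^+ 2 + l ^+ 2 = 1, m ^+ 2 + n ^+ 2 = 1,
    e = vec3 (l * m) (l * n) k & Defs.ortho e = vec3 (- n) m 0].
Proof.
case: e => [[x y] z]; rewrite /dot /= -!expr2 => e1.
rewrite /Defs.ortho/=; case: ifPn => [/andP[/eqP x0 /eqP y0]|xy].
  exists z, 0, 0, (-1); rewrite x0 y0 in e1 *; split.
  - by move: e1; rewrite expr0n/= !add0r addr0.
  - by rewrite expr0n/= add0r sqrrN expr1n.
  - by rewrite /vec3 !mul0r.
  - by rewrite opprK.
pose l := Num.sqrt (x ^+ 2 + y ^+ 2).
have l2 : l ^+ 2 = x ^+ 2 + y ^+ 2 by rewrite sqr_sqrtr// addr_ge0// sqr_ge0.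
have l0 : l != 0.
  apply/eqP => l0; move: l2; rewrite l0 expr0n/= => /esym/eqP.
  by rewrite paddr_eq0 ?sqr_ge0// !sqrf_eq0; apply/negP.
exists z, l, (x / l), (y / l); split.
- by rewrite l2 addrC.
- by rewrite !expr_div_n -mulrDl -l2 divff// expf_neq0.
- by rewrite /vec3; congr (_, _, _); field.
- by rewrite /scale3 /vec3/= -/l; congr (_, _, _); rewrite ?mulr0// mulrC ?mulNr.
Qed.

(** The frame is, up to reflections, a rotation in the first two coordinates
    after a rotation in the last two; invariance of Lebesgue measure under it
    thus reduces to the plane. *)
Lemma frameE e : dot e e = 1 ->
  exists k l m n : R, [/\ k ^+ 2 + l ^+ 2 = 1, m ^+ 2 + n ^+ 2 = 1 &
    forall a b c, frame e (vec3 a b c) =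
      vec3 (- n * a + m * (- k * b + l * c)) (m * a + n * (- k * b + l * c)) (l * b + k * c)].
Proof.
move=> /unit_param[k [l [m [n [kl mn eE oE]]]]]; exists k, l, m, n; split => // a b c.
rewrite /frame oE eE /cross /scale3 /vec3 /=.
have -> : l * m * m - l * n * - n = l by rewrite -[RHS]mulr1 -mn; ring.
by congr (_, _, _); rewrite /=; ring.
Qed.

Lemma meas_frame e : measurable_fun setT (frame e).
Proof. by rewrite /frame; mfun. Qed.

Lemma ge0_integral_frame e H : dot e e = 1 ->
  measurable_fun setT H -> (forall x, 0 <= H x)%E ->
  (\int[leb3 R]_x H (frame e x) = \int[leb3 R]_x H x)%E.
Proof.
move=> e1 mH H0.
have [k [l [m [n [kl mn fE]]]]] := frameE e1.
have mfr := meas_frame e.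
have mHf : measurable_fun setT (fun x => H (frame e x)) by mfun.
rewrite (leb3E mHf (fun x => H0 _)) (leb3E mH H0).
transitivity (\int[mu]_q \int[mu]_p \int[mu]_a
    H (vec3 (- n * a + m * p) (m * a + n * p) q))%E.
  pose G a := fun p : RR * RR => H (vec3 (- n * a + m * p.1) (m * a + n * p.1) p.2).
  transitivity (\int[mu]_c \int[mu]_b \int[mu]_a G a (- k * b + l * c, l * b + k * c)%R)%E.
    apply: eq_integral => c _; apply: eq_integral => b _; apply: eq_integral => a _.
    by rewrite fE.
  transitivity (\int[mu]_a \int[mu]_c \int[mu]_b G a (- k * b + l * c, l * b + k * c)%R)%E.
    rewrite [RHS](@tonelli _ _ _ _ R mu mu setT setT); last 4 first.
    - exact: measurableT.
    - exact: measurableT.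
    - by rewrite /G; mfun.
    - by move=> *; apply: integral_ge0 => ? _; exact: H0.
    apply: eq_integral => c _.
    by rewrite [RHS](@tonelli _ _ _ _ R mu mu setT setT)//; rewrite /G; mfun.
  transitivity (\int[mu]_a \int[mu]_q \int[mu]_p G a (p, q))%E.
    apply: eq_integral => a _; apply: ge0_integral_linear2 => //.
    - rewrite (_ : _ - _ = -1) ?normrN1//.
      by rewrite -kl; ring.
    - by rewrite /G; mfun.
    - by move=> *; exact: H0.
  rewrite [LHS](@tonelli _ _ _ _ R mu mu setT setT); last 4 first.
  - exact: measurableT.
  - exact: measurableT.
  - by rewrite /G; mfun.
  - by move=> *; apply: integral_ge0 => ? _; exact: H0.
  apply: eq_integral => q _.
  by rewrite [LHS](@tonelli _ _ _ _ R mu mu setT setT)//; rewrite /G; mfun.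
apply: eq_integral => q _.
pose G := fun p : RR * RR => H (vec3 p.1 p.2 q).
apply: (@ge0_integral_linear2 (- n) m m n G) => //.
- rewrite (_ : _ - _ = -1) ?normrN1//.
  by rewrite -mn; ring.
- by rewrite /G; mfun.
- by move=> *; exact: H0.
Qed.


Lemma sphere_pointE e t w : sphere_point e t w =
  frame e (vec3 (sin t * cos w) (sin t * sin w) (cos t)).
Proof.
rewrite /sphere_point /frame /scale3 /vec3 /=.
by congr (_, _, _); rewrite /=; ring.
Qed.

Lemma frame_scale3 e r v : frame e (scale3 r v) = scale3 r (frame e v).
Proof.
by rewrite /frame /scale3 /vec3 /=; congr (_, _, _); rewrite /=; ring.
Qed.

(** The surface integral of a nonnegative function; the absolute value makes the
    integrand nonnegative for every [t]. *)
Definition sphere_int e H : \bar R :=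
  (\int[mu]_(t in `[0%R, pi]) \int[mu]_(w in `[0%R, (2 * pi)%R])
     (`|sin t|%:E * H (sphere_point e t w)))%E.

Lemma m0pi : measurable ([set` `[0, pi]] : set RR).
Proof. exact: measurable_itv. Qed.

Lemma m02pi : measurable ([set` `[0, 2 * pi]] : set RR).
Proof. exact: measurable_itv. Qed.

Lemma polar_space e H : dot e e = 1 -> measurable_fun setT H -> (forall x, 0 <= H x)%E ->
  (\int[leb3 R]_x H x =
   \int[mu]_(r in `]0%R, +oo[) ((r ^+ 2)%:E * sphere_int e (fun s => H (scale3 r s))))%E.
Proof.
move=> e1 mH H0; rewrite -(ge0_integral_frame e1 mH H0).
have mfr := meas_frame e.
have mHf : measurable_fun setT (fun x => H (frame e x)) by mfun.
rewrite (leb3E mHf (fun x => H0 _)).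
pose G (w : RR) := fun p : RR * RR =>
  (`|p.2|%:E * H (frame e (vec3 (p.2 * cos w) (p.2 * sin w) p.1)))%E.
have mG (w : RR) : measurable_fun setT (G w) by rewrite /G; mfun.
have G0 w p : (0 <= G w p)%E by rewrite /G mule_ge0.
transitivity (\int[mu]_z \int[mu]_(r in `]0%R, +oo[) \int[mu]_(w in `[0%R, (2 * pi)%R]) G w (z, r))%E.
  apply: eq_integral => z _.
  have mHz : measurable_fun setT (fun p : RR * RR => H (frame e (vec3 p.1 p.2 z))) by mfun.
  refine (etrans (polar_plane mHz (fun p => H0 _)) _).
  apply: eq_integral => r; rewrite inE/= in_itv/= andbT => r0.
  by apply: eq_integral => w _; rewrite /G/= gtr0_norm.
transitivity (\int[mu]_(w in `[0%R, (2 * pi)%R]) \int[mu]_(r in `]0%R, +oo[) \int[mu]_z G w (z, r))%E.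
  rewrite [LHS](@tonelli _ _ _ _ R mu mu setT _); last 4 first.
  - exact: measurableT.
  - exact: mpos.
  - by rewrite /G; mfun; epos.
  - by epos.
  rewrite [RHS](@tonelli _ _ _ _ R mu mu); last 4 first.
  - exact: m02pi.
  - exact: mpos.
  - by rewrite /G; mfun; epos.
  - by epos.
  apply: eq_integral => r _.
  rewrite [RHS](@tonelli _ _ _ _ R mu mu); last 4 first.
  - exact: m02pi.
  - exact: measurableT.
  - by rewrite /G; mfun; epos.
  - by epos.
  by [].
transitivity (\int[mu]_(w in `[0%R, (2 * pi)%R]) \int[mu]_(r in `]0%R, +oo[)
    \int[mu]_(t in `[0%R, pi]) (`|r|%:E * G w (r * cos t, r * sin t)%R))%E.
  apply: eq_integral => w _; refine (etrans (polar_halfplane (mG w) (G0 w)) _).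
  apply: eq_integral => r; rewrite inE/= in_itv/= andbT => r0.
  rewrite gtr0_norm//.
  by rewrite [RHS]integral_itv_bndoo//; apply: measurable_funTS; rewrite /G; mfun.
rewrite [LHS](@tonelli _ _ _ _ R mu mu); last 4 first.
- exact: m02pi.
- exact: mpos.
- by rewrite /G; mfun; epos.
- by epos.
apply: eq_integral => r; rewrite inE/= in_itv/= andbT => r0.
rewrite [LHS](@tonelli _ _ _ _ R mu mu); last 4 first.
- exact: m02pi.
- exact: m0pi.
- by rewrite /G; mfun; epos.
- by epos.
rewrite /sphere_int -ge0Zl; last 4 first.
- exact: m0pi.
- by mfun; epos.
- by epos.
- by epos.
apply: eq_integral => t _; rewrite -ge0Zl; last 4 first.
- exact: m02pi.
- by mfun.
- by epos.
- by epos.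
apply: eq_integral => w _; rewrite /G/= !muleA -!EFinM sphere_pointE -frame_scale3.
congr (_%:E * H (frame e _))%E; first by rewrite normrM gtr0_norm// mulrA -expr2.
by rewrite /scale3 /vec3/=; congr (_, _, _); rewrite ?mulrA.
Qed.

End PolarCoordinates.

(** * Averages over spheres *)

Section SphereAverages.
Context (R : realType).
Notation mu := (@lebesgue_measure R).
Notation RR := (measurableTypeR R).
Implicit Types (e s x xi : R3 R) (F H : R3 R -> \bar R).

Lemma enorm_scale3 a x : enorm (scale3 a x) = `|a| * enorm x.
Proof.
rewrite /enorm -sqrtr_sqr -sqrtrM ?sqr_ge0//; congr Num.sqrt.
by rewrite /dot /=; ring.
Qed.

Lemma dot_ge0 x : 0 <= dot x x.
Proof. by rewrite /dot -!expr2; epos. Qed.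

Lemma enorm_sq x : enorm x ^+ 2 = dot x x.
Proof. by rewrite sqr_sqrtr// dot_ge0. Qed.

Lemma enorm_unit s : dot s s = 1 -> enorm s = 1.
Proof. by move=> s1; rewrite /enorm s1 sqrtr1. Qed.

Lemma dotC x y : dot x y = dot y x.
Proof. by rewrite /dot; ring. Qed.

Lemma scale3A a b x : scale3 a (scale3 b x) = scale3 (a * b) x.
Proof. by rewrite /scale3 /vec3 /=; congr (_, _, _); rewrite mulrA. Qed.

Lemma scale31 x : scale3 1 x = x.
Proof. by case: x => [[x y] z]; rewrite /scale3 /vec3 /= !mul1r. Qed.

Lemma dot_frame e u v : dot e e = 1 -> dot (frame e u) (frame e v) = dot u v.
Proof.
move=> /frameE[k [l [m [n [kl mn fE]]]]].
case: u => [[u1 u2] u3]; case: v => [[v1 v2] v3].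
rewrite -/(vec3 u1 u2 u3) -/(vec3 v1 v2 v3) !fE /dot/=.
transitivity ((m ^+ 2 + n ^+ 2) * (u1 * v1) + (m ^+ 2 + n ^+ 2) * ((- k * u2 + l * u3) * (- k * v2 + l * v3))
   + (l * u2 + k * u3) * (l * v2 + k * v3)); first by ring.
rewrite mn !mul1r.
transitivity (u1 * v1 + (k ^+ 2 + l ^+ 2) * (u2 * v2 + u3 * v3)); first by ring.
by rewrite kl mul1r addrA.
Qed.

Lemma frame_axis e : frame e (vec3 0 0 1) = e.
Proof.
by case: e => [[x y] z]; rewrite /frame /scale3 /vec3/=; congr (_, _, _); rewrite /=; ring.
Qed.

Lemma sphere_point_unit e t w : dot e e = 1 ->
  dot (sphere_point e t w) (sphere_point e t w) = 1.
Proof.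
move=> e1; rewrite sphere_pointE dot_frame// /dot/=.
transitivity (sin t ^+ 2 * (cos w ^+ 2 + sin w ^+ 2) + cos t ^+ 2); first by ring.
by rewrite cos2Dsin2 mulr1 addrC cos2Dsin2.
Qed.

Lemma dot_sphere_point e t w : dot e e = 1 -> dot e (sphere_point e t w) = cos t.
Proof.
move=> e1; rewrite sphere_pointE -{1}(frame_axis e) dot_frame// /dot/=.
by rewrite !mul0r !add0r mul1r.
Qed.

Lemma eq_sphere_int e F H : dot e e = 1 -> (forall s, dot s s = 1 -> F s = H s) ->
  sphere_int e F = sphere_int e H.
Proof.
move=> e1 FH; apply: eq_integral => t _; apply: eq_integral => w _.
by rewrite FH// sphere_point_unit.
Qed.

Lemma sphere_int_ge0 e F : (forall x, 0 <= F x)%E -> (0 <= sphere_int e F)%E.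
Proof. by move=> F0; rewrite /sphere_int; epos. Qed.

Lemma sphere_intZ e (c : \bar R) F : (0 <= c)%E -> measurable_fun setT F ->
  (forall x, 0 <= F x)%E -> sphere_int e (fun s => c * F s)%E = (c * sphere_int e F)%E.
Proof.
move=> c0 mF F0; rewrite /sphere_int -ge0Zl; last 4 first.
- exact: m0pi.
- by mfun; epos.
- by epos.
- by [].
apply: eq_integral => t _; rewrite -ge0Zl; last 4 first.
- exact: m02pi.
- by mfun; epos.
- by epos.
- by [].
by apply: eq_integral => w _; rewrite muleCA.
Qed.

(** Both sides are equal to the same Lebesgue integral over the unit ball, of
    [F (x / |x|)] with the radial weight [|x|^-2]. *)
Lemma sphere_int_axis e e' F : dot e e = 1 -> dot e' e' = 1 ->
  measurable_fun setT F -> (forall x, 0 <= F x)%E -> sphere_int e F = sphere_int e' F.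
Proof.
move=> e1 e1' mF F0.
pose c (r : RR) : R := \1_(`]0, 1[%classic : set RR) r * (r ^+ 2)^-1.
have c0 r : 0 <= c r by rewrite /c; epos; rewrite invr_ge0; epos.
have mc : mreal c by rewrite /c; mfun.
pose H x := ((c (enorm x))%:E * F (scale3 (enorm x)^-1 x))%E.
have mH : measurable_fun setT H by rewrite /H; mfun.
have H0 x : (0 <= H x)%E by rewrite /H; epos.
suff key u : dot u u = 1 -> (\int[leb3 R]_x H x = sphere_int u F)%E by rewrite -!key.
move=> u1; rewrite (polar_space u1 mH H0).
have S0 := sphere_int_ge0 u F0.
transitivity (\int[mu]_(r in `]0%R, +oo[) ((r ^+ 2 * c r)%:E * sphere_int u F))%E.
  apply: eq_integral => r; rewrite inE/= in_itv/= andbT => r0.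
  rewrite (eq_sphere_int (H := fun s => (c r)%:E * F s)%E u1); last first.
    move=> s s1; rewrite /H enorm_scale3 (enorm_unit s1) mulr1 gtr0_norm//.
    by rewrite scale3A mulVf ?gt_eqF// scale31.
  by rewrite sphere_intZ ?lee_fin// muleA.
rewrite (eq_integral (fun r => ((\1_(`]0, 1[%classic : set RR) r)%:E * sphere_int u F)%E)); last first.
  move=> r; rewrite inE/= in_itv/= andbT => r0; congr (_%:E * _)%E.
  by rewrite /c mulrCA divff ?mulr1// expf_neq0// gt_eqF.
rewrite ge0_integralZr//; last by apply: measurable_funTS; mfun.
rewrite [X in (X * _)%E](_ : _ = 1%E) ?mul1e//.
rewrite [LHS](@integral_indic _ _ _ mu _ (@mpos R)); last exact: measurable_itv.
rewrite setIidl; last by move=> r /=; rewrite !in_itv/= => /andP[-> _].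
by rewrite [LHS](lebesgue_measure_itv (Interval _ _))/= lte_fin ltr01 oppr0 adde0.
Qed.

Lemma sphere_int_swap e e' (G : R3 R * R3 R -> \bar R) :
  measurable_fun setT G -> (forall p, 0 <= G p)%E ->
  sphere_int e (fun s => sphere_int e' (fun s' => G (s, s'))) =
  sphere_int e' (fun s' => sphere_int e (fun s => G (s, s'))).
Proof.
move=> mG G0.
pose J t w t' w' := (`|sin t|%:E * (`|sin t'|%:E *
   G (sphere_point e t w, sphere_point e' t' w')))%E.
transitivity (\int[mu]_(t in `[0%R, pi]) \int[mu]_(w in `[0%R, (2 * pi)%R])
  \int[mu]_(t' in `[0%R, pi]) \int[mu]_(w' in `[0%R, (2 * pi)%R]) J t w t' w')%E.
  apply: eq_integral => t _; apply: eq_integral => w _.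
  rewrite /sphere_int -ge0Zl; last 4 first.
  - exact: m0pi.
  - by mfun; epos; exact: m02pi.
  - by epos.
  - by epos.
  apply: eq_integral => t' _; rewrite -ge0Zl; last 4 first.
  - exact: m02pi.
  - by mfun; epos.
  - by epos.
  - by epos.
  by [].
transitivity (\int[mu]_(t in `[0%R, pi]) \int[mu]_(t' in `[0%R, pi])
  \int[mu]_(w' in `[0%R, (2 * pi)%R]) \int[mu]_(w in `[0%R, (2 * pi)%R]) J t w t' w')%E.
  apply: eq_integral => t _.
  rewrite [LHS](@tonelli _ _ _ _ R mu mu); last 4 first.
  - exact: m02pi.
  - exact: m0pi.
  - by rewrite /J; mfun; epos; exact: m02pi.
  - by rewrite /J; epos.
  apply: eq_integral => t' _.
  rewrite [LHS](@tonelli _ _ _ _ R mu mu); last 4 first.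
  - exact: m02pi.
  - exact: m02pi.
  - by rewrite /J; mfun; epos; exact: m02pi.
  - by rewrite /J; epos.
  by [].
rewrite [LHS](@tonelli _ _ _ _ R mu mu); last 4 first.
- exact: m0pi.
- exact: m0pi.
- by rewrite /J; mfun; epos; exact: m02pi.
- by rewrite /J; epos.
apply: eq_integral => t' _.
rewrite [LHS](@tonelli _ _ _ _ R mu mu); last 4 first.
- exact: m0pi.
- exact: m02pi.
- by rewrite /J; mfun; epos; exact: m02pi.
- by rewrite /J; epos.
apply: eq_integral => w' _.
rewrite /sphere_int -ge0Zl; last 4 first.
- exact: m0pi.
- by mfun; epos; exact: m02pi.
- by epos.
- by epos.
apply: eq_integral => t _; rewrite -ge0Zl; last 4 first.
- exact: m02pi.
- by mfun; epos.
- by epos.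
- by epos.
by apply: eq_integral => w _; rewrite /J muleCA.
Qed.


(** The angle in []0, pi[] of cosine [c]; the formula through [atan] makes it
    measurable in [c]. *)
Definition theta (c : RR) : RR := pi / 2 - atan (c / Num.sqrt (1 - c ^+ 2)).

Lemma theta_cos t : 0 < t < pi -> theta (cos t) = t.
Proof.
move=> /andP[t0 tpi]; have st : 0 < sin t by apply: sin_gt0_pi; rewrite t0 tpi.
rewrite /theta -sin2cos2 sqrtr_sqr gtr0_norm//.
have -> : cos t / sin t = tan (pi / 2 - t).
  by rewrite /tan sinB cosB sin_pihalf cos_pihalf !mul1r !mul0r subr0 add0r.
rewrite tanK ?subKr// in_itv/=; apply/andP; split; lra.
Qed.

Lemma mreal_theta : mreal theta.
Proof.
rewrite /theta; apply: mreal_add; first by mfun.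
apply: mreal_opp; apply: (mreal_comp (h := @atan R)).
  by apply: continuous_measurable_fun => x; exact: continuous_atan.
by mfun.
Qed.

Definition ez : R3 R := vec3 0 0 1.

Lemma ez_unit : dot ez ez = 1.
Proof. by rewrite /dot/= !mul0r !add0r mulr1. Qed.

Lemma axis_unit x : x != 0 -> dot (scale3 (enorm x)^-1 x) (scale3 (enorm x)^-1 x) = 1.
Proof.
move=> x0; have dx : dot x x != 0.
  apply: contra x0; case: x => [[x y] z]; rewrite /dot/= -!expr2.
  rewrite !paddr_eq0 ?addr_ge0 ?sqr_ge0// !sqrf_eq0 => /andP[/andP[/eqP-> /eqP->] /eqP->].
  by [].
transitivity ((enorm x ^+ 2)^-1 * dot x x).
  have e0 : enorm x != 0 by move: dx; rewrite -enorm_sq sqrf_eq0.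
  by rewrite /dot/=; field.
by rewrite enorm_sq mulVf.
Qed.

(** The integrand depends on the direction [e] of [x] and on the rotated
    direction [s] only through [s] and the angle between the two. The spherical
    integrals in [e] and [s] are exchanged, and [e] is then averaged about the
    axis [s]: a vector turned by a fixed angle in a random direction is again
    distributed by Lebesgue measure. *)
Lemma rotate_average (G : RR * R3 R -> \bar R) : measurable_fun setT G ->
  (forall p, 0 <= G p)%E ->
  (\int[leb3 R]_x \int[mu]_(t in `[0%R, pi]) \int[mu]_(w in `[0%R, (2 * pi)%R])
     G (t, scale3 (enorm x) (sphere_point (scale3 (enorm x)^-1 x) t w)) =
   (2 * pi)%:E * \int[mu]_(t in `[0%R, pi]) \int[leb3 R]_x G (t, x))%E.
Proof.
move=> mG G0.
have mth := mreal_theta.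
have pi0 := pi_gt0 R.
pose K (p : RR * R3 R) := ((`|sin (theta p.1)|^-1)%:E * G (theta p.1, p.2))%E.
have mK : measurable_fun setT K by rewrite /K; mfun.
have K0 p : (0 <= K p)%E by rewrite /K; epos.
have KE t x : 0 < t < pi -> (`|sin t|%:E * K (cos t, x) = G (t, x))%E.
  move=> tI; rewrite /K/= (theta_cos tI) muleA -EFinM divff ?mul1e//.
  by rewrite normr_eq0 gt_eqF// sin_gt0_pi.
pose I x := (\int[mu]_(t in `[0%R, pi]) \int[mu]_(w in `[0%R, (2 * pi)%R])
     G (t, scale3 (enorm x) (sphere_point (scale3 (enorm x)^-1 x) t w)))%E.
have mI : measurable_fun setT I by rewrite /I; mfun; epos; exact: m02pi.
have I0 x : (0 <= I x)%E by rewrite /I; epos.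
(* only the open interval matters, where [theta] inverts [cos] *)
have oo (f g : RR -> \bar R) : measurable_fun setT f -> measurable_fun setT g ->
    (forall t, 0 < t < pi -> f t = g t) ->
    (\int[mu]_(t in `[0%R, pi]) f t = \int[mu]_(t in `[0%R, pi]) g t)%E.
  move=> mf mg fg.
  rewrite integral_itv_bndoo; last exact: measurable_funTS.
  rewrite [RHS]integral_itv_bndoo; last exact: measurable_funTS.
  by apply: eq_integral => t; rewrite inE/= in_itv/=; exact: fg.
have IE r e : 0 < r -> dot e e = 1 ->
    I (scale3 r e) = sphere_int e (fun s => K (dot e s, scale3 r s)).
  move=> r0 e1; have rV : r^-1 * r = 1 by rewrite mulVf// gt_eqF.
  rewrite /I enorm_scale3 (enorm_unit e1) mulr1 (gtr0_norm r0) scale3A rV scale31.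
  apply: oo.
  - by mfun; epos; exact: m02pi.
  - by mfun; epos; exact: m02pi.
  - move=> t tI; apply: eq_integral => w _.
    by rewrite (dot_sphere_point _ _ e1) (KE _ _ tI).
have SE r s : dot s s = 1 ->
    (sphere_int s (fun e => K (dot e s, scale3 r s)) =
     (2 * pi)%:E * \int[mu]_(t in `[0%R, pi]) G (t, scale3 r s))%E.
  move=> s1; rewrite -ge0Zl; last 4 first.
  - exact: m0pi.
  - by mfun.
  - by epos.
  - by rewrite lee_fin mulr_ge0// ltW.
  apply: oo.
  - by mfun; epos; exact: m02pi.
  - by mfun.
  - move=> t tI; rewrite (eq_integral (fun=> G (t, scale3 r s))); last first.
      by move=> w _; rewrite dotC (dot_sphere_point _ _ s1) (KE _ _ tI).
    rewrite integral_cst; last exact: m02pi.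
    rewrite muleC [X in (X * _)%E](lebesgue_measure_itv (Interval _ _))/= lte_fin.
    by rewrite mulr_gt0// oppr0 adde0.
rewrite (polar_space ez_unit mI I0).
transitivity (\int[mu]_(r in `]0%R, +oo[) ((r ^+ 2)%:E *
    sphere_int ez (fun s => (2 * pi)%:E * \int[mu]_(t in `[0%R, pi]) G (t, scale3 r s))))%E.
  apply: eq_integral => r; rewrite inE/= in_itv/= andbT => r0.
  apply: (congr1 (fun z => (r ^+ 2)%:E * z)%E).
  transitivity (sphere_int ez (fun e => sphere_int ez (fun s => K (dot e s, scale3 r s)))).
    apply: eq_sphere_int; first exact: ez_unit.
    move=> e e1; rewrite (IE r e r0 e1).
    have mKe : measurable_fun setT (fun s => K (dot e s, scale3 r s)) by mfun.
    exact (sphere_int_axis e1 ez_unit mKe (fun=> K0 _)).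
  pose L (p : R3 R * R3 R) := K (dot p.1 p.2, scale3 r p.2).
  have mL : measurable_fun setT L by rewrite /L; mfun.
  refine (etrans (sphere_int_swap ez ez mL (fun p => K0 _)) _); rewrite /L/=.
  apply: eq_sphere_int; first exact: ez_unit.
  move=> s s1; rewrite -(SE r s s1).
  have mKs : measurable_fun setT (fun e => K (dot e s, scale3 r s)) by mfun.
  exact (sphere_int_axis ez_unit s1 mKs (fun=> K0 _)).
pose J x := ((2 * pi)%:E * \int[mu]_(t in `[0%R, pi]) G (t, x))%E.
have mJ : measurable_fun setT J by rewrite /J; mfun; epos; exact: m0pi.
have J0 x : (0 <= J x)%E by rewrite /J; epos; rewrite ltW.
rewrite -[LHS](polar_space ez_unit mJ J0) /J ge0Zl; last 4 first.
- exact: measurableT.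
- by mfun; epos; exact: m0pi.
- by epos.
- by epos; rewrite ltW.
apply: (congr1 (fun z => (2 * pi)%:E * z)%E).
apply: (@tonelli _ _ _ _ R (leb3 R) mu setT _ (fun x t => G (t, x))).
- exact: measurableT.
- exact: m0pi.
- by mfun.
- by epos.
Qed.


Lemma ge0_integral_leb3_scale (c : R) H : c != 0 -> measurable_fun setT H ->
  (forall x, 0 <= H x)%E ->
  (\int[leb3 R]_x H x = (`|c| ^+ 3)%:E * \int[leb3 R]_x H (scale3 c x))%E.
Proof.
move=> c0 mH H0.
have mHc : measurable_fun setT (fun x => H (scale3 c x)) by mfun.
rewrite (leb3E mH H0) (leb3E mHc (fun=> H0 _)) exprS EFinM -muleA -ge0Zl; last 4 first.
- exact: measurableT.
- by mfun; epos.
- by epos.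
- by epos; apply: exprn_ge0.
rewrite [LHS](@ge0_integral_affine R c 0)//; last 2 first.
- by mfun; epos.
- by epos.
apply: (congr1 (fun z => `|c|%:E * z)%E).
apply: eq_integral => z _; rewrite addr0 exprS expr1 EFinM -muleA -ge0Zl; last 4 first.
- exact: measurableT.
- by mfun; epos.
- by epos.
- by epos.
rewrite [LHS](@ge0_integral_affine R c 0)//; last 2 first.
- by mfun; epos.
- by epos.
apply: (congr1 (fun z => `|c|%:E * z)%E).
apply: eq_integral => y _; rewrite addr0.
rewrite [LHS](@ge0_integral_affine R c 0)//; last by mfun.
apply: (congr1 (fun z => `|c|%:E * z)%E).
by apply: eq_integral => x _; rewrite addr0.
Qed.

Lemma m0pi2 : measurable ([set` `[0, pi / 2]] : set RR).
Proof. exact: measurable_itv. Qed.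

Lemma eq_integral_oo (f g : RR -> \bar R) :
  measurable_fun setT f -> measurable_fun setT g ->
  (forall t, 0 < t < pi / 2 -> f t = g t) ->
  (\int[mu]_(t in `[0%R, (pi / 2)%R]) f t = \int[mu]_(t in `[0%R, (pi / 2)%R]) g t)%E.
Proof.
move=> mf mg fg.
rewrite integral_itv_bndoo; last exact: measurable_funTS.
rewrite [RHS]integral_itv_bndoo; last exact: measurable_funTS.
by apply: eq_integral => t; rewrite inE/= in_itv/=; exact: fg.
Qed.

(** The substitution [t = 2 * (u - a)]. The indicator keeps [u] in the range of
    [t / 2 + a], so that [rotate_average] applies on the whole of [[0, pi]]. *)
Lemma half_angle_subst (a : R) (f : RR -> \bar R) : 0 <= a <= pi / 2 ->
  measurable_fun setT f -> (forall t, 0 <= f t)%E ->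
  (\int[mu]_(t in `[0%R, (pi / 2)%R]) f t =
   \int[mu]_(u in `[0%R, pi]) ((2 * \1_(`[a, a + pi / 4]%classic : set RR) u)%:E * f (2 * u + - (2 * a))%R))%E.
Proof.
move=> /andP[a0 a2] mf f0; have pi0 := pi_gt0 R.
have mD : measurable ([set` `[a, a + pi / 4]] : set RR) by exact: measurable_itv.
rewrite (@ge0_integral_affine_set R 2 (- (2 * a)) _ [set` `[a, a + pi / 4]])//; last first.
  by move=> x; rewrite /= !in_itv/=; split => /andP[? ?]; apply/andP; split; lra.
have DE : [set` `[a, a + pi / 4]] = [set` `[0, pi]] `&` [set` `[a, a + pi / 4]] :> set RR.
  by rewrite setIidr// => x /=; rewrite !in_itv/= => /andP[? ?]; apply/andP; split; lra.
rewrite {1}DE integral_mkcondr (_ : _ \_ _ = fun u =>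
    (f (2 * u + - (2 * a))%R * (\1_(`[a, a + pi / 4]%classic : set RR) u)%:E)%E); last first.
  by apply/funext => u; rewrite epatch_indic.
rewrite -ge0Zl; last 4 first.
- exact: m0pi.
- by mfun; exact: mD.
- by epos.
- by epos.
apply: eq_integral => u _.
by rewrite [(f _ * _)%E]muleC muleA -EFinM ger0_norm.
Qed.

Lemma half_angle_average (a : R) (G : RR * R3 R -> \bar R) : 0 <= a <= pi / 2 ->
  measurable_fun setT G -> (forall p, 0 <= G p)%E ->
  (\int[leb3 R]_x \int[mu]_(t in `[0%R, (pi / 2)%R]) \int[mu]_(w in `[0%R, (2 * pi)%R])
     G (t, scale3 (enorm x) (sphere_point (scale3 (enorm x)^-1 x) (t / 2 + a) w)) =
   (2 * pi)%:E * \int[mu]_(t in `[0%R, (pi / 2)%R]) \int[leb3 R]_x G (t, x))%E.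
Proof.
move=> aI mG G0.
have mD : measurable ([set` `[a, a + pi / 4]] : set RR) by exact: measurable_itv.
pose ch (u : RR) : R := 2 * \1_(`[a, a + pi / 4]%classic : set RR) u.
have mch : mreal ch by rewrite /ch; mfun; exact: mD.
have ch0 u : 0 <= ch u by rewrite /ch mulr_ge0.
pose G' (p : RR * R3 R) := ((ch p.1)%:E * G ((2 * p.1 + - (2 * a))%R, p.2))%E.
have mG' : measurable_fun setT G' by rewrite /G'; mfun.
have G'0 p : (0 <= G' p)%E by rewrite /G'; epos.
have := rotate_average mG' G'0.
rewrite (half_angle_subst aI); last 2 first.
- by mfun; epos.
- by epos.
under [X in (_ = _ * X)%E -> _]eq_integral.
  move=> u _; rewrite /G'/= ge0Zl; last 4 first.
  - exact: measurableT.
  - by mfun.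
  - by epos.
  - by epos.
  over.
move=> <-; apply: eq_integral => x _.
rewrite (half_angle_subst aI); last 2 first.
- by mfun; epos; exact: m02pi.
- by epos.
apply: eq_integral => u _; rewrite /G'/= -ge0Zl; last 4 first.
- exact: m02pi.
- by mfun.
- by epos.
- by epos.
apply: eq_integral => w _; congr (_ * G (_, scale3 _ (sphere_point _ _ _)))%E.
by field.
Qed.

Lemma gain_scaled (a : R) (k c : RR -> R) H : 0 <= a <= pi / 2 ->
  mreal k -> (forall t, 0 <= k t) -> mreal c ->
  (forall t, 0 < t < pi / 2 -> c t != 0) ->
  measurable_fun setT H -> (forall x, 0 <= H x)%E ->
  (\int[leb3 R]_x \int[mu]_(t in `[0%R, (pi / 2)%R]) \int[mu]_(w in `[0%R, (2 * pi)%R])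
     ((k t)%:E * H (scale3 (c t) (scale3 (enorm x)
        (sphere_point (scale3 (enorm x)^-1 x) (t / 2 + a) w)))) =
   (2 * pi)%:E * ((\int[mu]_(t in `[0%R, (pi / 2)%R]) (k t * `|c t| ^- 3)%:E)
     * \int[leb3 R]_x H x))%E.
Proof.
move=> aI mk k0 mc c0 mH H0.
pose G (p : RR * R3 R) := ((k p.1)%:E * H (scale3 (c p.1) p.2))%E.
have mG : measurable_fun setT G by rewrite /G; mfun.
have G0 p : (0 <= G p)%E by rewrite /G; epos.
refine (etrans (half_angle_average aI mG G0) _).
apply: (congr1 (fun z => (2 * pi)%:E * z)%E).
rewrite -ge0_integralZr; last 4 first.
- exact: m0pi2.
- by apply: measurable_funTS; mfun.
- by epos; rewrite invr_ge0; apply: exprn_ge0.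
- by epos.
apply: eq_integral_oo.
- by rewrite /G; mfun; epos.
- by mfun.
- move=> t tI; rewrite /G/= ge0Zl; last 4 first.
  + exact: measurableT.
  + by mfun.
  + by epos.
  + by epos.
  rewrite (ge0_integral_leb3_scale (c0 t tI) mH H0) muleA -EFinM.
  by rewrite -mulrA mulVf ?mulr1// expf_neq0// normr_eq0 c0.
Qed.


(** * The weight of the norm and the change of variables to xi+ and xi- *)

(** The weight of the norm of M^alpha; it vanishes at the origin when
    [3 + alpha != 0]. *)
Definition wt (alpha : R) x : R := (enorm x `^ (3 + alpha))^-1.

Lemma mreal_wt d (T : measurableType d) alpha (f : T -> R3 R) :
  measurable_fun setT f -> mreal (fun y => wt alpha (f y)).
Proof. by move=> mf; rewrite /wt; mfun. Qed.

Lemma wt_ge0 alpha x : 0 <= wt alpha x.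
Proof. by rewrite /wt; epos. Qed.

Lemma enorm_eq0 x : enorm x = 0 -> x = 0.
Proof.
move=> x0; apply/eqP; apply: contraT => /axis_unit.
by rewrite /dot /= x0 invr0 !mul0r !addr0 => /eqP; rewrite eq_sym oner_eq0.
Qed.

Lemma enorm0 : enorm (0 : R3 R) = 0.
Proof. by rewrite /enorm /dot/= !mul0r !addr0 sqrtr0. Qed.

Lemma wt0 alpha : 0 < alpha -> wt alpha 0 = 0.
Proof. by move=> a0; rewrite /wt enorm0 powR0 ?invr0// gt_eqF// addr_gt0. Qed.

Lemma wt_scale3 alpha a x : a != 0 -> 0 < alpha ->
  wt alpha (scale3 a x) = `|a| ^- 3 * (`|a| `^ alpha)^-1 * wt alpha x.
Proof.
move=> a0 al0; rewrite /wt enorm_scale3 powRM ?normr_ge0 ?sqrtr_ge0//.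
rewrite invfM; congr (_ * _).
have aP : 0 < `|a| by rewrite normr_gt0.
rewrite powRD; last by rewrite normr_eq0 a0 implybT.
by rewrite (powR_mulrn 3 (ltW aP)) invfM.
Qed.

(** The weight is homogeneous of degree [-3-alpha] and Lebesgue measure of
    degree [3]. *)
Lemma wt_dilation alpha a F : a != 0 -> 0 < alpha -> measurable_fun setT F ->
  (forall x, 0 <= F x)%E ->
  (\int[leb3 R]_x ((wt alpha x)%:E * F (scale3 a x)) =
   (`|a| `^ alpha)%:E * \int[leb3 R]_x ((wt alpha x)%:E * F x))%E.
Proof.
move=> a0 al0 mF F0; have mw := mreal_wt alpha (@measurable_id _ (R3 R) setT).
have mw' : mreal (wt alpha) by exact: mw.
have w0 := wt_ge0 alpha.
have mH : measurable_fun setT (fun x => (wt alpha x)%:E * F x)%E by mfun.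
have H0 x : (0 <= (wt alpha x)%:E * F x)%E by epos.
rewrite (ge0_integral_leb3_scale a0 mH H0) -!ge0Zl; last 8 first.
- exact: measurableT.
- by mfun.
- by epos.
- by epos; apply: exprn_ge0.
- exact: measurableT.
- by mfun; epos.
- by epos; apply: exprn_ge0.
- by epos.
apply: eq_integral => x _; rewrite !muleA -!EFinM; congr (_%:E * _)%E.
have aP : 0 < `|a| by rewrite normr_gt0.
have aaP : 0 < `|a| `^ alpha by rewrite powR_gt0.
rewrite wt_scale3//; field.
by rewrite !gt_eqF.
Qed.

(** Up to sign, [xi+] and [xi-] are [xi] turned by half the deviation angle, and by
    half of it plus a right angle, then shrunk by its cosine and its sine. *)
Lemma half_angle_vec x e t w : x = scale3 (enorm x) e ->
  xi_plus x (sphere_point e t w) =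
    scale3 (cos (t / 2)) (scale3 (enorm x) (sphere_point e (t / 2 + 0) w)) /\
  xi_minus x (sphere_point e t w) =
    scale3 (- sin (t / 2)) (scale3 (enorm x) (sphere_point e (t / 2 + pi / 2) w)).
Proof.
set r := enorm x => xE; set h := t / 2.
have tE : t = h + h by rewrite /h; field.
have {}xE : x = scale3 (r * (cos h ^+ 2 + sin h ^+ 2)) e by rewrite cos2Dsin2 mulr1.
rewrite /xi_plus /xi_minus -/r xE !sphere_pointE addr0 cosDpihalf sinDpihalf tE cosD sinD.
case: e {xE} => [[e1 e2] e3]; rewrite /frame.
case: (Defs.ortho _) => [[u1 u2] u3]; rewrite /scale3 /vec3 /=.
by split; congr (_, _, _); rewrite /=; field.
Qed.

Section Gains.
Variables (alpha : R) (k : RR -> R) (F : R3 R -> \bar R).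
Hypotheses (al0 : 0 < alpha) (mk : mreal k) (k0 : forall t, 0 <= k t)
  (mF : measurable_fun setT F) (F0 : forall x, (0 <= F x)%E).

Let gain (a : R) (c : RR -> R) (X : R3 R * R3 R -> R3 R) : 0 <= a <= pi / 2 -> mreal c ->
  (forall t, 0 < t < pi / 2 -> c t != 0) ->
  measurable_fun setT X ->
  (forall x e t w, x = scale3 (enorm x) e -> X (x, sphere_point e t w) =
    scale3 (c t) (scale3 (enorm x) (sphere_point e (t / 2 + a) w))) ->
  (\int[leb3 R]_x \int[mu]_(t in `[0%R, (pi / 2)%R]) \int[mu]_(w in `[0%R, (2 * pi)%R])
    ((wt alpha x * k t)%:E * F (X (x, sphere_point (scale3 (enorm x)^-1 x) t w))) =
   (2 * pi)%:E * ((\int[mu]_(t in `[0%R, (pi / 2)%R]) (k t * `|c t| `^ alpha)%:E)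
     * \int[leb3 R]_x ((wt alpha x)%:E * F x)))%E.
Proof.
move=> aI mc c0 mX XE.
have mw : mreal (wt alpha) := mreal_wt alpha (@measurable_id _ (R3 R) setT).
have w0 := wt_ge0 alpha.
pose H x := ((wt alpha x)%:E * F x)%E.
have mH : measurable_fun setT H by rewrite /H; mfun.
have H0 x : (0 <= H x)%E by rewrite /H; epos.
pose k' t := k t * (`|c t| ^+ 3 * `|c t| `^ alpha).
have mk' : mreal k' by rewrite /k'; mfun.
have k'0 t : 0 <= k' t by rewrite /k'; epos; apply: exprn_ge0.
have := gain_scaled aI mk' k'0 mc c0 mH H0.
have -> : (\int[mu]_(t in `[0%R, (pi / 2)%R]) (k' t * `|c t| ^- 3)%:E =
    \int[mu]_(t in `[0%R, (pi / 2)%R]) (k t * `|c t| `^ alpha)%:E)%E.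
  apply: eq_integral_oo; first by mfun.
    by mfun.
  move=> t tI; have ctP : `|c t| != 0 by rewrite normr_eq0 c0.
  by rewrite /k'; congr EFin; field.
move=> <-; apply: eq_integral => x _; apply: eq_integral_oo.
- by mfun; epos; exact: m02pi.
- by mfun; epos; exact: m02pi.
move=> t tI; apply: eq_integral => w _.
have [->|x0] := eqVneq x 0.
  rewrite wt0// mul0r mul0e enorm0 /H.
  by rewrite (_ : scale3 _ _ = 0) ?wt0 ?mul0e ?mule0// /scale3 /vec3/= !mul0r !mulr0.
set e := scale3 (enorm x)^-1 x.
have e1 : dot e e = 1 by exact: axis_unit.
have nx0 : enorm x != 0 by apply: contra x0 => /eqP/enorm_eq0/eqP.
have xE : x = scale3 (enorm x) e by rewrite /e scale3A divff// scale31.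
rewrite XE// /H muleA -EFinM; congr (_%:E * _)%E.
have ct0 := c0 t tI; have ctP : 0 < `|c t| by rewrite normr_gt0.
have ctaP : 0 < `|c t| `^ alpha by rewrite powR_gt0.
rewrite wt_scale3// {1}/wt.
have -> : wt alpha (scale3 (enorm x) (sphere_point e (t / 2 + a) w)) = wt alpha x.
  by rewrite /wt enorm_scale3 (enorm_unit (sphere_point_unit _ _ e1)) mulr1 ger0_norm// sqrtr_ge0.
rewrite /k' -/(wt alpha x); field.
by rewrite !gt_eqF.
Qed.

Lemma half_in (t : R) : 0 < t < pi / 2 -> 0 < t / 2 < pi / 2.
Proof. by have := pi_gt0 R; move=> pi0 /andP[? ?]; apply/andP; split; lra. Qed.

(** The powers of [cos] and [sin] in [lambda] come from here: on average the
    rotation preserves the weighted measure, and the dilation contributes the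
    factor of [wt_dilation]. *)
Lemma gain_plus :
  (\int[leb3 R]_x \int[mu]_(t in `[0%R, (pi / 2)%R]) \int[mu]_(w in `[0%R, (2 * pi)%R])
    ((wt alpha x * k t)%:E * F (xi_plus x (sphere_point (scale3 (enorm x)^-1 x) t w))) =
   (2 * pi)%:E * ((\int[mu]_(t in `[0%R, (pi / 2)%R]) (k t * `|cos (t / 2)| `^ alpha)%:E)
     * \int[leb3 R]_x ((wt alpha x)%:E * F x)))%E.
Proof.
have pi0 := pi_gt0 R.
apply: (@gain 0 (fun t => cos (t / 2)) (fun p => xi_plus p.1 p.2)).
- by rewrite lexx divr_ge0// ltW.
- by mfun.
- move=> t /half_in/andP[t0 t1]; rewrite gt_eqF// cos_gt0_pihalf// t1 andbT.
  by rewrite (lt_trans _ t0)// oppr_lt0 divr_gt0.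
- by rewrite /xi_plus; mfun.
- by move=> x e t w xE; have [] := half_angle_vec t w xE.
Qed.

Lemma gain_minus :
  (\int[leb3 R]_x \int[mu]_(t in `[0%R, (pi / 2)%R]) \int[mu]_(w in `[0%R, (2 * pi)%R])
    ((wt alpha x * k t)%:E * F (xi_minus x (sphere_point (scale3 (enorm x)^-1 x) t w))) =
   (2 * pi)%:E * ((\int[mu]_(t in `[0%R, (pi / 2)%R]) (k t * `|sin (t / 2)| `^ alpha)%:E)
     * \int[leb3 R]_x ((wt alpha x)%:E * F x)))%E.
Proof.
have pi0 := pi_gt0 R.
under [in RHS]eq_integral do rewrite -normrN.
apply: (@gain (pi / 2) (fun t => - sin (t / 2)) (fun p => xi_minus p.1 p.2)).
- by rewrite lexx divr_ge0// ltW.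
- by mfun.
- move=> t /half_in/andP[t0 t1]; rewrite oppr_eq0 gt_eqF// sin_gt0_pi// t0/=; lra.
- by rewrite /xi_minus; mfun.
- by move=> x e t w xE; have [] := half_angle_vec t w xE.
Qed.

Lemma gain_dilation (a : RR -> R) : mreal a -> (forall t, 0 < t < pi / 2 -> a t != 0) ->
  (\int[leb3 R]_x \int[mu]_(t in `[0%R, (pi / 2)%R]) \int[mu]_(w in `[0%R, (2 * pi)%R])
    ((wt alpha x * k t)%:E * F (scale3 (a t) x)) =
   (2 * pi)%:E * ((\int[mu]_(t in `[0%R, (pi / 2)%R]) (k t * `|a t| `^ alpha)%:E)
     * \int[leb3 R]_x ((wt alpha x)%:E * F x)))%E.
Proof.
move=> ma a0; have pi0 := pi_gt0 R.
have mw : mreal (wt alpha) := mreal_wt alpha (@measurable_id _ (R3 R) setT).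
have w0 := wt_ge0 alpha.
rewrite [LHS](@tonelli _ _ _ _ R (leb3 R) mu); last 4 first.
- exact: measurableT.
- exact: m0pi2.
- by mfun; epos; exact: m02pi.
- by epos.
rewrite -ge0_integralZr; last 4 first.
- exact: m0pi2.
- by apply: measurable_funTS; mfun.
- by epos.
- by epos.
rewrite -ge0Zl; last 4 first.
- exact: m0pi2.
- by mfun.
- by epos.
- by epos; rewrite ltW.
apply: eq_integral_oo.
- by mfun; epos; exact: m02pi.
- by mfun.
move=> t tI.
transitivity (\int[leb3 R]_x ((2 * pi * k t)%:E * ((wt alpha x)%:E * F (scale3 (a t) x))))%E.
  apply: eq_integral => x _; rewrite integral_cst; last exact: m02pi.
  rewrite [X in (_ * X)%E](lebesgue_measure_itv (Interval _ _))/= lte_fin.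
  rewrite mulr_gt0// oppr0 adde0 muleC !muleA -!EFinM; congr (_%:E * _)%E.
  by ring.
rewrite ge0Zl; last 4 first.
- exact: measurableT.
- by mfun.
- by epos.
- by epos; rewrite ltW.
rewrite (wt_dilation (a0 t tI) al0 mF F0) !muleA -!EFinM; congr (_%:E * _)%E.
by ring.
Qed.

End Gains.

End SphereAverages.

Local Open Scope complex_scope.

(** * Complex-valued functions *)

Notation normc := Normc.normc.

Section ComplexIntegrals.
Context (R : realType).
Implicit Types z : R[i].

Lemma normc_ge0 z : 0 <= normc z.
Proof. by case: z => a b; exact: sqrtr_ge0. Qed.

Lemma normc_sq z : normc z ^+ 2 = complex.Re z ^+ 2 + complex.Im z ^+ 2.
Proof. by case: z => a b; rewrite /= sqr_sqrtr// addr_ge0// sqr_ge0. Qed.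

Lemma normc_leP z (h : R) : 0 <= h ->
  complex.Re z ^+ 2 + complex.Im z ^+ 2 <= h ^+ 2 -> normc z <= h.
Proof. by move=> h0; rewrite -normc_sq ler_sqr ?nnegrE// normc_ge0. Qed.

Lemma normc_Re z : `|complex.Re z| <= normc z.
Proof.
rewrite -ler_sqr ?nnegrE ?normc_ge0// normc_sq real_normK ?num_real//.
by rewrite lerDl sqr_ge0.
Qed.

Lemma normc_Im z : `|complex.Im z| <= normc z.
Proof.
rewrite -ler_sqr ?nnegrE ?normc_ge0// normc_sq real_normK ?num_real//.
by rewrite lerDr sqr_ge0.
Qed.

Lemma ReD z z' : complex.Re (z + z') = complex.Re z + complex.Re z'.
Proof. by case: z z' => [a b] [c d]. Qed.

Lemma ImD z z' : complex.Im (z + z') = complex.Im z + complex.Im z'.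
Proof. by case: z z' => [a b] [c d]. Qed.

Lemma ReB z z' : complex.Re (z - z') = complex.Re z - complex.Re z'.
Proof. by case: z z' => [a b] [c d]. Qed.

Lemma ImB z z' : complex.Im (z - z') = complex.Im z - complex.Im z'.
Proof. by case: z z' => [a b] [c d]. Qed.

Lemma ReM z z' : complex.Re (z * z') =
  complex.Re z * complex.Re z' - complex.Im z * complex.Im z'.
Proof. by case: z z' => [a b] [c d]. Qed.

Lemma ImM z z' : complex.Im (z * z') =
  complex.Re z * complex.Im z' + complex.Im z * complex.Re z'.
Proof. by case: z z' => [a b] [c d]. Qed.

Lemma normcD z z' : normc (z + z') <= normc z + normc z'.
Proof.
by rewrite -lecR rmorphD/=; exact: (@ler_normD _ R[i]).
Qed.

Lemma normcM z z' : normc (z * z') = normc z * normc z'.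
Proof. exact: Normc.normcM. Qed.

Lemma normcN z : normc (- z) = normc z.
Proof. by case: z => a b; rewrite /= !sqrrN. Qed.

Lemma normcB z z' : normc (z - z') <= normc z + normc z'.
Proof. by rewrite -(normcN z') normcD. Qed.

Lemma normc_real (a : R) : normc a%:C = `|a|.
Proof. by rewrite /= expr0n addr0 sqrtr_sqr. Qed.

Lemma complex_eq z z' : complex.Re z = complex.Re z' -> complex.Im z = complex.Im z' -> z = z'.
Proof. by case: z z' => [a b] [c d] /= -> ->. Qed.

End ComplexIntegrals.

Definition mcomplex d (T : measurableType d) (R : realType) (f : T -> R[i]) : Prop :=
  mreal (fun x => complex.Re (f x)) /\ mreal (fun x => complex.Im (f x)).

Section ComplexMeasurability.
Context d (T : measurableType d) (R : realType).
Implicit Types f g : T -> R[i].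

Lemma mcomplex_add f g : mcomplex f -> mcomplex g -> mcomplex (fun x => f x + g x).
Proof.
move=> [f1 f2] [g1 g2]; split.
- by under eq_fun do rewrite ReD; exact: mreal_add.
- by under eq_fun do rewrite ImD; exact: mreal_add.
Qed.

Lemma mcomplex_sub f g : mcomplex f -> mcomplex g -> mcomplex (fun x => f x - g x).
Proof.
move=> [f1 f2] [g1 g2]; split.
- by under eq_fun do rewrite ReB; apply: mreal_add => //; exact: mreal_opp.
- by under eq_fun do rewrite ImB; apply: mreal_add => //; exact: mreal_opp.
Qed.

Lemma mcomplex_mul f g : mcomplex f -> mcomplex g -> mcomplex (fun x => f x * g x).
Proof.
move=> [f1 f2] [g1 g2]; split.
- by under eq_fun do rewrite ReM; apply: mreal_add; [|apply: mreal_opp]; exact: mreal_mul.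
- by under eq_fun do rewrite ImM; apply: mreal_add; exact: mreal_mul.
Qed.

Lemma mcomplex_real (f : T -> R) : mreal f -> mcomplex (fun x => (f x)%:C).
Proof. by move=> mf; split => //=; exact: (@measurable_cst _ _ _ _ _ 0). Qed.

Lemma mcomplex_cst (c : R[i]) : mcomplex (fun _ : T => c).
Proof. by split; exact: (@measurable_cst _ _ _ _ _ _). Qed.

Lemma mcomplex_comp d' (T' : measurableType d') (f : T' -> R[i]) (g : T -> T') :
  mcomplex f -> measurable_fun setT g -> mcomplex (fun x => f (g x)).
Proof.
move=> [f1 f2] mg; split.
- exact: (measurableT_comp f1 mg).
- exact: (measurableT_comp f2 mg).
Qed.

Lemma mreal_normc f : mcomplex f -> mreal (fun x => normc (f x)).
Proof.
move=> [f1 f2].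
have -> : (fun x => normc (f x)) =
    (fun x => Num.sqrt (complex.Re (f x) ^+ 2 + complex.Im (f x) ^+ 2)).
  by apply/funext => x; case: (f x).
by mfun.
Qed.

End ComplexMeasurability.

Section ComplexIntegral.
Context d (T : measurableType d) (R : realType) (m : {measure set T -> \bar R})
  (D : set T) (mD : measurable D).
Implicit Types f g : T -> R[i].

Definition Cintegrable f := mcomplex f /\ (\int[m]_(x in D) (normc (f x))%:E < +oo)%E.

Lemma Cintegrable_Re f : Cintegrable f -> m.-integrable D (EFin \o (fun x => complex.Re (f x))).
Proof.
move=> [mf ff]; apply/integrableP; split.
  by apply: measurable_funTS; apply: mereal_EFin; exact: mf.1.
apply: le_lt_trans ff; apply: ge0_le_integral => //.
- by apply: measurable_funTS; apply: mereal_EFin; apply: mreal_norm; exact: mf.1.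
- by apply: measurable_funTS; apply: mereal_EFin; exact: mreal_normc.
- by move=> x _; rewrite lee_fin normc_Re.
Qed.

Lemma Cintegrable_Im f : Cintegrable f -> m.-integrable D (EFin \o (fun x => complex.Im (f x))).
Proof.
move=> [mf ff]; apply/integrableP; split.
  by apply: measurable_funTS; apply: mereal_EFin; exact: mf.2.
apply: le_lt_trans ff; apply: ge0_le_integral => //.
- by apply: measurable_funTS; apply: mereal_EFin; apply: mreal_norm; exact: mf.2.
- by apply: measurable_funTS; apply: mereal_EFin; exact: mreal_normc.
- by move=> x _; rewrite lee_fin normc_Im.
Qed.

Lemma CintegralD f g : Cintegrable f -> Cintegrable g ->
  Cintegral m D (fun x => f x + g x) = Cintegral m D f + Cintegral m D g.
Proof.
move=> If Ig; apply: complex_eq; rewrite /=.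
- rewrite -RintegralD//; last 2 first.
    exact: Cintegrable_Re. exact: Cintegrable_Re.
  by apply: eq_Rintegral => x _; rewrite ReD.
- rewrite -RintegralD//; last 2 first.
    exact: Cintegrable_Im. exact: Cintegrable_Im.
  by apply: eq_Rintegral => x _; rewrite ImD.
Qed.

Lemma CintegralB f g : Cintegrable f -> Cintegrable g ->
  Cintegral m D (fun x => f x - g x) = Cintegral m D f - Cintegral m D g.
Proof.
move=> If Ig; apply: complex_eq; rewrite /=.
- rewrite -RintegralB//; last 2 first.
    exact: Cintegrable_Re. exact: Cintegrable_Re.
  by apply: eq_Rintegral => x _; rewrite ReB.
- rewrite -RintegralB//; last 2 first.
    exact: Cintegrable_Im. exact: Cintegrable_Im.
  by apply: eq_Rintegral => x _; rewrite ImB.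
Qed.

Lemma CintegralZ (c : R) f : Cintegrable f ->
  Cintegral m D (fun x => c%:C * f x) = c%:C * Cintegral m D f.
Proof.
move=> If; apply: complex_eq; rewrite /=.
- rewrite mul0r subr0 -RintegralZl//; last exact: Cintegrable_Re.
  by apply: eq_Rintegral => x _; rewrite ReM /= mul0r subr0.
- rewrite mul0r addr0 -RintegralZl//; last exact: Cintegrable_Im.
  by apply: eq_Rintegral => x _; rewrite ImM /= mul0r addr0.
Qed.

Lemma eq_Cintegral f g : (forall x, D x -> f x = g x) -> Cintegral m D f = Cintegral m D g.
Proof.
by move=> fg; rewrite /Cintegral; congr (_ +i* _); apply: eq_Rintegral => x;
  rewrite inE => Dx; rewrite fg.
Qed.

(** Pairing the integral [z] with itself reduces the bound to the real integrand
    [Re z * Re f + Im z * Im f], at most [|z| * |f|] by Cauchy-Schwarz. *)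
Lemma normc_Cintegral f : mcomplex f ->
  ((normc (Cintegral m D f))%:E <= \int[m]_(x in D) (normc (f x))%:E)%E.
Proof.
move=> mf.
have I0 : (0 <= \int[m]_(x in D) (normc (f x))%:E)%E.
  by apply: integral_ge0 => x _; rewrite lee_fin normc_ge0.
have [->|Ifin] := eqVneq (\int[m]_(x in D) (normc (f x))%:E)%E +oo%E; first exact: leey.
have If : Cintegrable f by split => //; rewrite ltey.
set z := Cintegral m D f; pose N := normc z.
have [N0|N0] := eqVneq N 0; first by rewrite -/N N0.
have NP : 0 < N by rewrite lt_neqAle eq_sym N0 normc_ge0.
have IRe := Cintegrable_Re If; have IIm := Cintegrable_Im If.
pose g x := complex.Re z * complex.Re (f x) + complex.Im z * complex.Im (f x).
have mg : mreal g by rewrite /g; case: mf => m1 m2; mfun.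
have NE : (\int[m]_(x in D) (g x)%:E = (N ^+ 2)%:E)%E.
  have I1 := integrableZl mD (complex.Re z) IRe.
  have I2 := integrableZl mD (complex.Im z) IIm.
  rewrite (_ : (fun x => (g x)%:E) = (fun x =>
      (complex.Re z)%:E * (complex.Re (f x))%:E + (complex.Im z)%:E * (complex.Im (f x))%:E)%E)//.
  rewrite integralD//= integralZl// integralZl//.
  have -> : (\int[m]_(x in D) (complex.Re (f x))%:E = (complex.Re z)%:E)%E.
    by rewrite /z/= /Rintegral fineK//; exact: integrable_fin_num IRe.
  have -> : (\int[m]_(x in D) (complex.Im (f x))%:E = (complex.Im z)%:E)%E.
    by rewrite /z/= /Rintegral fineK//; exact: integrable_fin_num IIm.
  by rewrite -!EFinM -EFinD /N normc_sq !expr2.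
have : (`|\int[m]_(x in D) (g x)%:E| <= \int[m]_(x in D) (N%:E * (normc (f x))%:E))%E.
  apply: le_trans (le_abse_integral _ mD _) _.
    by apply: measurable_funTS; mfun.
  apply: ge0_le_integral => //.
  - by apply: measurable_funTS; apply: mereal_EFin; exact: mreal_norm.
  - apply: measurable_funTS; apply: mereal_mul; first exact: measurable_cst.
    by apply: mereal_EFin; exact: mreal_normc.
  - move=> x _; rewrite lee_fin /g /N -ler_sqr ?nnegrE ?mulr_ge0 ?normc_ge0//.
    rewrite real_normK ?num_real// exprMn !normc_sq.
    set a := complex.Re z; set b := complex.Im z; set c := complex.Re _; set e := complex.Im _.
    rewrite -subr_ge0 (_ : _ - _ = (a * e - b * c) ^+ 2) ?sqr_ge0//.
    by ring.
rewrite NE ge0Zl//; last 3 first.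
- by apply: mereal_EFin; exact: mreal_normc.
- by move=> x; rewrite lee_fin normc_ge0.
- by rewrite lee_fin ltW.
rewrite /= ger0_norm ?sqr_ge0// expr2 EFinM lee_pmul2l// lte_fin//.
Qed.

Lemma Cintegrable_bounded f (C : R) : (m D < +oo)%E -> mcomplex f ->
  (forall x, D x -> normc (f x) <= C) -> Cintegrable f.
Proof.
move=> mDoo mf fC; split => //.
apply: (@le_lt_trans _ _ (\int[m]_(x in D) C%:E)%E).
  apply: ge0_le_integral => //.
  - by move=> x _; rewrite lee_fin normc_ge0.
  - by apply: measurable_funTS; apply: mereal_EFin; exact: mreal_normc.
rewrite (_ : (\int[m]_(x in D) C%:E = C%:E * m D)%E); last exact: (integral_cst m mD).
have [C0|C0] := leP 0 C; first by rewrite lte_mul_pinfty.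
by rewrite (@le_lt_trans _ _ 0%E)// mule_le0_ge0// lee_fin ltW.
Qed.

End ComplexIntegral.

(** * Characteristic functions *)

Section CharacteristicFunctions.
Context (R : realType) (f : probability (R3 R) R).
Implicit Types (x y v : R3 R).
Notation phi := (charfun f).
Notation RR := (measurableTypeR R).

Lemma dotDr v x y : dot v (x + y) = dot v x + dot v y.
Proof. by rewrite /dot /=; ring. Qed.

Lemma dotNr v x : dot v (- x) = - dot v x.
Proof. by rewrite /dot /=; ring. Qed.

Lemma dot0r v : dot v 0 = 0.
Proof. by rewrite /dot /= !mulr0 !addr0. Qed.

Lemma mcomplex_cexpi d (T : measurableType d) (g : T -> R) : mreal g ->
  mcomplex (fun t => cexpi (g t)).
Proof. by move=> mg; split; rewrite /=; mfun. Qed.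

Lemma normc_cexpi (t : R) : normc (cexpi t) = 1.
Proof. by rewrite /= cos2Dsin2 sqrtr1. Qed.

Lemma mreal_dotl x : mreal (fun v => dot v x).
Proof. by mfun. Qed.

Lemma mcomplex_expdot x : mcomplex (fun v => cexpi (- dot v x)).
Proof. by apply: mcomplex_cexpi; mfun. Qed.

Lemma bounded_Cintegrable (g : R3 R -> R[i]) (C : R) : mcomplex g ->
  (forall v, normc (g v) <= C) -> Cintegrable f setT g.
Proof.
move=> mg gC; apply: (Cintegrable_bounded measurableT _ mg (fun x _ => gC x)).
have h : (f [set: R3 R] < +oo)%E by rewrite probability_setT ltry.
exact: h.
Qed.

Lemma Cintegrable_expdot x : Cintegrable f setT (fun v => cexpi (- dot v x)).
Proof.
apply: (bounded_Cintegrable (C := 1)); first exact: mcomplex_expdot.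
by move=> v; rewrite normc_cexpi.
Qed.

Lemma charfun0 : phi 0 = 1.
Proof.
rewrite /charfun (@eq_Cintegral _ _ _ f setT _ (fun=> 1)) //; last first.
  by move=> v _; rewrite dot0r oppr0 /cexpi cos0 sin0.
apply: complex_eq; rewrite /= (Rintegral_cst f measurableT) ?mul0r//.
by rewrite (_ : fine _ = 1) ?mulr1//; rewrite -[RHS]/(fine 1); congr fine; exact: probability_setT.
Qed.

Lemma Re_charfun x : complex.Re (phi x) = \int[f]_v cos (dot v x).
Proof. by rewrite /=; apply: eq_Rintegral => v _; rewrite /= cosN. Qed.

Lemma Re_charfunN x : complex.Re (phi (- x)) = complex.Re (phi x).
Proof. by rewrite !Re_charfun; apply: eq_Rintegral => v _; rewrite dotNr cosN. Qed.

Lemma integrable_bounded (g : R3 R -> R) (C : R) : mreal g ->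
  (forall v, `|g v| <= C) -> f.-integrable setT (EFin \o g).
Proof.
move=> mg gC; apply: (Cintegrable_Re measurableT (f := fun v => (g v)%:C)).
by apply: (bounded_Cintegrable (C := C)) => [|v]; [exact: mcomplex_real|rewrite normc_real].
Qed.

Lemma norm_cos_le1 (t : R) : `|cos t| <= 1.
Proof. by rewrite ler_norml cos_geN1 cos_le1. Qed.

Lemma integrable_cosdot x : f.-integrable setT (EFin \o (fun v => cos (dot v x))).
Proof.
apply: (integrable_bounded (C := 1)) => [|v]; first by mfun.
exact: norm_cos_le1.
Qed.

Lemma one_sub_Re x : 1 - complex.Re (phi x) = \int[f]_v (1 - cos (dot v x)).
Proof.
rewrite RintegralB//; last exact: integrable_cosdot.
  rewrite Re_charfun (Rintegral_cst f measurableT).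
  by rewrite (_ : fine _ = 1) ?mulr1//; rewrite -[RHS]/(fine 1); congr fine; exact: probability_setT.
by apply: (integrable_bounded (C := 1)) => [|v]; [exact: (@measurable_cst _ _ _ _ _ _)|rewrite normr1].
Qed.

Lemma integrable_1cos x : f.-integrable setT (EFin \o (fun v => 1 - cos (dot v x))).
Proof.
apply: (integrable_bounded (C := 2)) => [|v]; first by mfun.
by rewrite (le_trans (ler_normB _ _))// normr1; have := norm_cos_le1 (dot v x); lra.
Qed.

Lemma integrable_1cosZ (a : R) x :
  f.-integrable setT (EFin \o (fun v => a * (1 - cos (dot v x)))).
Proof.
apply: (integrable_bounded (C := `|a| * 2)) => [|v]; first by mfun.
rewrite normrM ler_wpM2l// (le_trans (ler_normB _ _))// normr1.
by have := norm_cos_le1 (dot v x); lra.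
Qed.

Lemma integrable_1cosD (a b : R) x y : f.-integrable setT
  (EFin \o (fun v => a * (1 - cos (dot v x)) + b * (1 - cos (dot v y)))).
Proof.
apply: (eq_integrable measurableT (fun v => (a * (1 - cos (dot v x)))%:E +
  (b * (1 - cos (dot v y)))%:E)%E); first by [].
exact: (integrableD measurableT (integrable_1cosZ a x) (integrable_1cosZ b y)).
Qed.

Lemma one_sub_Re_ge0 x : 0 <= 1 - complex.Re (phi x).
Proof.
by rewrite one_sub_Re; apply: Rintegral_ge0 => v _; rewrite subr_ge0 cos_le1.
Qed.

Definition defect x : R := normc (phi x - 1).

Lemma one_sub_Re_le x : 1 - complex.Re (phi x) <= defect x.
Proof.
apply: le_trans (normc_Re _); rewrite ReB /= distrC ger0_norm//.
exact: one_sub_Re_ge0.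
Qed.

(** Pointwise, [1 - cos (a + b) <= 2 * (1 - cos a) + 2 * (1 - cos b)]. *)
Lemma one_sub_Re_add x y : 1 - complex.Re (phi (x + y)) <=
  2 * (1 - complex.Re (phi x)) + 2 * (1 - complex.Re (phi y)).
Proof.
rewrite !one_sub_Re -!RintegralZl//; last 2 first.
  exact: integrable_1cos.
  exact: integrable_1cos.
rewrite -(RintegralD measurableT (integrable_1cosZ 2 x) (integrable_1cosZ 2 y)).
apply: le_Rintegral => //; first exact: integrable_1cos.
  exact: integrable_1cosD.
move=> v _; rewrite dotDr cosD; set a := dot v x; set b := dot v y.
set C := cos a * cos b - sin a * sin b; pose S := sin a * cos b + cos a * sin b.
have hb := cos2Dsin2 b.
have E1 : C ^+ 2 + S ^+ 2 = 1.
  by rewrite -[RHS](mulr1 1) -{1}(cos2Dsin2 a) -hb /C /S; ring.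
have E2 : C * cos b + S * sin b = cos a by rewrite -[RHS]mulr1 -hb /C /S; ring.
have := sqr_ge0 (C - 2 * cos b + 1); have := sqr_ge0 (S - 2 * sin b).
by move: C S E1 E2 => C S E1 E2; nra.
Qed.

Lemma Cintegral_comb x y z (a : R) :
  Cintegral f setT (fun v => cexpi (- dot v x) + cexpi (- dot v y) - a%:C * cexpi (- dot v z)) =
  phi x + phi y - a%:C * phi z.
Proof.
have Ixy : Cintegrable f setT (fun v => cexpi (- dot v x) + cexpi (- dot v y)).
  apply: (bounded_Cintegrable (C := 1 + 1)).
    by apply: mcomplex_add; exact: mcomplex_expdot.
  by move=> v; apply: le_trans (normcD _ _) _; rewrite !normc_cexpi.
have Iz : Cintegrable f setT (fun v => a%:C * cexpi (- dot v z)).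
  apply: (bounded_Cintegrable (C := `|a|)).
    apply: mcomplex_mul; last exact: mcomplex_expdot.
    by apply: mcomplex_real; exact: (@measurable_cst _ _ _ _ _ _).
  by move=> v; rewrite normcM normc_cexpi mulr1 normc_real.
rewrite CintegralB// CintegralD//; last 2 first.
  exact: Cintegrable_expdot.
  exact: Cintegrable_expdot.
by rewrite CintegralZ//; exact: Cintegrable_expdot.
Qed.

(** The integrand is [2 * (cos (dot v y) - 1)] times a number of modulus [1]. *)
Lemma second_difference z y :
  normc (phi (z + y) + phi (z - y) - 2%:C * phi z) <= 2 * (1 - complex.Re (phi y)).
Proof.
rewrite -Cintegral_comb -lee_fin.
have mg : mcomplex (fun v => cexpi (- dot v (z + y)) + cexpi (- dot v (z - y)) -
    2%:C * cexpi (- dot v z)).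
  apply: mcomplex_sub; first by apply: mcomplex_add; exact: mcomplex_expdot.
  by apply: mcomplex_mul; [exact: mcomplex_cst|exact: mcomplex_expdot].
apply: le_trans (normc_Cintegral f measurableT mg) _.
rewrite one_sub_Re -RintegralZl//; last exact: integrable_1cos.
rewrite /Rintegral fineK; last exact: (integrable_fin_num measurableT (integrable_1cosZ 2 y)).
apply: ge0_le_integral => //.
- by move=> v _; rewrite lee_fin normc_ge0.
- by apply: mereal_EFin; exact: mreal_normc.
- by mfun.
- move=> v _; rewrite lee_fin; apply: normc_leP.
    by rewrite mulr_ge0// subr_ge0 cos_le1.
  rewrite ReB ReD ImB ImD ReM ImM /= !mul0r addr0 subr0 !dotDr dotNr.
  move: (dot v z) (dot v y) => a b.
  rewrite !cosN !sinN !cosD !sinD cosN sinN.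
  rewrite le_eqVlt; apply/orP; left; apply/eqP.
  transitivity ((cos a ^+ 2 + sin a ^+ 2) * (2 * (1 - cos b)) ^+ 2); first by ring.
  by rewrite cos2Dsin2 mul1r.
Qed.

(** With [e] and [e'] the exponentials at [z] and [y], the integrand
    [e - e * e'] is [(1 - e') + (e - 1) * (1 - e')]; the product is split by the
    arithmetic-geometric inequality with weight [kappa], since
    [|e - 1|^2 = 2 * (1 - cos (dot v z))]. *)
Lemma charfun_sub_le z y (kappa : R) : 0 < kappa ->
  normc (phi z - phi (z + y)) <= defect y + (kappa * defect z + kappa^-1 * defect y).
Proof.
move=> k0.
have kV0 : 0 < kappa^-1 by rewrite invr_gt0.
have mg : mcomplex (fun v => (cexpi (- dot v z) - 1) * (1 - cexpi (- dot v y))).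
  by apply: mcomplex_mul; apply: mcomplex_sub;
    first [exact: mcomplex_cst|exact: mcomplex_expdot].
pose B v := kappa * (1 - cos (dot v z)) + kappa^-1 * (1 - cos (dot v y)).
have B0 v : 0 <= B v by apply: addr_ge0; apply: mulr_ge0; rewrite ?subr_ge0 ?cos_le1//; exact: ltW.
have gB v : normc ((cexpi (- dot v z) - 1) * (1 - cexpi (- dot v y))) <= B v.
  apply: normc_leP => //.
  rewrite -normc_sq normcM exprMn !normc_sq !ReB !ImB /= !cosN !sinN !subr0 !sub0r opprK.
  have hz := cos2Dsin2 (dot v z); have hy := cos2Dsin2 (dot v y).
  rewrite /B.
  set c := cos (dot v z) in hz *; set s := sin (dot v z) in hz *.
  set c' := cos (dot v y) in hy *; set s' := sin (dot v y) in hy *.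
  have -> : (c - 1) ^+ 2 + (- s) ^+ 2 = 2 * (1 - c).
    rewrite (_ : _ + _ = (c ^+ 2 + s ^+ 2) + 1 - 2 * c); last by ring.
    by rewrite hz; ring.
  have -> : (1 - c') ^+ 2 + s' ^+ 2 = 2 * (1 - c').
    rewrite (_ : _ + _ = (c' ^+ 2 + s' ^+ 2) + 1 - 2 * c'); last by ring.
    by rewrite hy; ring.
  rewrite -subr_ge0 (_ : _ - _ = (kappa * (1 - c) - kappa^-1 * (1 - c')) ^+ 2) ?sqr_ge0//.
  by field; rewrite gt_eqF.
have gle : normc (Cintegral f setT (fun v => (cexpi (- dot v z) - 1) * (1 - cexpi (- dot v y))))
    <= kappa * (1 - complex.Re (phi z)) + kappa^-1 * (1 - complex.Re (phi y)).
  rewrite -lee_fin; apply: le_trans (normc_Cintegral f measurableT mg) _.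
  rewrite !one_sub_Re -!RintegralZl//; last 2 first.
    exact: integrable_1cos.
    exact: integrable_1cos.
  rewrite -(RintegralD measurableT (integrable_1cosZ kappa z) (integrable_1cosZ kappa^-1 y)).
  rewrite /Rintegral fineK; last exact: (integrable_fin_num measurableT (integrable_1cosD _ _ z y)).
  apply: ge0_le_integral => //.
  - by move=> v _; rewrite lee_fin normc_ge0.
  - by apply: mereal_EFin; exact: mreal_normc.
  - by mfun.
  - by move=> v _; rewrite lee_fin; exact: gB.
have -> : phi z - phi (z + y) =
    (1 - phi y) + Cintegral f setT (fun v => (cexpi (- dot v z) - 1) * (1 - cexpi (- dot v y))).
  have -> : Cintegral f setT (fun v => (cexpi (- dot v z) - 1) * (1 - cexpi (- dot v y))) =
      Cintegral f setT (fun v => (cexpi (- dot v z) + cexpi (- dot v y) - 1%:C * cexpi (- dot v 0))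
         - cexpi (- dot v (z + y))).
    apply: eq_Cintegral => v _; rewrite dot0r oppr0 dotDr.
    move: (dot v z) (dot v y) => a b.
    rewrite /cexpi (opprD a b) cosD sinD cos0 sin0.
    by apply: complex_eq; rewrite !(ReB, ReD, ReM, ImB, ImD, ImM) /=; ring.
  rewrite CintegralB//; last 2 first.
  - apply: (bounded_Cintegrable (C := (1 + 1) + 1)).
      apply: mcomplex_sub; first by apply: mcomplex_add; exact: mcomplex_expdot.
      by apply: mcomplex_mul; [exact: mcomplex_cst|exact: mcomplex_expdot].
    move=> v; apply: le_trans (normcB _ _) _; rewrite lerD//.
      by apply: le_trans (normcD _ _) _; rewrite !normc_cexpi.
    by rewrite normcM normc_real normc_cexpi normr1 mulr1.
  - exact: Cintegrable_expdot.
  rewrite Cintegral_comb charfun0 -/(phi (z + y)) (_ : 1%:C = 1)//.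
  by move: (phi z) (phi y) (phi (z + y)) => p1 p2 p3; ring.
apply: le_trans (normcD _ _) _; rewrite lerD//.
  by rewrite -normcN opprB /defect.
apply: le_trans gle _; rewrite lerD// ler_pM2l//; exact: one_sub_Re_le.
Qed.

Lemma mreal_expectation (g : R3 R * R3 R -> R) : mreal g -> (forall p, `|g p| <= 1) ->
  mreal (fun x => \int[f]_v g (x, v)).
Proof.
move=> mg g1.
have gI x : f.-integrable setT (EFin \o (fun v => g (x, v))).
  by apply: (integrable_bounded (C := 1)) => //; mfun.
have -> : (fun x => \int[f]_v g (x, v)) =
    (fun x => fine (\int[f]_v (1 + g (x, v))%:E)%E - 1).
  apply/funext => x.
  have I1 : f.-integrable setT (EFin \o (fun _ : R3 R => 1 : R)).
    by apply: (integrable_bounded (C := 1)) => [|v]; [exact: (@measurable_cst _ _ _ _ _ _)|rewrite normr1].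
  have := RintegralD measurableT I1 (gI x); rewrite (Rintegral_cst f measurableT).
  rewrite (_ : fine _ = 1); last first.
    by rewrite -[RHS]/(fine 1); congr fine; exact: probability_setT.
  by rewrite mulr1 {1}/Rintegral => ->; rewrite addrC addKr.
have h : measurable_fun setT (fun x => \int[f]_v (1 + g (x, v))%:E)%E.
  apply: meas_integral => //; first by mfun.
  move=> x v; rewrite lee_fin.
  by have := g1 (x, v); rewrite ler_norml => /andP[? _]; lra.
apply: mreal_add; last exact: (@measurable_cst _ _ _ _ _ _).
exact: mreal_fine.
Qed.

Lemma mcomplex_charfun : mcomplex phi.
Proof.
split.
- have h := @mreal_expectation (fun p => cos (- dot p.2 p.1)).
  by apply: h; [mfun|move=> p; rewrite ler_norml cos_geN1 cos_le1].
- have h := @mreal_expectation (fun p => sin (- dot p.2 p.1)).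
  by apply: h; [mfun|move=> p; rewrite ler_norml sin_geN1 sin_le1].
Qed.

Lemma normc_charfun x : normc (phi x) <= 1.
Proof.
rewrite -lee_fin; apply: le_trans (normc_Cintegral f measurableT (mcomplex_expdot x)) _.
rewrite (eq_integral (fun=> 1%E)); last by move=> v _; rewrite normc_cexpi.
rewrite (integral_cst f measurableT) mul1e.
have h : (f [set: R3 R] <= 1)%E by rewrite probability_setT.
exact: h.
Qed.

End CharacteristicFunctions.

(** * Cancellation in the azimuthal average *)

(** The counterpart of [mfun] for [mcomplex]. *)
Ltac mcfun := repeat match goal with
  | |- mcomplex (fun x => ?c) => exact (@mcomplex_cst _ _ _ c)
  | |- mcomplex ?f => match goal with H : mcomplex ?g |- _ => constr_eq f g; exact H end
  | |- mcomplex (fun x => (@?f x) - (@?g x)) => refine (@mcomplex_sub _ _ _ f g _ _)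
  | |- mcomplex (fun x => (@?f x) + (@?g x)) => refine (@mcomplex_add _ _ _ f g _ _)
  | |- mcomplex (fun x => (@?f x) * (@?g x)) => refine (@mcomplex_mul _ _ _ f g _ _)
  | |- mcomplex (fun x => (@?f x)%:C) => refine (@mcomplex_real _ _ _ f _); mfun
  | |- mcomplex (fun x => ?h (@?g x)) =>
      match goal with H : mcomplex h |- _ =>
        refine (@mcomplex_comp _ _ _ _ _ h g H _); mfun end
  end.

Section ParametricComplexIntegral.
Context d d1 (T : measurableType d) (T1 : measurableType d1) (R : realType)
  (m : {sigma_finite_measure set T1 -> \bar R}) (D : set T1) (mD : measurable D).

Lemma mreal_Rintegral (F : T -> T1 -> R) :
  mreal (fun p : T * T1 => F p.1 p.2) -> mreal (fun x => \int[m]_(y in D) F x y).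
Proof.
move=> mF.
have -> : (fun x => \int[m]_(y in D) F x y) =
    (fun x => fine (\int[m]_(y in D) (Num.max (F x y) 0)%:E
                    - \int[m]_(y in D) (Num.max (- F x y) 0)%:E)%E).
  by apply/funext => x; rewrite /Rintegral integralE; congr (fine (_ - _)%E);
    apply: eq_integral => y _; rewrite ?funeposE ?funenegE EFin_max.
apply: mreal_fine; apply: emeasurable_funB.
- by refine (@meas_integral _ _ _ _ _ m D (fun x y => (Num.max (F x y) 0)%:E) mD _ _);
    [mfun|move=> x y; rewrite lee_fin le_max lexx orbT].
- by refine (@meas_integral _ _ _ _ _ m D (fun x y => (Num.max (- F x y) 0)%:E) mD _ _);
    [mfun|move=> x y; rewrite lee_fin le_max lexx orbT].
Qed.

Lemma mcomplex_Cintegral (F : T -> T1 -> R[i]) :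
  mcomplex (fun p : T * T1 => F p.1 p.2) -> mcomplex (fun x => Cintegral m D (F x)).
Proof. by move=> [m1 m2]; split; exact: mreal_Rintegral. Qed.

End ParametricComplexIntegral.

Section OddIntegrals.
Context (R : realType).
Notation mu := (@lebesgue_measure R).
Notation RR := (measurableTypeR R).

Lemma ge0_integral_antipode (F : RR -> \bar R) :
  measurable_fun setT F -> (forall w, 0 <= F w)%E ->
  (\int[mu]_(w in `[0%R, (2 * pi)%R]) F w =
   \int[mu]_(w in `[0%R, pi]) F w + \int[mu]_(w in `[0%R, pi]) F (w + pi)%R)%E.
Proof.
move=> mF F0.
have -> : [set` `[0, 2 * pi]] = [set` `[0, pi]] `|` [set` `]pi, 2 * pi]] :> set RR.
  apply/seteqP; split => t /=; rewrite !in_itv/=.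
    by move=> /andP[t0 t2]; case: (leP t pi) => tp; [left; rewrite t0|right].
  have := pi_gt0 R.
  by move=> ? [|] /andP[? ?]; apply/andP; split; lra.
rewrite ge0_integral_setU//; last 2 first.
- exact: measurable_funTS.
- apply/disj_setPRL => t /=; rewrite !in_itv/= => /andP[pt _]; apply/negP.
  by rewrite negb_and -!ltNge pt orbT.
congr (_ + _)%E.
rewrite (@integral_itv_obnd_cbnd _ pi); last by apply: measurable_funTS.
rewrite [LHS](@ge0_integral_affine_set R 1 pi _ [set` `[0, pi]])//; last first.
  by move=> x; rewrite /= !in_itv/= mul1r; split => /andP[? ?]; apply/andP; split; lra.
rewrite normr1 mul1e; apply: eq_integral => t _.
by rewrite mul1r.
Qed.

(** The half-turn exchanges the positive and the negative part. *)
Lemma Rintegral_odd (g : RR -> R) : mreal g -> (forall w, g (w + pi) = - g w) ->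
  \int[mu]_(w in `[0, 2 * pi]) g w = 0.
Proof.
move=> mg gN; rewrite /Rintegral integralE.
have E (F G : RR -> \bar R) : measurable_fun setT F -> (forall w, 0 <= F w)%E ->
    measurable_fun setT G -> (forall w, 0 <= G w)%E ->
    (forall w, F (w + pi) = G w) -> (forall w, G (w + pi) = F w) ->
    (\int[mu]_(w in `[0%R, (2 * pi)%R]) F w = \int[mu]_(w in `[0%R, (2 * pi)%R]) G w)%E.
  move=> mF F0 mG G0 FG GF; rewrite !ge0_integral_antipode// addeC.
  by congr (_ + _)%E; apply: eq_integral => w _.
have mE : measurable_fun setT (fun w => (g w)%:E) by mfun.
rewrite [X in (X - _)%E](E _ ((fun w => (g w)%:E)^\-)%E) => //.
- by move: (integral _ _ _) => z; case: z => [r||]//=; rewrite subrr.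
- exact: measurable_funepos.
- exact: measurable_funeneg.
- by move=> w; rewrite funeposE funenegE gN.
- by move=> w; rewrite funeposE funenegE gN EFinN oppeK.
Qed.

Lemma Cintegral_odd (g : RR -> R[i]) : mcomplex g -> (forall w, g (w + pi) = - g w) ->
  Cintegral mu `[0, 2 * pi] g = 0.
Proof.
move=> [m1 m2] gN; apply: complex_eq; rewrite /= (Rintegral_odd)// => w.
  by rewrite gN; case: (g w).
by rewrite gN; case: (g w).
Qed.

End OddIntegrals.

Section AzimuthalAverage.
Context (R : realType).
Notation mu := (@lebesgue_measure R).
Notation RR := (measurableTypeR R).
Implicit Types (phi : R3 R -> R[i]) (x : R3 R) (t w : R).

Definition plus_at x t w := xi_plus x (sphere_point (scale3 (enorm x)^-1 x) t w).
Definition minus_at x t w := xi_minus x (sphere_point (scale3 (enorm x)^-1 x) t w).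

(** The azimuthal integral of the collision operator, without the kernel. *)
Definition azimuthal phi x t : R[i] :=
  Cintegral mu `[0, 2 * pi] (fun w =>
    phi (plus_at x t w) * phi (minus_at x t w) - phi 0 * phi x).

Lemma axisE x : scale3 (enorm x) (scale3 (enorm x)^-1 x) = x.
Proof.
have [->|x0] := eqVneq x 0; first by rewrite enorm0 /scale3 /vec3/= !mul0r.
rewrite scale3A divff ?scale31//.
by apply: contra x0 => /eqP/enorm_eq0/eqP.
Qed.

(** As the azimuth varies, [xi+] and [xi-] run over circles of equal radius about
    [cos (t / 2) ^+ 2 * xi] and [sin (t / 2) ^+ 2 * xi]; the offset [z] changes sign
    under the half-turn. *)
Lemma plus_minus_atE x t w (z := scale3 (enorm x * cos (t / 2) * sin (t / 2))
    (frame (scale3 (enorm x)^-1 x) (vec3 (cos w) (sin w) 0))) :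
  plus_at x t w = scale3 (cos (t / 2) ^+ 2) x + z /\
  minus_at x t w = scale3 (sin (t / 2) ^+ 2) x - z.
Proof.
rewrite /z{z} /plus_at /minus_at /xi_plus /xi_minus; set e := scale3 _^-1 x; set h := t / 2.
have tE : t = h + h by rewrite /h; field.
rewrite !sphere_pointE tE cosD sinD.
have := axisE x; rewrite -/e; move: (enorm x) => r xE.
rewrite -xE; case: e {xE} => [[e1 e2] e3]; rewrite /frame.
case: (Defs.ortho _) => [[u1 u2] u3]; rewrite /scale3 /vec3 /=.
by split; congr (_, _, _); rewrite /= -!expr2 cos2sin2; field.
Qed.

Lemma enorm_ge0 x : 0 <= enorm x.
Proof. exact: sqrtr_ge0. Qed.

Lemma meas_plus_at d (T : measurableType d) (f : T -> R3 R) (a b : T -> R) :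
  measurable_fun setT f -> mreal a -> mreal b ->
  measurable_fun setT (fun y => plus_at (f y) (a y) (b y)).
Proof. by move=> mf ma mb; rewrite /plus_at /xi_plus; mfun. Qed.

Lemma meas_minus_at d (T : measurableType d) (f : T -> R3 R) (a b : T -> R) :
  measurable_fun setT f -> mreal a -> mreal b ->
  measurable_fun setT (fun y => minus_at (f y) (a y) (b y)).
Proof. by move=> mf ma mb; rewrite /minus_at /xi_minus; mfun. Qed.

End AzimuthalAverage.

Ltac mfun' := mfun; repeat (match goal with
  | |- measurable_fun _ (fun y => plus_at (@?f y) (@?a y) (@?b y)) => refine (@meas_plus_at _ _ _ f a b _ _ _)
  | |- measurable_fun _ (fun y => minus_at (@?f y) (@?a y) (@?b y)) => refine (@meas_minus_at _ _ _ f a b _ _ _)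
  end; mfun).

Lemma mcomplex_azimuthal (R : realType) d (T : measurableType d) (Phi : T -> R3 R -> R[i])
    (f : T -> R3 R) (a : T -> R) :
  mcomplex (fun p : T * R3 R => Phi p.1 p.2) -> measurable_fun setT f -> mreal a ->
  mcomplex (fun y => azimuthal (Phi y) (f y) (a y)).
Proof.
move=> mPhi mf ma; rewrite /azimuthal.
pose RR := measurableTypeR R.
refine (@mcomplex_Cintegral _ _ T RR R (@lebesgue_measure R) _ (@m02pi R)
  (fun y w => Phi y (plus_at (f y) (a y) w) * Phi y (minus_at (f y) (a y) w) - Phi y 0 * Phi y (f y)) _).
have c (g : T * RR -> R3 R) : measurable_fun setT g ->
    mcomplex (fun p : T * RR => Phi p.1 (g p)).
  move=> mg; refine (@mcomplex_comp _ _ _ _ _ (fun p : T * R3 R => Phi p.1 p.2)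
     (fun p => (p.1, g p)) mPhi _).
  by mfun.
have m1 : measurable_fun setT (fun p : T * RR => f p.1) by mfun.
have m2 : mreal (fun p : T * RR => a p.1) by mfun.
by apply: mcomplex_sub; apply: mcomplex_mul; apply: c; mfun'.
Qed.

Lemma half_sin_gt0 (R : realType) (t : R) : 0 < t < pi / 2 -> 0 < sin (t / 2).
Proof.
have := pi_gt0 R; move=> pi0 /andP[? ?].
by apply: sin_gt0_pi; apply/andP; split; lra.
Qed.

Lemma half_cos_gt0 (R : realType) (t : R) : 0 < t < pi / 2 -> 0 < cos (t / 2).
Proof.
have := pi_gt0 R; move=> pi0 /andP[? ?].
by apply: cos_gt0_pihalf; apply/andP; split; lra.
Qed.

Section AzimuthalBound.
Context (R : realType) (f : probability (R3 R) R).
Notation mu := (@lebesgue_measure R).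
Notation RR := (measurableTypeR R).
Implicit Types (x : R3 R) (t w : R).
Notation phi := (charfun f).
Notation q := (defect f).

Lemma mreal_defect : mreal q.
Proof.
by apply: mreal_normc; apply: mcomplex_sub; [exact: mcomplex_charfun|exact: mcomplex_cst].
Qed.

Definition azimuthal_bound (alpha : R) x t w : R :=
  3 * q (minus_at x t w) + (3 * q (scale3 (sin (t / 2) ^+ 2) x) +
  (sin (t / 2) `^ alpha * q (scale3 (cos (t / 2) ^+ 2) x) +
   (sin (t / 2) `^ alpha)^-1 * q (scale3 (sin (t / 2) ^+ 2) x))).

Lemma Cintegrable_bounded_itv (a b C : R) (g : RR -> R[i]) : mcomplex g ->
  (forall w, normc (g w) <= C) -> Cintegrable mu `[a, b] g.
Proof.
move=> mg gC.
apply: (@Cintegrable_bounded _ _ _ mu `[a, b] _ g C) => //.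
by rewrite [X in (X < _)%E](lebesgue_measure_itv (Interval _ _))/=; case: ifP => _; rewrite ltry.
Qed.

(** The integrand is split into [phi+ * (phi- - 1)], half a second difference of
    [phi] at the centre of the circle described by [xi+], the difference of [phi]
    between this centre and [xi], and a part odd under the half-turn, which
    integrates to [0]. No first difference across the circle remains, and this
    compensates the singularity of the kernel. *)
Lemma normc_azimuthal_le alpha x t : 0 < sin (t / 2) ->
  ((normc (azimuthal phi x t))%:E <=
   \int[mu]_(w in `[0%R, (2 * pi)%R]) (azimuthal_bound alpha x t w)%:E)%E.
Proof.
move=> st.
have mphi : mcomplex phi by exact: mcomplex_charfun.
have mq : mreal q by exact: mreal_defect.
set c2 := cos (t / 2) ^+ 2; set s2 := sin (t / 2) ^+ 2.
pose z w := scale3 (enorm x * cos (t / 2) * sin (t / 2))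
    (frame (scale3 (enorm x)^-1 x) (vec3 (cos w) (sin w) 0)).
pose zeta := scale3 c2 x.
have mz : measurable_fun setT (z : RR -> R3 R) by rewrite /z /frame; mfun.
have mzz : measurable_fun setT (fun w : RR => zeta + z w) by mfun.
have mzz' : measurable_fun setT (fun w : RR => zeta - z w) by mfun.
have mmin : measurable_fun setT (fun w : RR => minus_at x t w) by mfun'.
pose odd w := 2^-1%:C * (phi (zeta + z w) - phi (zeta - z w)).
pose G w := phi (plus_at x t w) * phi (minus_at x t w) - phi 0 * phi x.
pose E w := phi (zeta + z w) * (phi (minus_at x t w) - 1) +
  (2^-1%:C * (phi (zeta + z w) + phi (zeta - z w) - 2%:C * phi zeta) + (phi zeta - phi x)).
have GE w : G w = E w + odd w.
  rewrite /G /E /odd charfun0 mul1r.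
  have [-> _] := plus_minus_atE x t w; rewrite -/(z w) -/c2 -/zeta.
  have h2 : 2%:C = 1 + 1 :> R[i] by rewrite -(rmorphD (@real_complex R))/=; congr (_%:C); ring.
  have hk : 2^-1%:C + 2^-1%:C = 1 :> R[i].
    by rewrite -(rmorphD (@real_complex R))/= -[RHS]/(1%:C); congr (_%:C); field.
  rewrite h2; move: (2^-1%:C) hk => k hk.
  rewrite [RHS](_ : _ = phi (zeta + z w) * (phi (minus_at x t w) - 1) +
    ((k + k) * (phi (zeta + z w) - phi zeta) + (phi zeta - phi x))); last by ring.
  by rewrite hk; ring.
have mE : mcomplex (E : RR -> R[i]) by rewrite /E; mcfun.
have modd : mcomplex (odd : RR -> R[i]) by rewrite /odd; mcfun.
have zN w : z (w + pi) = - z w.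
  rewrite /z cosDpi sinDpi /frame /scale3 /vec3 /=.
  case: (Defs.ortho _) => [[u1 u2] u3] /=.
  by congr (_, _, _); rewrite /=; ring.
have oddN w : odd (w + pi) = - odd w.
  by rewrite /odd zN opprK -mulrN opprB.
have phi1 y : normc (phi y) <= 1 by exact: normc_charfun.
have qb y : q y <= 2.
  by rewrite /defect; apply: le_trans (normcB _ _) _; rewrite -[1]/(1%:C) normc_real normr1; have := phi1 y; lra.
have Ele w : normc (E w) <= azimuthal_bound alpha x t w.
  have minE : z w = scale3 s2 x + (- minus_at x t w).
    have [_ ->] := plus_minus_atE x t w; rewrite -/(z w) -/s2.
    by rewrite opprB addrC subrK.
  have xE : x = zeta + scale3 s2 x.
    rewrite /zeta /c2 /s2; case: (x) => [[x1 x2] x3].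
    by rewrite /scale3 /vec3/= cos2sin2; congr (_, _, _); rewrite /=; ring.
  have sa : 0 < sin (t / 2) `^ alpha by rewrite powR_gt0.
  have T1 : normc (phi (zeta + z w) * (phi (minus_at x t w) - 1)) <= q (minus_at x t w).
    by rewrite normcM -[leRHS]mul1r ler_wpM2r// normc_ge0.
  have T2 : normc (2^-1%:C * (phi (zeta + z w) + phi (zeta - z w) - 2%:C * phi zeta)) <=
      2 * q (scale3 s2 x) + 2 * q (minus_at x t w).
    rewrite normcM normc_real ger0_norm ?invr_ge0//.
    have h1 := second_difference f zeta (z w).
    have h2 := one_sub_Re_add f (scale3 s2 x) (- minus_at x t w).
    have h3 := one_sub_Re_le f (scale3 s2 x).
    have h4 := one_sub_Re_le f (minus_at x t w).
    rewrite -minE Re_charfunN in h2.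
    rewrite mulrC ler_pdivrMr//; lra.
  have T3 : normc (phi zeta - phi x) <= q (scale3 s2 x) +
      (sin (t / 2) `^ alpha * q zeta + (sin (t / 2) `^ alpha)^-1 * q (scale3 s2 x)).
    by rewrite {1}xE; exact: charfun_sub_le.
  rewrite /E; apply: le_trans (normcD _ _) _.
  apply: le_trans (lerD T1 (le_trans (normcD _ _) (lerD T2 T3))) _.
  rewrite /azimuthal_bound -/s2 -/c2 -/zeta; lra.
have Eint : Cintegrable mu `[0, 2 * pi] (E : RR -> R[i]).
  have sa : 0 < sin (t / 2) `^ alpha by rewrite powR_gt0.
  apply: (@Cintegrable_bounded_itv _ _ (3 * 2 + (3 * 2 + (sin (t / 2) `^ alpha * 2 +
    (sin (t / 2) `^ alpha)^-1 * 2))) _ mE) => w.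
  apply: le_trans (Ele w) _; rewrite /azimuthal_bound.
  rewrite !lerD// ?ler_pM2l// ?invr_gt0//.
have oddint : Cintegrable mu `[0, 2 * pi] (odd : RR -> R[i]).
  apply: (@Cintegrable_bounded_itv _ _ 2 _ modd) => w.
  rewrite /odd normcM normc_real ger0_norm ?invr_ge0//.
  rewrite mulrC ler_pdivrMr//; apply: le_trans (normcB _ _) _.
  have := phi1 (zeta + z w); have := phi1 (zeta - z w); lra.
have -> : azimuthal phi x t = Cintegral mu `[0, 2 * pi] E.
  transitivity (Cintegral mu `[0, 2 * pi] (fun w => E w + odd w)).
    by apply: eq_Cintegral => w _; exact: GE.
  by rewrite (CintegralD (@m02pi R) Eint oddint) (Cintegral_odd modd oddN) addr0.
apply: le_trans (normc_Cintegral mu (@m02pi R) mE) _.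
apply: ge0_le_integral.
- exact: m02pi.
- by move=> w _; rewrite lee_fin normc_ge0.
- by apply: measurable_funTS; apply: mereal_EFin; exact: mreal_normc.
- by apply: measurable_funTS; rewrite /azimuthal_bound; mfun'.
- by move=> w _; rewrite lee_fin Ele.
Qed.


Definition angular_integral (H : R3 R -> RR -> RR -> \bar R) : \bar R :=
  (\int[leb3 R]_x \int[mu]_(t in `[0%R, (pi / 2)%R]) \int[mu]_(w in `[0%R, (2 * pi)%R]) H x t w)%E.

Lemma angular_integralD (G H : R3 R -> RR -> RR -> \bar R) :
  measurable_fun setT (fun p : R3 R * RR * RR => G p.1.1 p.1.2 p.2) ->
  measurable_fun setT (fun p : R3 R * RR * RR => H p.1.1 p.1.2 p.2) ->
  (forall x t w, 0 <= G x t w)%E -> (forall x t w, 0 <= H x t w)%E ->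
  (angular_integral (fun x t w => G x t w + H x t w) =
   angular_integral G + angular_integral H)%E.
Proof.
move=> mG mH G0 H0; rewrite /angular_integral.
have m1 (K : R3 R -> RR -> RR -> \bar R) :
    measurable_fun setT (fun p : R3 R * RR * RR => K p.1.1 p.1.2 p.2) ->
    (forall x t w, 0 <= K x t w)%E -> measurable_fun setT (fun p : R3 R * RR =>
      \int[mu]_(w in `[0%R, (2 * pi)%R]) K p.1 p.2 w)%E.
  move=> mK K0.
  by refine (@meas_integral _ _ _ _ _ mu _ (fun (p : R3 R * RR) w => K p.1 p.2 w) (@m02pi R) mK _).
have m2 (K : R3 R -> RR -> RR -> \bar R) :
    measurable_fun setT (fun p : R3 R * RR * RR => K p.1.1 p.1.2 p.2) ->
    (forall x t w, 0 <= K x t w)%E -> measurable_fun setT (fun x : R3 R =>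
      \int[mu]_(t in `[0%R, (pi / 2)%R]) \int[mu]_(w in `[0%R, (2 * pi)%R]) K x t w)%E.
  move=> mK K0.
  refine (@meas_integral _ _ _ _ _ mu _ (fun x t => \int[mu]_(w in `[0%R, (2 * pi)%R]) K x t w)%E (@m0pi2 R) (m1 _ mK K0) _).
  by move=> x t; apply: integral_ge0.
rewrite -ge0_integralD//; last 4 first.
- by move=> x _; do 2 apply: integral_ge0 => ? _.
- exact: m2.
- by move=> x _; do 2 apply: integral_ge0 => ? _.
- exact: m2.
apply: eq_integral => x _; rewrite -ge0_integralD//; last 4 first.
- by move=> t _; apply: integral_ge0 => ? _.
- apply: measurable_funTS; exact: (measurableT_comp (m1 _ mG G0) (pair1_measurable x)).
- by move=> t _; apply: integral_ge0 => ? _.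
- apply: measurable_funTS; exact: (measurableT_comp (m1 _ mH H0) (pair1_measurable x)).
apply: eq_integral => t _; rewrite -ge0_integralD//.
- apply: measurable_funTS; exact: (measurableT_comp mG (pair1_measurable (x, t))).
- apply: measurable_funTS; exact: (measurableT_comp mH (pair1_measurable (x, t))).
Qed.


Lemma angular_integralD4 (H1 H2 H3 H4 : R3 R -> RR -> RR -> \bar R) :
  measurable_fun setT (fun p : R3 R * RR * RR => H1 p.1.1 p.1.2 p.2) ->
  measurable_fun setT (fun p : R3 R * RR * RR => H2 p.1.1 p.1.2 p.2) ->
  measurable_fun setT (fun p : R3 R * RR * RR => H3 p.1.1 p.1.2 p.2) ->
  measurable_fun setT (fun p : R3 R * RR * RR => H4 p.1.1 p.1.2 p.2) ->
  (forall x t w, 0 <= H1 x t w)%E -> (forall x t w, 0 <= H2 x t w)%E ->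
  (forall x t w, 0 <= H3 x t w)%E -> (forall x t w, 0 <= H4 x t w)%E ->
  (angular_integral (fun x t w => H1 x t w + (H2 x t w + (H3 x t w + H4 x t w))) =
   angular_integral H1 + (angular_integral H2 + (angular_integral H3 + angular_integral H4)))%E.
Proof.
move=> m1 m2 m3 m4 p1 p2 p3 p4.
have m34 := mereal_add m3 m4; have m234 := mereal_add m2 m34.
have p34 x t w : (0 <= H3 x t w + H4 x t w)%E by exact: (adde_ge0 (p3 x t w) (p4 x t w)).
have p234 x t w : (0 <= H2 x t w + (H3 x t w + H4 x t w))%E by exact: (adde_ge0 (p2 x t w) (p34 x t w)).
refine (etrans (angular_integralD m1 m234 p1 p234) _); congr (_ + _)%E.
refine (etrans (angular_integralD m2 m34 p2 p34) _); congr (_ + _)%E.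
exact: (angular_integralD m3 m4 p3 p4).
Qed.

(** The four terms of [azimuthal_bound] are transported by [gain_minus] and
    [gain_dilation]; the choice of [sin (t / 2) `^ alpha] as the weight of
    [charfun_sub_le] balances the last two. The constant is
    [2 * pi * (3 + 3 + 1 + 1)]. *)
Lemma azimuthal_integral_le (alpha : R) (k : RR -> R) : 0 < alpha ->
  mreal k -> (forall t, 0 <= k t) ->
  (\int[leb3 R]_x \int[mu]_(t in `[0%R, (pi / 2)%R])
     ((wt alpha x * k t)%:E * (normc (azimuthal phi x t))%:E) <=
   (16 * pi)%:E * ((\int[mu]_(t in `[0%R, (pi / 2)%R]) (k t * `|sin (t / 2)| `^ alpha)%:E)
     * \int[leb3 R]_x ((wt alpha x)%:E * (q x)%:E)))%E.
Proof.
move=> al0 mk k0.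
have mphi : mcomplex phi by exact: mcomplex_charfun.
have mq : mreal q by exact: mreal_defect.
have mqE : measurable_fun setT (fun x => (q x)%:E) by mfun.
have qE0 x : (0 <= (q x)%:E)%E by rewrite lee_fin normc_ge0.
have q0 x : 0 <= q x by exact: normc_ge0.
have w0 := wt_ge0 alpha.
have mw : mreal (wt alpha) := mreal_wt alpha (@measurable_id _ (R3 R) setT).
pose s (t : RR) : RR := sin (t / 2) ^+ 2; pose c (t : RR) : RR := cos (t / 2) ^+ 2.
have ms : mreal s by rewrite /s; mfun.
have mc : mreal c by rewrite /c; mfun.
pose sa (t : RR) : R := sin (t / 2) `^ alpha.
have msa : mreal sa by rewrite /sa; mfun.
have sa0 t : 0 <= sa t by exact: powR_ge0.
pose k1 (t : RR) := 3 * k t; pose k3 (t : RR) := k t * sa t; pose k4 (t : RR) := k t * (sa t)^-1.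
have mk1 : mreal k1 by rewrite /k1; mfun.
have mk3 : mreal k3 by rewrite /k3; mfun.
have mk4 : mreal k4 by rewrite /k4; mfun.
have k10 t : 0 <= k1 t by rewrite /k1 mulr_ge0.
have k30 t : 0 <= k3 t by rewrite /k3 mulr_ge0.
have k40 t : 0 <= k4 t by rewrite /k4 mulr_ge0// invr_ge0.
pose H1 x t w := ((wt alpha x * k1 t)%:E * (q (minus_at x t w))%:E)%E.
pose H2 x t (w : RR) := ((wt alpha x * k1 t)%:E * (q (scale3 (s t) x))%:E)%E.
pose H3 x t (w : RR) := ((wt alpha x * k3 t)%:E * (q (scale3 (c t) x))%:E)%E.
pose H4 x t (w : RR) := ((wt alpha x * k4 t)%:E * (q (scale3 (s t) x))%:E)%E.
have mm (h a : RR -> R) : mreal h -> mreal a ->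
    measurable_fun setT (fun p : R3 R * RR * RR =>
      (wt alpha p.1.1 * h p.1.2)%:E * (q (scale3 (a p.1.2) p.1.1))%:E)%E.
  by move=> mh ma; mfun'.
have m1 : measurable_fun setT (fun p : R3 R * RR * RR => H1 p.1.1 p.1.2 p.2).
  by rewrite /H1; mfun'.
have m2 : measurable_fun setT (fun p : R3 R * RR * RR => H2 p.1.1 p.1.2 p.2) := mm _ _ mk1 ms.
have m3 : measurable_fun setT (fun p : R3 R * RR * RR => H3 p.1.1 p.1.2 p.2) := mm _ _ mk3 mc.
have m4 : measurable_fun setT (fun p : R3 R * RR * RR => H4 p.1.1 p.1.2 p.2) := mm _ _ mk4 ms.
have p1 x t w : (0 <= H1 x t w)%E by rewrite /H1; epos.
have p2 x t w : (0 <= H2 x t w)%E by rewrite /H2; epos.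
have p3 x t w : (0 <= H3 x t w)%E by rewrite /H3; epos.
have p4 x t w : (0 <= H4 x t w)%E by rewrite /H4; epos.
have step : (\int[leb3 R]_x \int[mu]_(t in `[0%R, (pi / 2)%R])
     ((wt alpha x * k t)%:E * (normc (azimuthal phi x t))%:E) <=
   angular_integral (fun x t w => H1 x t w + (H2 x t w + (H3 x t w + H4 x t w))))%E.
  have maz : mreal (fun p : R3 R * RR => normc (azimuthal phi p.1 p.2)).
    apply: mreal_normc; apply: (@mcomplex_azimuthal _ _ _ (fun _ => phi) fst snd).
    - by mcfun.
    - exact: measurable_fst.
    - exact: measurable_snd.
  have mazx x : mreal (fun t : RR => normc (azimuthal phi x t)).
    exact: (measurableT_comp maz (pair1_measurable x)).
  have mH : measurable_fun setT (fun p : R3 R * RR * RR => H1 p.1.1 p.1.2 p.2 +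
      (H2 p.1.1 p.1.2 p.2 + (H3 p.1.1 p.1.2 p.2 + H4 p.1.1 p.1.2 p.2)))%E.
    by refine (mereal_add m1 (mereal_add m2 (mereal_add m3 m4))).
  pose H x t w := (H1 x t w + (H2 x t w + (H3 x t w + H4 x t w)))%E.
  have HH0 x t w : (0 <= H x t w)%E.
    exact: (adde_ge0 (p1 x t w) (adde_ge0 (p2 x t w) (adde_ge0 (p3 x t w) (p4 x t w)))).
  have mHi : measurable_fun setT (fun p : R3 R * RR =>
      \int[mu]_(w in `[0%R, (2 * pi)%R]) H p.1 p.2 w)%E.
    refine (@meas_integral _ _ _ _ _ mu _ (fun (p : R3 R * RR) w => H p.1 p.2 w) (@m02pi R) mH _).
    by move=> p w; exact: HH0.
  have I0 x t : (0 <= \int[mu]_(w in `[0%R, (2 * pi)%R]) H x t w)%E.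
    by apply: integral_ge0 => w _; exact: HH0.
  have L0 x t : (0 <= (wt alpha x * k t)%:E * (normc (azimuthal phi x t))%:E)%E.
    by epos; exact: normc_ge0.
  rewrite /angular_integral; apply: ge0_le_integral.
  - exact: measurableT.
  - by move=> x _; apply: integral_ge0 => t _.
  - refine (@meas_integral _ _ _ _ _ mu _ (fun x t => (wt alpha x * k t)%:E * (normc (azimuthal phi x t))%:E)%E (@m0pi2 R) _ L0).
    by mfun.
  - by refine (@meas_integral _ _ _ _ _ mu _ (fun x t => \int[mu]_(w in `[0%R, (2 * pi)%R]) H x t w)%E (@m0pi2 R) mHi I0).
  move=> x _.
  have mHx : measurable_fun setT (fun t : RR => \int[mu]_(w in `[0%R, (2 * pi)%R]) H x t w)%E.
    exact: (measurableT_comp mHi (pair1_measurable x)).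
  rewrite integral_itv_bndoo; last by apply: measurable_funTS; mfun.
  rewrite [leRHS]integral_itv_bndoo; last exact: measurable_funTS.
  apply: ge0_le_integral.
  - exact: measurable_itv.
  - by move=> t _.
  - by apply: measurable_funTS; mfun.
  - exact: measurable_funTS.
  move=> t /=; rewrite in_itv/= => tI.
  have st : 0 < sin (t / 2).
    exact: half_sin_gt0.
  have wk0 : (0 <= (wt alpha x * k t)%:E)%E by epos.
  apply: le_trans (lee_wpmul2l wk0 (normc_azimuthal_le alpha x st)) _.
  rewrite -ge0Zl; last 4 first.
  - exact: m02pi.
  - by rewrite /azimuthal_bound; mfun'.
  - by move=> w; rewrite /azimuthal_bound; epos.
  - exact: wk0.
  rewrite le_eqVlt; apply/orP; left; apply/eqP; apply: eq_integral => w _.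
  rewrite /H /H1 /H2 /H3 /H4 /azimuthal_bound /k1 /k3 /k4 /sa /s /c -!EFinM -!EFinD.
  by congr EFin; ring.
apply: le_trans step _.
have -> : angular_integral (fun x t w => H1 x t w + (H2 x t w + (H3 x t w + H4 x t w)))%E =
    (angular_integral H1 + (angular_integral H2 + (angular_integral H3 + angular_integral H4)))%E.
  exact: (angular_integralD4 m1 m2 m3 m4 p1 p2 p3 p4).
clear mm m1 m2 m3 m4 p1 p2 p3 p4.
pose K := (\int[mu]_(t in `[0%R, (pi / 2)%R]) (k t * `|sin (t / 2)| `^ alpha)%:E)%E.
pose Q := (\int[leb3 R]_x ((wt alpha x)%:E * (q x)%:E))%E.
have K0 : (0 <= K)%E by apply: integral_ge0 => t _; epos.
have Q0 : (0 <= Q)%E by apply: integral_ge0 => x _; epos.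
have pi0 := pi_gt0 R.
have half t : 0 < t < pi / 2 -> 0 < sin (t / 2).
  exact: half_sin_gt0.
have halfc t : 0 < t < pi / 2 -> 0 < cos (t / 2).
  exact: half_cos_gt0.
(* each of the four terms is at most a multiple of 2 pi K Q *)
have bnd (k' g : RR -> R) (a : R) (I : \bar R) : 0 <= a -> mreal k' -> (forall t, 0 <= k' t) ->
    mreal g -> (forall t, 0 <= g t) ->
    (forall t, 0 < t < pi / 2 -> k' t * g t <= a * (k t * sa t)) ->
    I = ((2 * pi)%:E * ((\int[mu]_(t in `[0%R, (pi / 2)%R]) (k' t * g t)%:E) * Q))%E ->
    (I <= (2 * pi * a)%:E * (K * Q))%E.
  move=> a0 mk' k'0 mg g0 le ->.
  rewrite (EFinM (2 * pi) a) -muleA; apply: lee_wpmul2l; first by rewrite lee_fin mulr_ge0// ltW.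
  rewrite muleA; apply: lee_wpmul2r => //; rewrite -ge0Zl; last 4 first.
  - exact: m0pi2.
  - by mfun.
  - by move=> t; epos.
  - by rewrite lee_fin.
  rewrite integral_itv_bndoo; last by apply: measurable_funTS; mfun.
  rewrite [leRHS]integral_itv_bndoo; last by apply: measurable_funTS; mfun.
  apply: ge0_le_integral.
  - exact: measurable_itv.
  - by move=> t _; epos.
  - by apply: measurable_funTS; mfun.
  - by apply: measurable_funTS; mfun.
  move=> t /=; rewrite in_itv/= => tI.
  by rewrite lee_fin; apply: le_trans (le t tI) _; rewrite /sa (gtr0_norm (half t tI)).
have sq1 (y : R) : 0 < y <= 1 -> `|y ^+ 2| `^ alpha = y `^ alpha * y `^ alpha.
  move=> /andP[y0 y1]; rewrite ger0_norm ?sqr_ge0// expr2 powRM// ltW//.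
have le1 (y : R) : 0 <= y <= 1 -> y `^ alpha <= 1.
  move=> /andP[y0 y1]; have <- : 1 `^ alpha = 1 :> R by rewrite powR1.
  by rewrite ge0_ler_powR// ?nnegrE// ltW.
have B1 : (angular_integral H1 <= (2 * pi * 3)%:E * (K * Q))%E.
  apply: (bnd k1 (fun t => `|sin (t / 2)| `^ alpha)) => //.
  - by mfun.
  - by move=> t tI; rewrite /k1 /sa (gtr0_norm (half t tI)) mulrA.
  - exact: (gain_minus al0 mk1 k10 mqE qE0).
have B2 : (angular_integral H2 <= (2 * pi * 3)%:E * (K * Q))%E.
  apply: (bnd k1 (fun t => `|s t| `^ alpha)) => //.
  - by mfun.
  - move=> t tI; have st := half t tI.
    rewrite /s sq1 ?st ?sin_le1// /k1 /sa -mulrA ler_pM2l// ler_wpM2l//.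
    have s1 : sin (t / 2) `^ alpha <= 1 by apply: le1; rewrite ltW//= sin_le1.
    by rewrite -[leRHS]mul1r; apply: ler_wpM2r => //; exact: powR_ge0.
  - apply: (gain_dilation al0 mk1 k10 mqE qE0 ms) => t tI.
    by rewrite /s expf_neq0// gt_eqF// half.
have B3 : (angular_integral H3 <= (2 * pi * 1)%:E * (K * Q))%E.
  apply: (bnd k3 (fun t => `|c t| `^ alpha)) => //.
  - by mfun.
  - move=> t tI; have ct := halfc t tI.
    rewrite /c sq1 ?ct ?cos_le1// /k3 mul1r -[leRHS]mulr1.
    have c1 : cos (t / 2) `^ alpha <= 1 by apply: le1; rewrite ltW//= cos_le1.
    apply: ler_wpM2l; first exact: mulr_ge0.
    by rewrite mulr_ile1 ?powR_ge0.
  - apply: (gain_dilation al0 mk3 k30 mqE qE0 mc) => t tI.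
    by rewrite /c expf_neq0// gt_eqF// halfc.
have B4 : (angular_integral H4 <= (2 * pi * 1)%:E * (K * Q))%E.
  apply: (bnd k4 (fun t => `|s t| `^ alpha)) => //.
  - by mfun.
  - move=> t tI; have st := half t tI.
    rewrite /s sq1 ?st ?sin_le1// /k4 -/(sa t) mul1r.
    have sa1 : 0 < sa t by rewrite powR_gt0.
    by rewrite -mulrA mulKf// gt_eqF.
  - apply: (gain_dilation al0 mk4 k40 mqE qE0 ms) => t tI.
    by rewrite /s expf_neq0// gt_eqF// half.
apply: le_trans (leeD B1 (leeD B2 (leeD B3 B4))) _.
have KQ0 : (0 <= K * Q)%E by exact: mule_ge0.
have A (a b : R) : 0 <= a -> 0 <= b ->
    (a%:E * (K * Q) + b%:E * (K * Q) = (a + b)%:E * (K * Q))%E.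
  by move=> a0 b0; rewrite EFinD; symmetry; apply: ge0_muleDl; rewrite lee_fin.
have P (a : R) : 0 <= a -> 0 <= 2 * pi * a by move=> a0; rewrite !mulr_ge0// ltW.
rewrite !A ?addr_ge0 ?P//.
rewrite le_eqVlt; apply/orP; left; apply/eqP; congr (_%:E * _)%E; ring.
Qed.

End AzimuthalBound.

(** * Real induction and a one-sided Gronwall inequality *)

Section RealInduction.
Context (R : realType).
Implicit Types (s t : R).

(** Otherwise the supremum of the times up to which [P] holds contradicts one of
    the last two assumptions. *)
Lemma real_induction (P : R -> Prop) : P 0 ->
  (forall s, 0 <= s -> P s -> exists2 d, 0 < d & forall t, s <= t < s + d -> P t) ->
  (forall s, 0 < s -> (forall t, 0 <= t < s -> P t) -> P s) ->
  forall t, 0 <= t -> P t.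
Proof.
move=> P0 Pnext Plim T T0; apply: contrapT => nPT.
pose S := [set t : R | 0 <= t /\ forall r, 0 <= r <= t -> P r].
have S0 : S 0 by split=> // r r0; rewrite (_ : r = 0)//; apply/eqP; rewrite eq_le andbC.
have ST t : S t -> t <= T.
  move=> [t0 St]; rewrite leNgt; apply/negP => Tt; apply: nPT; apply: St.
  by rewrite T0 ltW.
have supS : has_sup S by split; [exists 0|exists T].
pose s := sup S.
have s0 : 0 <= s by exact: (ub_le_sup supS.2 S0).
have Pbelow t : 0 <= t < s -> P t.
  move=> /andP[t0 ts]; have st : 0 < s - t by rewrite subr_gt0.
  have [u [u0 Su] tu] := sup_adherent st supS.
  apply: Su; rewrite t0 ltW//=; move: tu; rewrite -/s; lra.
have Ps : P s.
  have [->//|sn0] := eqVneq s 0.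
  by apply: Plim => //; rewrite lt_neqAle eq_sym sn0.
have [d d0 Pd] := Pnext s s0 Ps.
have Sd : S (s + d / 2).
  split; first by rewrite addr_ge0// divr_ge0// ltW.
  move=> r /andP[r0 rs]; have [rs'|sr] := ltP r s; first by apply: Pbelow; rewrite r0.
  by apply: Pd; rewrite sr/=; lra.
have := ub_le_sup supS.2 Sd; rewrite -/s; lra.
Qed.

Lemma locally_bounded (N : R -> R) (T : R) : 0 <= T ->
  (forall s, 0 <= s -> exists2 d, 0 < d & forall t, 0 <= t -> `|t - s| < d -> N t <= N s + 1) ->
  exists C, forall t, 0 <= t <= T -> N t <= C.
Proof.
move=> T0 loc.
apply: (@real_induction (fun T => exists C, forall t, 0 <= t <= T -> N t <= C)) => //.
- by exists (N 0) => t; rewrite -eq_le => /eqP <-.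
- move=> s s0 [C NC]; have [d d0 Nd] := loc s s0.
  exists d => // u /andP[su usd]; exists (Num.max C (N s + 1)) => t /andP[t0 tu].
  rewrite le_max; have [ts|st] := leP t s; first by rewrite NC// t0.
  by rewrite Nd ?orbT// gtr0_norm ?subr_gt0//; lra.
- move=> s s0 NC; have [d d0 Nd] := loc s (ltW s0).
  have [|C {}NC] := NC (Num.max 0 (s - d / 2)).
    by rewrite le_max lexx/= gt_max s0/=; lra.
  exists (Num.max C (N s + 1)) => t /andP[t0 ts].
  rewrite le_max; have [tsd|std] := leP t (s - d / 2).
    by rewrite NC// t0 le_max tsd orbT.
  by rewrite Nd ?orbT// ler0_norm ?subr_le0//; lra.
Qed.

(** The function [(m 0 + k) * expR ((l + k) * t)] grows faster than the hypothesis
    lets [m] grow, once the error [e] is [k] times its current value; so real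
    induction keeps [m] below it, and [k] tends to [0]. *)
Lemma dini_gronwall (m : R -> R) (l : R) : 0 <= l -> (forall t, 0 <= m t) ->
  (forall s e : R, 0 <= s -> 0 < e -> exists2 d : R, 0 < d &
     forall t, 0 <= t -> `|t - s| < d -> `|m t - m s| <= e) ->
  (forall s e : R, 0 <= s -> 0 < e -> exists2 d : R, 0 < d &
     forall t, s <= t < s + d -> m t <= m s + (t - s) * (l * m s + e)) ->
  forall t, 0 <= t -> m t <= expR (l * t) * m 0.
Proof.
move=> l0 m0 mC mG t t0.
suff H k : 0 < k -> m t <= (m 0 + k) * expR ((l + k) * t).
  apply/ler_addgt0Pr => e e0.
  pose f (k : R) := (m 0 + k) * expR ((l + k) * t).
  have cf : f k @[k --> 0] --> f 0.
    rewrite /f; apply: cvgM; first by apply: cvgD; [exact: cvg_cst|exact: cvg_id].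
    apply: (@continuous_cvg _ _ _ _ _ (fun k : R => (l + k) * t) expR); first exact: continuous_expR.
    apply: cvgM; last exact: cvg_cst.
    by apply: cvgD; [exact: cvg_cst|exact: cvg_id].
  move/cvgrPdist_lt : cf => /(_ e e0) [/= d d0 fd].
  have dd : ball_ (@Num.norm _ R) 0 d (d / 2).
    by rewrite /ball_/= sub0r normrN gtr0_norm ?divr_gt0//; lra.
  have := H (d / 2); rewrite divr_gt0// => /(_ isT) /le_trans; apply.
  have := fd _ dd; rewrite /f !addr0 distrC mulrC => /ltr_normlW.
  by rewrite mulrC; lra.
move=> k0; pose y r := (m 0 + k) * expR ((l + k) * r).
have y0 r : 0 < y r by rewrite mulr_gt0 ?expR_gt0// ltr_wpDl.
apply: (@real_induction (fun r => m r <= y r)) => //.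
- by rewrite /y mulr0 expR0 mulr1 lerDl ltW.
- move=> s s0 my; have [d d0 Hd] := mG s (k * y s) s0 (mulr_gt0 k0 (y0 s)).
  exists d => // r sr; apply: le_trans (Hd r sr) _.
  have rs : 0 <= r - s by rewrite subr_ge0; case/andP: sr.
  apply: (@le_trans _ _ (y s + (r - s) * (l * y s + k * y s))).
    by rewrite lerD// ler_wpM2l// lerD2r ler_wpM2l.
  have -> : y r = y s * expR ((l + k) * (r - s)).
    by rewrite /y -mulrA -expRD; congr (_ * expR _); ring.
  have -> : y s + (r - s) * (l * y s + k * y s) = y s * (1 + (l + k) * (r - s)) by ring.
  by rewrite ler_wpM2l ?expR_ge1Dx// ltW.
- move=> s s0 my; apply/ler_addgt0Pr => e e0.
  have [d d0 Hd] := mC s e (ltW s0) e0.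
  pose r := Num.max 0 (s - d / 2).
  have r0 : 0 <= r by rewrite le_max lexx.
  have rs : r < s by rewrite gt_max s0/=; lra.
  have sr : s - d / 2 <= r by rewrite le_max lexx orbT.
  have := my r; rewrite r0 rs => /(_ isT) mr.
  have := Hd r r0; rewrite ler0_norm; last by rewrite subr_le0 ltW.
  have -> : - (r - s) < d by lra.
  move=> /(_ isT) /ler_normlP[h1 _].
  have yrs : y r <= y s.
    have k0' := ltW k0; rewrite /y; apply: ler_wpM2l; first exact: addr_ge0.
    by rewrite ler_expR; apply: ler_wpM2l; [exact: addr_ge0|exact: ltW].
  lra.
Qed.

End RealInduction.

(** * Joint measurability *)

Section JointMeasurability.
Context (R : realType) d (T : measurableType d).
Notation RR := (measurableTypeR R).

Lemma meas_countable_pieces (j : RR -> nat) (F : nat -> T -> R) :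
  (forall k, measurable (j @^-1` [set k])) -> (forall k, mreal (F k)) ->
  mreal (fun p : RR * T => F (j p.1) p.2).
Proof.
move=> mj mF _ Y mY; rewrite setTI.
have -> : (fun p : RR * T => F (j p.1) p.2) @^-1` Y =
    \bigcup_k ((j @^-1` [set k]) `*` (F k @^-1` Y)).
  apply/seteqP; split => [p Yp|p [k _ [/= <-//]]].
  by exists (j p.1).
apply: bigcupT_measurable => k; apply: measurableX => //.
by rewrite -[X in measurable X]setTI; exact: mF.
Qed.

(** The function is the limit of those obtained by rounding the time down to a
    multiple of [1 / n.+1]; it is clipped at [0] because continuity is known on
    the half-line only. *)
Lemma caratheodory_measurable (F : RR -> T -> R) :
  (forall t, 0 <= t -> mreal (F t)) ->
  (forall x t e, 0 <= t -> 0 < e -> exists2 d, 0 < d &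
     forall s, 0 <= s -> `|s - t| < d -> `|F s x - F t x| <= e) ->
  mreal (fun p : RR * T => F (Num.max 0 p.1) p.2).
Proof.
move=> mF cF.
pose j (n : nat) (t : RR) : nat := Num.truncn (n.+1%:R * Num.max 0 t : R).
pose h (n : nat) (p : RR * T) : R := F ((j n p.1)%:R / n.+1%:R) p.2.
apply: (@measurable_fun_cvg _ _ _ _ h) => [n|p _].
- apply: (@meas_countable_pieces (j n) (fun k => F (k%:R / n.+1%:R))); last first.
    by move=> k; apply: mF; rewrite divr_ge0.
  move=> k.
  have -> : j n @^-1` [set k] = [set t | k%:R <= n.+1%:R * Num.max 0 t] `&`
      [set t | n.+1%:R * Num.max 0 t < k.+1%:R] :> set RR.
    apply/seteqP; split => t /=; rewrite /j.
      by move=> <-; apply/andP; apply: truncn_itv; rewrite mulr_ge0// le_max lexx.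
    by move=> [h1 h2]; apply/eqP; rewrite truncn_eq ?h1// mulr_ge0// le_max lexx.
  have mg : mreal (fun t : RR => n.+1%:R * Num.max 0 t : R) by mfun.
  apply: measurableI.
  - have := @mbool_le _ _ R (fun=> k%:R) _ (@measurable_cst _ _ _ _ _ _) mg.
    by move=> /(_ measurableT [set true]); rewrite setTI; exact.
  - have := @mbool_lt _ _ R _ (fun=> k.+1%:R) mg (@measurable_cst _ _ _ _ _ _).
    by move=> /(_ measurableT [set true]); rewrite setTI; exact.
- apply/cvgrPdist_le => e e0.
  set t : R := Num.max 0 p.1.
  have t0 : 0 <= t by rewrite le_max lexx.
  have [dl dl0 Fd] := cF p.2 t e t0 e0.
  near=> n; rewrite distrC; apply: Fd; first by rewrite divr_ge0.
  have n0 : 0 < n.+1%:R :> R by [].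
  have /andP[h1 h2] : ((j n p.1)%:R <= n.+1%:R * t < (j n p.1).+1%:R).
    by apply: truncn_itv; rewrite mulr_ge0.
  have dn : n.+1%:R^-1 < dl by near: n; exact: near_infty_natSinv_lt (PosNum dl0).
  have : n.+1%:R * `|(j n p.1)%:R / n.+1%:R - t| < 1.
    rewrite -{1}(gtr0_norm n0) -normrM mulrBr mulrC divfK ?gt_eqF//.
    by rewrite ler0_norm ?subr_le0// opprB ltrBlDl; move: h2; rewrite -[X in _ < X -> _]natr1.
  rewrite mulrC -ltr_pdivlMr// mul1r => /lt_trans; exact.
Unshelve. all: by end_near.
Qed.

End JointMeasurability.

(** * The collision operator in polar coordinates *)

Section CollisionKernel.
Context (R : realType) (b : R -> R).
Notation mu := (@lebesgue_measure R).
Notation RR := (measurableTypeR R).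
Hypotheses
  (b_meas : measurable_fun (`[0, pi] : set R) (fun theta : R => b (cos theta)))
  (b_ge0 : forall theta : R, 0 <= theta <= pi -> 0 <= b (cos theta))
  (b_supp : forall theta : R, pi / 2 < theta <= pi -> b (cos theta) = 0).

(** The kernel against Lebesgue measure in the deviation angle, extended by [0]
    so as to be measurable on the whole line. *)
Definition angular_kernel (t : RR) : R :=
  if (0 <= t) && (t <= pi / 2) then b (cos t) * sin t else 0.
Notation h := angular_kernel.

Lemma angular_kernel_ge0 t : 0 <= h t.
Proof.
rewrite /h; case: ifP => // /andP[t0 t2]; have := pi_gt0 R => pi0.
have tpi : t <= pi by lra.
by rewrite mulr_ge0 ?b_ge0 ?t0//; apply: sin_ge0_pi; rewrite t0.
Qed.

Lemma mreal_angular_kernel : mreal h.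
Proof.
have m2 : measurable_fun (`[0, pi / 2] : set RR) (fun t : RR => b (cos t) * sin t : RR).
  apply: measurable_funM.
    apply: measurable_funS b_meas; first exact: measurable_itv.
    move=> t /=; rewrite !in_itv/= => /andP[-> t2]/=; have := pi_gt0 R; lra.
  by apply: measurable_funTS; have : mreal (fun t : RR => sin t : R) by mfun.
have -> : h = (fun t : RR => b (cos t) * sin t) \_ (`[0, pi / 2] : set RR).
  apply/funext => t; rewrite /h patchE; case: ifPn => [H|/negbTE H].
    by rewrite ifT// inE/= in_itv.
  by rewrite ifF//; apply/negP; rewrite inE/= in_itv/= H.
exact/(measurable_restrictT _ (measurable_itv _)).
Qed.

Lemma Bop_azimuthal (f : probability (R3 R) R) (x : R3 R) : x != 0 ->
  Bop b (charfun f) x =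
  Cintegral mu `[0, pi / 2] (fun t => (h t)%:C * azimuthal (charfun f) x t).
Proof.
move=> x0; rewrite /Bop (negbTE x0) /sphere_integral.
set e := scale3 _ x; have e1 : dot e e = 1 by exact: axis_unit.
have pi0 := pi_gt0 R.
have mphi := mcomplex_charfun f.
have inner t : Cintegral mu `[0, 2 * pi] (fun w => (b (dot e (sphere_point e t w)))%:C *
    (charfun f (xi_plus x (sphere_point e t w)) * charfun f (xi_minus x (sphere_point e t w)) -
     charfun f 0 * charfun f x)) = (b (cos t))%:C * azimuthal (charfun f) x t.
  rewrite /azimuthal -CintegralZ; last 2 first.
  - exact: m02pi.
  - apply: (@Cintegrable_bounded_itv _ _ _ 2).
      have m1 : measurable_fun setT (fun w : RR => plus_at x t w) by mfun'.
      have m2 : measurable_fun setT (fun w : RR => minus_at x t w) by mfun'.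
      by mcfun.
    move=> w; apply: le_trans (normcB _ _) _; rewrite !normcM.
    have n1 y := normc_charfun f y; have n0 y : 0 <= normc (charfun f y) := normc_ge0 _.
    by rewrite (_ : 2 = 1 * 1 + 1 * 1 :> R); [apply: lerD; apply: ler_pM|rewrite mulr1].
  by apply: eq_Cintegral => w _; rewrite dot_sphere_point.
have E (g : R[i] -> R) : g 0 = 0 ->
    \int[mu]_(t in `[0, pi]) g ((sin t)%:C * ((b (cos t))%:C * azimuthal (charfun f) x t)) =
    \int[mu]_(t in `[0, pi / 2]) g ((h t)%:C * azimuthal (charfun f) x t).
  move=> g0; rewrite Rintegral_mkcond [RHS]Rintegral_mkcond; apply: eq_Rintegral => t _.
  rewrite !patchE; case: ifPn => [|/negP]; rewrite ?inE/= in_itv/= => H.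
    rewrite /h; have /andP[t0 tpi] := H; rewrite t0/=.
    have [t2|t2] := leP t (pi / 2).
      rewrite ifT; last by rewrite inE/= in_itv/= t0.
      by rewrite mulrA -rmorphM [sin _ * _]mulrC.
    rewrite ifF; last by apply/negP; rewrite inE/= in_itv/= t0/= leNgt t2.
    by rewrite b_supp ?t2// mul0r mulr0.
  rewrite ifF//; apply/negP; rewrite inE/= in_itv/= => /andP[t0 t2]; apply: H; rewrite t0/=; lra.
transitivity (Cintegral mu `[0, pi] (fun t =>
    (sin t)%:C * ((b (cos t))%:C * azimuthal (charfun f) x t))).
  by apply: eq_Cintegral => t _; rewrite inner.
apply: complex_eq.
- exact: (E (@complex.Re R) erefl).
- exact: (E (@complex.Im R) erefl).
Qed.

End CollisionKernel.

(** * Difference of two collision terms *)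

Section PowerInequalities.
Context (R : realType).
Implicit Types (a c p : R) (x : R3 R).

Lemma powR_ge_sqr c p : 0 <= c <= 1 -> 0 < p <= 2 -> c ^+ 2 <= c `^ p.
Proof.
move=> /andP[c0 c1] /andP[p0 p2]; have [->|cn0] := eqVneq c 0.
  by rewrite expr0n/= powR_ge0.
have cP : 0 < c by rewrite lt_neqAle eq_sym cn0.
by rewrite -powR_mulrn// ger_powR ?cP.
Qed.

(** After division by [r] both terms lie in [[0, 1]], where a power of exponent at
    most [2] is at least the square. *)
Lemma powR_pythagoras a c r p : 0 <= a -> 0 <= c -> 0 <= r -> r ^+ 2 = a ^+ 2 + c ^+ 2 ->
  0 < p <= 2 -> r `^ p <= a `^ p + c `^ p.
Proof.
move=> a0 c0 r0 rE /andP[p0 p2]; have [->|rn0] := eqVneq r 0.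
  by rewrite powR0 ?gt_eqF// addr_ge0 ?powR_ge0.
have rP : 0 < r by rewrite lt_neqAle eq_sym rn0.
have key y : 0 <= y -> y ^+ 2 <= r ^+ 2 -> r `^ p * (y / r) ^+ 2 <= y `^ p.
  move=> y0 yr; have yr' : y <= r by rewrite -ler_sqr ?nnegrE.
  have -> : y `^ p = r `^ p * (y / r) `^ p.
    by rewrite -powRM ?divr_ge0// mulrC divfK// gt_eqF.
  rewrite ler_wpM2l ?powR_ge0// powR_ge_sqr ?p0//.
  by rewrite divr_ge0//= ler_pdivrMr ?mul1r.
have h1 := key a a0; have h2 := key c c0.
rewrite rE lerDl lerDr !sqr_ge0 in h1 h2.
apply: le_trans (lerD (h1 isT) (h2 isT)).
by rewrite -mulrDr !expr_div_n -mulrDl -rE divff ?mulr1// expf_neq0.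
Qed.

Lemma enorm_plus_minus x t w : x != 0 ->
  enorm x ^+ 2 = enorm (plus_at x t w) ^+ 2 + enorm (minus_at x t w) ^+ 2.
Proof.
move=> x0; rewrite !enorm_sq; rewrite /plus_at /minus_at.
rewrite /xi_plus /xi_minus.
have := sphere_point_unit t w (axis_unit x0); move: (sphere_point _ t w) => sg.
have := enorm_sq x; move: (enorm x) => r rE s1.
have {s1} : r ^+ 2 * dot sg sg = dot x x by rewrite s1 mulr1.
case: sg => [[s1 s2] s3]; case: (x) => [[x1 x2] x3].
rewrite /dot /scale3 /vec3 /= => h.
set L := LHS; have -> : L = 2^-1 * L + 2^-1 * L by field.
by rewrite {2}/L -h /L; field.
Qed.

Lemma enorm_plus_le x t w : x != 0 -> enorm (plus_at x t w) <= enorm x.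
Proof.
move=> x0; rewrite -ler_sqr ?nnegrE ?enorm_ge0// (enorm_plus_minus t w x0).
by rewrite lerDl sqr_ge0.
Qed.

Lemma enorm_minus_le x t w : x != 0 -> enorm (minus_at x t w) <= enorm x.
Proof.
move=> x0; rewrite -ler_sqr ?nnegrE ?enorm_ge0// (enorm_plus_minus t w x0).
by rewrite lerDr sqr_ge0.
Qed.

End PowerInequalities.

Lemma Cintegrable_sub (R : realType) d (T : measurableType d)
    (m : {measure set T -> \bar R}) (D : set T) (F G : T -> R[i]) : measurable D ->
  Cintegrable m D F -> Cintegrable m D G -> Cintegrable m D (fun x => F x - G x).
Proof.
move=> mD [mF F1] [mG G1]; split; first exact: mcomplex_sub.
have mnF := mereal_EFin (mreal_normc mF); have mnG := mereal_EFin (mreal_normc mG).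
apply: (@le_lt_trans _ _ (\int[m]_(x in D) ((normc (F x))%:E + (normc (G x))%:E))%E).
  apply: ge0_le_integral => //.
  - by move=> x _; rewrite lee_fin normc_ge0.
  - by apply: measurable_funTS; apply: mereal_EFin; apply: mreal_normc; exact: mcomplex_sub.
  - by apply: measurable_funTS; exact: mereal_add.
  - by move=> x _; rewrite -EFinD lee_fin normcB.
rewrite ge0_integralD//; first exact: lte_add_pinfty.
- by move=> x _; rewrite lee_fin normc_ge0.
- exact: measurable_funTS.
- by move=> x _; rewrite lee_fin normc_ge0.
- exact: measurable_funTS.
Qed.

Section RealMultiples.
Context (R : realType).
Notation mu := (@lebesgue_measure R).
Notation RR := (measurableTypeR R).

Lemma Cintegral_realM (D : set RR) (mD : measurable D) (l : RR -> R) (u : R[i]) :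
  mu.-integrable D (EFin \o l) ->
  Cintegral mu D (fun t => (l t)%:C * u) = (\int[mu]_(t in D) l t)%:C * u.
Proof.
move=> Il; case: u => a c; apply: complex_eq; rewrite /= ?mul0r ?subr0 ?addr0.
- rewrite -RintegralZr//; apply: eq_Rintegral => t _.
  by rewrite /= ?mul0r ?subr0.
- rewrite -RintegralZr//; apply: eq_Rintegral => t _.
  by rewrite /= ?mul0r ?addr0.
Qed.

Lemma ereal_eq_le (x y : \bar R) : x = y -> (x <= y)%E.
Proof. by move=> ->. Qed.

Lemma lebesgue_circle : mu `[0%R, (2 * pi)%R] = (2 * pi)%:E.
Proof.
rewrite [LHS](lebesgue_measure_itv (Interval _ _))/= lte_fin mulr_gt0 ?pi_gt0//.
by rewrite oppr0 addr0.
Qed.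

End RealMultiples.

Section CollisionDifference.
Context (R : realType) (f g : probability (R3 R) R).
Notation mu := (@lebesgue_measure R).
Notation RR := (measurableTypeR R).
Notation phi := (charfun f).
Notation psi := (charfun g).

Definition pair_gap x (t w : R) : R :=
  normc (phi (plus_at x t w) * phi (minus_at x t w) -
         psi (plus_at x t w) * psi (minus_at x t w)).

(** The added multiple of [phi x - psi x] cancels the loss terms. *)
Lemma normc_azimuthal_sub x t :
  ((normc (azimuthal phi x t - azimuthal psi x t + (2 * pi)%:C * (phi x - psi x)))%:E <=
   \int[mu]_(w in `[0%R, (2 * pi)%R]) (pair_gap x t w)%:E)%E.
Proof.
have mphi := mcomplex_charfun f; have mpsi := mcomplex_charfun g.
have n1 y := normc_charfun f y; have n0 y : 0 <= normc (phi y) := normc_ge0 _.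
have n1' y := normc_charfun g y; have n0' y : 0 <= normc (psi y) := normc_ge0 _.
have m1 : measurable_fun setT (fun w : RR => plus_at x t w) by mfun'.
have m2 : measurable_fun setT (fun w : RR => minus_at x t w) by mfun'.
have two : 1 * 1 + 1 * 1 = 2 :> R by rewrite mulr1.
have If : Cintegrable mu `[0, 2 * pi] (fun w : RR =>
    phi (plus_at x t w) * phi (minus_at x t w) - phi 0 * phi x).
  apply: (@Cintegrable_bounded_itv _ _ _ 2); first by mcfun.
  by move=> w; apply: le_trans (normcB _ _) _; rewrite !normcM -two; apply: lerD; apply: ler_pM.
have Ig : Cintegrable mu `[0, 2 * pi] (fun w : RR =>
    psi (plus_at x t w) * psi (minus_at x t w) - psi 0 * psi x).
  apply: (@Cintegrable_bounded_itv _ _ _ 2); first by mcfun.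
  by move=> w; apply: le_trans (normcB _ _) _; rewrite !normcM -two; apply: lerD; apply: ler_pM.
have I1 : mu.-integrable `[0, 2 * pi] (EFin \o (fun _ : RR => 1 : R)).
  apply: (Cintegrable_Re (@m02pi R) (f := fun=> 1%:C)).
  apply: (@Cintegrable_bounded_itv _ _ _ 1); first exact: mcomplex_cst.
  by move=> w; rewrite normc_real normr1.
have Ic : Cintegrable mu `[0, 2 * pi] (fun w : RR => (1 : R)%:C * (phi x - psi x)).
  apply: (@Cintegrable_bounded_itv _ _ _ (normc (1%:C * (phi x - psi x)))) => //.
have Ifg : Cintegrable mu `[0, 2 * pi] (fun w : RR =>
    (phi (plus_at x t w) * phi (minus_at x t w) - phi 0 * phi x) -
    (psi (plus_at x t w) * psi (minus_at x t w) - psi 0 * psi x)).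
  apply: (@Cintegrable_bounded_itv _ _ _ (2 + 2)); first by mcfun.
  move=> w; apply: le_trans (normcB _ _) _; apply: lerD.
    by apply: le_trans (normcB _ _) _; rewrite !normcM -two; apply: lerD; apply: ler_pM.
  by apply: le_trans (normcB _ _) _; rewrite !normcM -two; apply: lerD; apply: ler_pM.
have -> : azimuthal phi x t - azimuthal psi x t + (2 * pi)%:C * (phi x - psi x) =
   Cintegral mu `[0, 2 * pi] (fun w =>
     phi (plus_at x t w) * phi (minus_at x t w) - psi (plus_at x t w) * psi (minus_at x t w)).
  rewrite /azimuthal -(CintegralB (@m02pi R) If Ig).
  have -> : (2 * pi)%:C * (phi x - psi x) =
      Cintegral mu `[0, 2 * pi] (fun=> (1 : R)%:C * (phi x - psi x)).
    rewrite Cintegral_realM//; congr (_%:C * _).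
    symmetry; refine (etrans (Rintegral_cst mu (@m02pi R) 1) _).
    by rewrite mul1r; exact: (congr1 fine (lebesgue_circle R)).
  rewrite -(CintegralD (@m02pi R) Ifg Ic); apply: eq_Cintegral => w _.
  by rewrite !charfun0; ring.
by apply: normc_Cintegral; [exact: m02pi|mcfun].
Qed.

Lemma azimuthal_le4pi x t : normc (azimuthal phi x t) <= 4 * pi.
Proof.
have mphi := mcomplex_charfun f.
have n1 y := normc_charfun f y; have n0 y : 0 <= normc (phi y) := normc_ge0 _.
have m1 : measurable_fun setT (fun w : RR => plus_at x t w) by mfun'.
have m2 : measurable_fun setT (fun w : RR => minus_at x t w) by mfun'.
rewrite -lee_fin; apply: le_trans (normc_Cintegral mu (@m02pi R) _) _; first by mcfun.
apply: (@le_trans _ _ (\int[mu]_(w in `[0%R, (2 * pi)%R]) 2%:E)%E).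
  apply: ge0_le_integral.
  - exact: m02pi.
  - by move=> w _; rewrite lee_fin normc_ge0.
  - by apply: measurable_funTS; apply: mereal_EFin; apply: mreal_normc; mcfun.
  - exact: measurable_cst.
  - move=> w _; rewrite lee_fin; apply: le_trans (normcB _ _) _; rewrite !normcM.
    by rewrite (_ : 2 = 1 * 1 + 1 * 1 :> R); [apply: lerD; apply: ler_pM|rewrite mulr1].
apply: (@le_trans _ _ (2%:E * (2 * pi)%:E)%E).
  rewrite le_eqVlt; apply/orP; left; apply/eqP.
  refine (etrans (integral_cst mu (@m02pi R) 2) _).
  exact: (congr1 (fun z => 2%:E * z)%E (lebesgue_circle R)).
rewrite -EFinM lee_fin; lra.
Qed.

End CollisionDifference.

Section TruncatedCollision.
Context (R : realType) (f g : probability (R3 R) R).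
Notation mu := (@lebesgue_measure R).
Notation RR := (measurableTypeR R).
Notation phi := (charfun f).
Notation psi := (charfun g).
Variables (h k : RR -> R) (N : R).
Hypotheses (mh : mreal h) (mk : mreal k) (k0 : forall t, 0 <= k t)
  (kh : forall t, k t <= h t) (kN : forall t, k t <= N).
Notation Ihalf := (`[0, pi / 2]%classic : set RR).

Lemma mreal_azimuthal_charfun (f' : probability (R3 R) R) x :
  mcomplex (fun t : RR => azimuthal (charfun f') x t).
Proof.
have mphi := mcomplex_charfun f'.
apply: (@mcomplex_azimuthal _ _ RR (fun _ => charfun f') (fun _ => x) id).
- by mcfun.
- exact: measurable_cst.
- exact: measurable_id.
Qed.

Lemma lebesgue_half_fin : (mu Ihalf < +oo)%E.
Proof. by rewrite [X in (X < _)%E](lebesgue_measure_itv (Interval _ _))/=; case: ifP => _; rewrite ltry. Qed.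

Lemma truncation_integrable : Cintegrable mu Ihalf (fun t => (k t)%:C).
Proof.
apply: (@Cintegrable_bounded_itv _ _ _ N); first exact: mcomplex_real.
by move=> t; rewrite normc_real ger0_norm.
Qed.

(** Gain and loss are separated for the integrable kernel [k] alone; on [h - k]
    the cancellation within each azimuthal average is kept. If the integral
    against [h - k] is infinite there is nothing to prove, and otherwise all the
    integrals converge. *)
Lemma collision_difference x :
  ((normc (Cintegral mu Ihalf (fun t => (h t)%:C * azimuthal phi x t)
        - Cintegral mu Ihalf (fun t => (h t)%:C * azimuthal psi x t)
        + (2 * pi * \int[mu]_(t in Ihalf) k t)%:C * (phi x - psi x)))%:E <=
   \int[mu]_(t in Ihalf) ((h t - k t) * (normc (azimuthal phi x t) + normc (azimuthal psi x t)))%:E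
   + \int[mu]_(t in Ihalf) ((k t)%:E * \int[mu]_(w in `[0%R, (2 * pi)%R]) (pair_gap f g x t w)%:E))%E.
Proof.
have ma := mreal_azimuthal_charfun f x; have mb := mreal_azimuthal_charfun g x.
have mna := mreal_normc ma; have mnb := mreal_normc mb.
have mphi := mcomplex_charfun f; have mpsi := mcomplex_charfun g.
have mP : measurable_fun setT (fun t : RR =>
    ((h t - k t) * (normc (azimuthal phi x t) + normc (azimuthal psi x t)))%:E).
  exact: (mereal_EFin (mreal_mul (mreal_add mh (mreal_opp mk)) (mreal_add mna mnb))).
set P := integral mu Ihalf (fun t => ((h t - k t) * _)%:E).
set G := integral mu Ihalf (fun t => (_ * integral _ _ _)%E).
have hk0 t : 0 <= h t - k t by rewrite subr_ge0.
have h0 t : 0 <= h t by apply: le_trans (kh t).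
have P0 : (0 <= P)%E.
  by apply: integral_ge0 => t _; rewrite lee_fin mulr_ge0// addr_ge0// normc_ge0.
have G0 : (0 <= G)%E.
  apply: integral_ge0 => t _; rewrite mule_ge0 ?lee_fin//; apply: integral_ge0 => w _.
  by rewrite lee_fin normc_ge0.
have mG : measurable_fun setT (fun t : RR => \int[mu]_(w in `[0%R, (2 * pi)%R]) (pair_gap f g x t w)%:E)%E.
  refine (@meas_integral _ _ _ _ _ mu _ (fun t w => (pair_gap f g x t w)%:E) (@m02pi R) _ _).
    have m1 : measurable_fun setT (fun p : RR * RR => plus_at x p.1 p.2) by mfun'.
    have m2 : measurable_fun setT (fun p : RR * RR => minus_at x p.1 p.2) by mfun'.
    by apply: mereal_EFin; apply: mreal_normc; mcfun.
  by move=> t w; rewrite lee_fin normc_ge0.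
have [PE|Poo] := eqVneq P +oo%E.
  by rewrite PE addye ?leey// gt_eqF// (lt_le_trans _ G0)// ltNy0.
have Pfin : (P < +oo)%E by rewrite ltey.
have hint (f' : probability (R3 R) R) :
    (forall t, normc (azimuthal (charfun f') x t) <=
       normc (azimuthal phi x t) + normc (azimuthal psi x t)) ->
    Cintegrable mu Ihalf (fun t => (h t)%:C * azimuthal (charfun f') x t).
  move=> fle; have mf' := mreal_azimuthal_charfun f' x; have mnf' := mreal_normc mf'.
  split; first by mcfun.
  apply: (@le_lt_trans _ _ (P + \int[mu]_(t in Ihalf) (N * (4 * pi))%:E)%E).
    rewrite /P -ge0_integralD; last 5 first.
    - exact: m0pi2.
    - by move=> t _; rewrite lee_fin mulr_ge0// addr_ge0// normc_ge0.
    - exact: measurable_funTS.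
    - move=> t _; rewrite lee_fin mulr_ge0// ?mulr_ge0// ?pi_ge0//.
      exact: le_trans (k0 t) (kN t).
    - exact: measurable_cst.
    apply: ge0_le_integral.
    - exact: m0pi2.
    - by move=> t _; rewrite lee_fin normc_ge0.
    - by apply: measurable_funTS; apply: mereal_EFin; apply: mreal_normc; mcfun.
    - by apply: measurable_funTS; apply: mereal_add => //; exact: measurable_cst.
    - move=> t _; rewrite -EFinD lee_fin normcM normc_real ger0_norm//.
      rewrite -{1}(subrK (k t) (h t)) mulrDl; apply: lerD.
        exact: ler_wpM2l.
      apply: ler_pM => //; first exact: normc_ge0.
      exact: azimuthal_le4pi.
  apply: lte_add_pinfty => //.
  refine (le_lt_trans (ereal_eq_le (integral_cst mu (@m0pi2 R) _)) _).
  have c0 : (0 <= (N * (4 * pi))%:E)%E.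
    by rewrite lee_fin !mulr_ge0 ?pi_ge0// (le_trans (k0 0)).
  exact: (lte_mul_pinfty c0 isT lebesgue_half_fin).
have I1 : Cintegrable mu Ihalf (fun t => (h t)%:C * azimuthal phi x t).
  by apply: hint => t; rewrite lerDl normc_ge0.
have I2 : Cintegrable mu Ihalf (fun t => (h t)%:C * azimuthal psi x t).
  by apply: hint => t; rewrite lerDr normc_ge0.
have Ik := Cintegrable_Re (@m0pi2 R) truncation_integrable.
have Iu : Cintegrable mu Ihalf (fun t => (2 * pi * k t)%:C * (phi x - psi x)).
  apply: (@Cintegrable_bounded_itv _ _ _ (2 * pi * N * normc (phi x - psi x))).
    by apply: mcomplex_mul; [apply: mcomplex_real; mfun|exact: mcomplex_cst].
  move=> t; rewrite normcM normc_real ger0_norm ?mulr_ge0 ?pi_ge0//.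
  by rewrite ler_wpM2r ?normc_ge0// ler_wpM2l ?mulr_ge0 ?pi_ge0.
have I12 : Cintegrable mu Ihalf (fun t => (h t)%:C * azimuthal phi x t - (h t)%:C * azimuthal psi x t).
  exact: (Cintegrable_sub (@m0pi2 R) I1 I2).
have -> : (2 * pi * \int[mu]_(t in Ihalf) k t)%:C * (phi x - psi x) =
    Cintegral mu Ihalf (fun t => (2 * pi * k t)%:C * (phi x - psi x)).
  rewrite Cintegral_realM; last 2 first.
  - exact: m0pi2.
  - apply: (Cintegrable_Re (@m0pi2 R) (f := fun t => (2 * pi * k t)%:C)).
    apply: (@Cintegrable_bounded_itv _ _ _ (2 * pi * N)); first by apply: mcomplex_real; mfun.
    move=> t; rewrite normc_real ger0_norm ?mulr_ge0 ?pi_ge0//.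
    by rewrite ler_wpM2l ?mulr_ge0 ?pi_ge0.
  by rewrite RintegralZl//; exact: m0pi2.
rewrite -(CintegralB (@m0pi2 R) I1 I2) -(CintegralD (@m0pi2 R) I12 Iu).
apply: le_trans (normc_Cintegral mu (@m0pi2 R) (mcomplex_add I12.1 Iu.1)) _.
have mG' : measurable_fun setT (fun t : RR =>
    (k t)%:E * \int[mu]_(w in `[0%R, (2 * pi)%R]) (pair_gap f g x t w)%:E)%E by mfun.
rewrite /P /G -ge0_integralD; last 5 first.
- exact: m0pi2.
- by move=> t _; rewrite lee_fin mulr_ge0// addr_ge0// normc_ge0.
- exact: measurable_funTS.
- move=> t _; rewrite mule_ge0 ?lee_fin//; apply: integral_ge0 => w _.
  by rewrite lee_fin normc_ge0.
- exact: measurable_funTS.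
apply: ge0_le_integral.
- exact: m0pi2.
- by move=> t _; rewrite lee_fin normc_ge0.
- by apply: measurable_funTS; apply: mereal_EFin; apply: mreal_normc; exact: (mcomplex_add I12.1 Iu.1).
- by apply: measurable_funTS; exact: mereal_add.
move=> t _.
have -> : (h t)%:C * azimuthal phi x t - (h t)%:C * azimuthal psi x t + (2 * pi * k t)%:C * (phi x - psi x)
   = (h t - k t)%:C * (azimuthal phi x t - azimuthal psi x t) +
     (k t)%:C * (azimuthal phi x t - azimuthal psi x t + (2 * pi)%:C * (phi x - psi x)).
  have -> : (h t - k t)%:C = (h t)%:C - (k t)%:C by exact: rmorphB.
  have -> : (2 * pi * k t)%:C = (2 * pi)%:C * (k t)%:C by exact: rmorphM.
  move: (azimuthal phi x t) (azimuthal psi x t) (phi x - psi x) (h t)%:C (k t)%:C (2 * pi)%:C.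
  by move=> *; ring.
apply: (@le_trans _ _ (((h t - k t) * (normc (azimuthal phi x t) + normc (azimuthal psi x t)))%:E +
  (k t)%:E * (normc (azimuthal phi x t - azimuthal psi x t + (2 * pi)%:C * (phi x - psi x)))%:E)%E).
  rewrite -EFinM -EFinD lee_fin; apply: le_trans (normcD _ _) _.
  rewrite !normcM !normc_real !ger0_norm//; apply: lerD => //.
  by apply: ler_wpM2l => //; exact: normcB.
apply: leeD => //; apply: lee_wpmul2l; first by rewrite lee_fin.
exact: normc_azimuthal_sub.
Qed.

End TruncatedCollision.

(** * Growth of the weighted difference in time *)

Section IntegrabilityTransfer.
Context (R : realType) d (T : measurableType d) (m : {measure set T -> \bar R}).
Implicit Types (F : T -> R[i]) (D : set T).

Lemma Cintegrable_subset D D' F : measurable D -> measurable D' -> D' `<=` D ->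
  Cintegrable m D F -> Cintegrable m D' F.
Proof.
move=> mD mD' DD' [mF F1]; split => //; apply: le_lt_trans F1.
apply: ge0_subset_integral => //.
- by apply: measurable_funTS; apply: mereal_EFin; exact: mreal_normc.
- by move=> x _; rewrite lee_fin normc_ge0.
Qed.

Lemma Cintegrable_scale D F (l : T -> R) (C : R) : measurable D -> mreal l ->
  0 <= C -> (forall x, D x -> `|l x| <= C) -> Cintegrable m D F ->
  Cintegrable m D (fun x => (l x)%:C * F x).
Proof.
move=> mD ml C0 lC [mF F1]; split; first by apply: mcomplex_mul => //; exact: mcomplex_real.
have mnF := mereal_EFin (mreal_normc mF).
apply: (@le_lt_trans _ _ (\int[m]_(x in D) (C%:E * (normc (F x))%:E))%E).
  apply: ge0_le_integral => //.
  - by move=> x _; rewrite lee_fin normc_ge0.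
  - apply: measurable_funTS; apply: mereal_EFin; apply: mreal_normc.
    by apply: mcomplex_mul => //; exact: mcomplex_real.
  - by apply: measurable_funTS; apply: mereal_mul => //; exact: measurable_cst.
  - move=> x Dx; rewrite -EFinM lee_fin normcM normc_real ler_wpM2r ?normc_ge0//.
    exact: lC.
rewrite ge0Zl; last 4 first.
- exact: mD.
- exact: mnF.
- by move=> x; rewrite lee_fin normc_ge0.
- by rewrite lee_fin.
by rewrite lte_mul_pinfty.
Qed.

End IntegrabilityTransfer.

Section Duhamel.
Context (R : realType).
Notation mu := (@lebesgue_measure R).
Notation RR := (measurableTypeR R).

Lemma meas_itv (i : interval R) : measurable ([set` i] : set RR).
Proof. exact: measurable_itv. Qed.

Lemma Cintegral_itvB (T s t : R) (F : RR -> R[i]) : 0 <= s -> s <= t -> t <= T ->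
  Cintegrable mu `[0, T] F ->
  Cintegral mu `[0, t] F - Cintegral mu `[0, s] F = Cintegral mu `]s, t] F.
Proof.
move=> s0 st tT IF.
have It : Cintegrable mu `[0, t] F.
  apply: Cintegrable_subset IF; try exact: meas_itv.
  by move=> r /=; rewrite !in_itv/= => /andP[-> rt]; rewrite (le_trans rt).
have IRe := Cintegrable_Re (meas_itv `[0, t]) It.
have IIm := Cintegrable_Im (meas_itv `[0, t]) It.
apply: complex_eq.
- rewrite ReB; apply: (@Rintegral_itvB R (fun r => complex.Re (F r)) (BLeft 0) (BRight t) s IRe).
  + by rewrite bnd_simp.
  + by rewrite bnd_simp.
- rewrite ImB; apply: (@Rintegral_itvB R (fun r => complex.Im (F r)) (BLeft 0) (BRight t) s IIm).
  + by rewrite bnd_simp.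
  + by rewrite bnd_simp.
Qed.

(** In the variable [expR (a * t) * u t] the equation is a plain integral in
    time. *)
Lemma duhamel_increment (a T s t : R) (beta : RR -> R[i]) (u0 : R[i]) (u : R -> R[i]) :
  0 <= a -> Cintegrable mu `[0, T] beta ->
  (forall t, 0 <= t -> u t = (expR (- (a * t)))%:C * u0 +
     Cintegral mu `[0, t] (fun tau => (expR (- (a * (t - tau))))%:C * beta tau)) ->
  0 <= s -> s <= t -> t <= T ->
  (expR (a * t))%:C * u t - (expR (a * s))%:C * u s =
  Cintegral mu `]s, t] (fun tau => (expR (a * tau))%:C * beta tau).
Proof.
move=> a0 Ib uE s0 st tT.
have Ig : Cintegrable mu `[0, T] (fun tau => (expR (a * tau))%:C * beta tau).
  apply: (@Cintegrable_scale _ _ _ _ _ _ _ (expR (a * T))) => //.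
  - by have : mreal (fun tau : RR => expR (a * tau)) by mfun.
  - move=> tau /=; rewrite in_itv/= => /andP[_ tauT].
    by rewrite ger0_norm ?expR_ge0// ler_expR ler_wpM2l.
rewrite -(Cintegral_itvB s0 st tT Ig).
have E r : 0 <= r -> r <= T -> (expR (a * r))%:C * u r =
    u0 + Cintegral mu `[0, r] (fun tau => (expR (a * tau))%:C * beta tau).
  move=> r0 rT; rewrite uE// mulrDr mulrA -rmorphM/= -expRD addrN expR0 mul1r; congr (_ + _).
  rewrite -CintegralZ; last 2 first.
  - exact: meas_itv.
  - apply: (@Cintegrable_scale _ _ _ _ _ _ _ 1) => //.
    + by have : mreal (fun tau : RR => expR (- (a * (r - tau)))) by mfun.
    + move=> tau /=; rewrite in_itv/= => /andP[_ taur].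
      rewrite ger0_norm ?expR_ge0// -[leRHS]expR0 ler_expR oppr_le0 mulr_ge0//.
      by rewrite subr_ge0.
    + apply: Cintegrable_subset Ib; try exact: meas_itv.
      by move=> q /=; rewrite !in_itv/= => /andP[-> qr]; rewrite (le_trans qr).
  apply: eq_Cintegral => tau _; rewrite mulrA -rmorphM/= -expRD.
  by congr ((expR _)%:C * _); ring.
rewrite !E//; [|exact: le_trans tT|exact: le_trans st].
by rewrite opprD addrACA subrr add0r.
Qed.

End Duhamel.

(** From [P * Q - P' * Q' = (P - P') * Q + P' * (Q - Q')]. *)
Lemma product_difference_le (R : realType) (P Q P' Q' : R[i]) (W Wy Wz : R) :
  0 <= Wy -> 0 <= Wz -> W <= Wy * Wz -> Wz * normc Q <= 1 -> Wy * normc P' <= 1 ->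
  W * normc (P * Q - P' * Q') <= Wy * normc (P - P') + Wz * normc (Q - Q').
Proof.
move=> Wy0 Wz0 hW hQ hP'; have n0 u : 0 <= normc u :> R := normc_ge0 u.
have -> : P * Q - P' * Q' = (P - P') * Q + P' * (Q - Q') by ring.
apply: le_trans (ler_wpM2r (n0 _) hW) _.
apply: le_trans (ler_wpM2l (mulr_ge0 Wy0 Wz0) (normcD _ _)) _.
rewrite !normcM mulrDr; apply: lerD.
- rewrite mulrACA -[leRHS]mulr1; apply: ler_wpM2l => //; exact: mulr_ge0.
- rewrite mulrACA -[leRHS]mul1r; apply: ler_wpM2r => //; exact: mulr_ge0.
Qed.

Section GapGrowth.
Context (R : realType) (p delta : R) (h k : measurableTypeR R -> R) (N : R)
  (Phi Psi : measurableTypeR R -> R3 R -> R[i]).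
Notation mu := (@lebesgue_measure R).
Notation RR := (measurableTypeR R).
Notation Ihalf := (`[0, pi / 2]%classic : set RR).
Notation Icircle := (`[0, 2 * pi]%classic : set RR).
Hypotheses (p02 : 0 < p <= 2) (delta0 : 0 <= delta).
Hypotheses (mh : mreal h) (mk : mreal k) (k0 : forall t, 0 <= k t)
  (kh : forall t, k t <= h t) (kN : forall t, k t <= N).
Hypotheses (Phi_char : forall tau, exists f : probability (R3 R) R, Phi tau = charfun f)
  (Psi_char : forall tau, exists f : probability (R3 R) R, Psi tau = charfun f)
  (mPhi : mcomplex (fun q : RR * R3 R => Phi q.1 q.2))
  (mPsi : mcomplex (fun q : RR * R3 R => Psi q.1 q.2)).

Definition growth (tau : RR) (x : R3 R) : R := expR (delta * enorm x `^ p * tau).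

Hypotheses (Phi_le : forall tau x, 0 <= tau -> growth tau x * normc (Phi tau x) <= 1)
  (Psi_le : forall tau x, 0 <= tau -> growth tau x * normc (Psi tau x) <= 1).

Definition gap tau x : R[i] := (growth tau x)%:C * (Phi tau x - Psi tau x).

Definition gap_size tau x : R := growth tau x * normc (Phi tau x - Psi tau x).

Definition collision (F : RR -> R3 R -> R[i]) tau x : R[i] :=
  Cintegral mu Ihalf (fun t => (h t)%:C * azimuthal (F tau) x t).

Definition collision_size (F : RR -> R3 R -> R[i]) tau x : \bar R :=
  (\int[mu]_(t in Ihalf) (h t * normc (azimuthal (F tau) x t))%:E)%E.

(** The contribution of the part [h - k] of the kernel. *)
Definition tail_term tau x : \bar R := (\int[mu]_(t in Ihalf)
  ((h t - k t) * (normc (azimuthal (Phi tau) x t) + normc (azimuthal (Psi tau) x t)))%:E)%E.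

Definition gain_term tau x : \bar R := (\int[mu]_(t in Ihalf) ((k t)%:E *
  \int[mu]_(w in Icircle)
    ((gap_size tau (plus_at x t w))%:E + (gap_size tau (minus_at x t w))%:E)))%E.

Lemma growth_ge0 tau x : 0 <= growth tau x. Proof. exact: expR_ge0. Qed.

(** The sum of the squares of [|xi+|] and [|xi-|] is the square of [|xi|], and
    [p <= 2]. *)
Lemma growth_plus_minus tau x t w : 0 <= tau -> x != 0 ->
  growth tau x <= growth tau (plus_at x t w) * growth tau (minus_at x t w).
Proof.
move=> tau0 x0; rewrite /growth -expRD ler_expR -mulrDl ler_wpM2r// -mulrDr ler_wpM2l//.
apply: powR_pythagoras p02; rewrite ?enorm_ge0//.
exact: enorm_plus_minus.
Qed.

Lemma normc_gap tau x : normc (gap tau x) = gap_size tau x.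
Proof. by rewrite /gap normcM normc_real ger0_norm ?growth_ge0. Qed.

Lemma gap_size_ge0 tau x : 0 <= gap_size tau x.
Proof. by rewrite mulr_ge0 ?growth_ge0 ?normc_ge0. Qed.

Lemma gap_size_plus_minus tau x t w : 0 <= tau -> x != 0 ->
  growth tau x * normc (Phi tau (plus_at x t w) * Phi tau (minus_at x t w) -
         Psi tau (plus_at x t w) * Psi tau (minus_at x t w)) <=
  gap_size tau (plus_at x t w) + gap_size tau (minus_at x t w).
Proof.
move=> tau0 x0; apply: product_difference_le.
- exact: growth_ge0.
- exact: growth_ge0.
- exact: growth_plus_minus.
- exact: Phi_le.
- exact: Psi_le.
Qed.

Lemma mreal_growth d (T : measurableType d) (f : T -> RR) (g : T -> R3 R) :
  measurable_fun setT f -> measurable_fun setT g -> mreal (fun y => growth (f y) (g y)).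
Proof. by move=> mf mg; rewrite /growth; mfun. Qed.

Lemma mcomplex_flow (F : RR -> R3 R -> R[i]) d (T : measurableType d) (f : T -> RR) (g : T -> R3 R) :
  mcomplex (fun q : RR * R3 R => F q.1 q.2) ->
  measurable_fun setT f -> measurable_fun setT g -> mcomplex (fun y => F (f y) (g y)).
Proof.
move=> mF mf mg.
exact: (mcomplex_comp mF (meas_pair mf mg)).
Qed.

Lemma mcomplex_gap d (T : measurableType d) (f : T -> RR) (g : T -> R3 R) :
  measurable_fun setT f -> measurable_fun setT g -> mcomplex (fun y => gap (f y) (g y)).
Proof.
move=> mf mg; apply: mcomplex_mul; first by apply: mcomplex_real; exact: mreal_growth.
by apply: mcomplex_sub; exact: mcomplex_flow.
Qed.

Lemma mreal_gap_size d (T : measurableType d) (f : T -> RR) (g : T -> R3 R) :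
  measurable_fun setT f -> measurable_fun setT g -> mreal (fun y => gap_size (f y) (g y)).
Proof.
move=> mf mg; apply: mreal_mul; first exact: mreal_growth.
by apply: mreal_normc; apply: mcomplex_sub; exact: mcomplex_flow.
Qed.

Lemma mcomplex_flow_azimuthal (F : RR -> R3 R -> R[i]) d (T : measurableType d)
    (f : T -> RR) (g : T -> R3 R) (a : T -> RR) :
  mcomplex (fun q : RR * R3 R => F q.1 q.2) ->
  measurable_fun setT f -> measurable_fun setT g -> mreal a ->
  mcomplex (fun y => azimuthal (F (f y)) (g y) (a y)).
Proof.
move=> mF mf mg ma; apply: (mcomplex_azimuthal (Phi := fun y => F (f y))) => //.
by apply: mcomplex_flow => //; mfun.
Qed.

Lemma measurable_tail_term d (T : measurableType d) (f : T -> RR) (g : T -> R3 R) :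
  measurable_fun setT f -> measurable_fun setT g ->
  measurable_fun setT (fun y => tail_term (f y) (g y)).
Proof.
move=> mf mg; rewrite /tail_term.
refine (@meas_integral _ _ T RR R mu Ihalf (fun y t => ((h t - k t) *
  (normc (azimuthal (Phi (f y)) (g y) t) + normc (azimuthal (Psi (f y)) (g y) t)))%:E)
  (@m0pi2 R) _ _).
- have ma (F : RR -> R3 R -> R[i]) : mcomplex (fun q : RR * R3 R => F q.1 q.2) ->
    mreal (fun q : T * RR => normc (azimuthal (F (f q.1)) (g q.1) q.2)).
    move=> mF; apply: mreal_normc.
    by apply: (@mcomplex_flow_azimuthal F _ _ (fun q : T * RR => f q.1) (fun q => g q.1) snd mF); mfun; exact: measurable_snd.
  have m1 := ma _ mPhi; have m2 := ma _ mPsi.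
  have m3 : mreal (fun q : T * RR => h q.2 - k q.2) by mfun.
  exact: (mereal_EFin (mreal_mul m3 (mreal_add m1 m2))).
- by move=> y t; rewrite lee_fin mulr_ge0 ?subr_ge0// addr_ge0 ?normc_ge0.
Qed.

Lemma measurable_gain_inner d (T : measurableType d) (f : T -> RR) (g : T -> R3 R) :
  measurable_fun setT f -> measurable_fun setT g ->
  measurable_fun setT (fun y : T * RR => \int[mu]_(w in Icircle)
    ((gap_size (f y.1) (plus_at (g y.1) y.2 w))%:E +
     (gap_size (f y.1) (minus_at (g y.1) y.2 w))%:E))%E.
Proof.
move=> mf mg.
refine (@meas_integral _ _ (T * RR)%type RR R mu Icircle (fun y w =>
    ((gap_size (f y.1) (plus_at (g y.1) y.2 w))%:E +
     (gap_size (f y.1) (minus_at (g y.1) y.2 w))%:E)%E) (@m02pi R) _ _).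
- have m0 : measurable_fun setT (fun q : T * RR * RR => f q.1.1) by mfun.
  have m1 : measurable_fun setT (fun q : T * RR * RR => plus_at (g q.1.1) q.1.2 q.2) by mfun'.
  have m2 : measurable_fun setT (fun q : T * RR * RR => minus_at (g q.1.1) q.1.2 q.2) by mfun'.
  exact: (mereal_add (mereal_EFin (mreal_gap_size m0 m1)) (mereal_EFin (mreal_gap_size m0 m2))).
- by move=> y w; rewrite adde_ge0// lee_fin gap_size_ge0.
Qed.

Lemma gain_inner_ge0 tau x t : (0 <= \int[mu]_(w in Icircle)
    ((gap_size tau (plus_at x t w))%:E + (gap_size tau (minus_at x t w))%:E))%E.
Proof. by apply: integral_ge0 => w _; rewrite adde_ge0// lee_fin gap_size_ge0. Qed.

Lemma measurable_gain_term d (T : measurableType d) (f : T -> RR) (g : T -> R3 R) :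
  measurable_fun setT f -> measurable_fun setT g ->
  measurable_fun setT (fun y => gain_term (f y) (g y)).
Proof.
move=> mf mg; rewrite /gain_term.
have m1 := measurable_gain_inner mf mg.
refine (@meas_integral _ _ T RR R mu Ihalf (fun y t => ((k t)%:E * \int[mu]_(w in Icircle)
    ((gap_size (f y) (plus_at (g y) t w))%:E +
     (gap_size (f y) (minus_at (g y) t w))%:E))%E)
  (@m0pi2 R) _ _).
- have m2 : mreal (fun q : T * RR => k q.2) by mfun.
  exact: (mereal_mul (mereal_EFin m2) m1).
- by move=> y t; rewrite mule_ge0 ?lee_fin ?gain_inner_ge0.
Qed.

Lemma tail_term_ge0 tau x : (0 <= tail_term tau x)%E.
Proof.
by apply: integral_ge0 => t _; rewrite lee_fin mulr_ge0 ?subr_ge0// addr_ge0 ?normc_ge0.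
Qed.

Lemma gain_term_ge0 tau x : (0 <= gain_term tau x)%E.
Proof. by apply: integral_ge0 => t _; rewrite mule_ge0 ?lee_fin ?gain_inner_ge0. Qed.

(** The rate at which the loss term of the kernel [k] damps the difference. *)
Definition decay : R := 2 * pi * \int[mu]_(t in Ihalf) k t.

Lemma mcomplex_collision (F : RR -> R3 R -> R[i]) d (T : measurableType d) (f : T -> RR) (g : T -> R3 R) :
  mcomplex (fun q : RR * R3 R => F q.1 q.2) ->
  measurable_fun setT f -> measurable_fun setT g ->
  mcomplex (fun y => collision F (f y) (g y)).
Proof.
move=> mF mf mg; rewrite /collision.
refine (@mcomplex_Cintegral _ _ T RR R mu Ihalf (@m0pi2 R)
  (fun y t => (h t)%:C * azimuthal (F (f y)) (g y) t) _).
apply: mcomplex_mul; first by apply: mcomplex_real; mfun.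
by apply: (@mcomplex_flow_azimuthal F _ _ (fun q : T * RR => f q.1) (fun q => g q.1) snd mF);
  mfun; exact: measurable_snd.
Qed.

Lemma normc_collision (F : RR -> R3 R -> R[i]) tau x :
  mcomplex (fun q : RR * R3 R => F q.1 q.2) ->
  ((normc (collision F tau x))%:E <= collision_size F tau x)%E.
Proof.
move=> mF.
have ma : mcomplex (fun t : RR => (h t)%:C * azimuthal (F tau) x t).
  apply: mcomplex_mul; first exact: mcomplex_real.
  apply: (@mcomplex_flow_azimuthal F _ RR (fun _ => tau) (fun _ => x) id mF).
  - exact: measurable_cst.
  - exact: measurable_cst.
  - exact: measurable_id.
apply: le_trans (normc_Cintegral mu (@m0pi2 R) ma) _.
apply: ereal_eq_le; apply: eq_integral => t _.
by rewrite normcM normc_real ger0_norm//; apply: le_trans (kh t).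
Qed.

Lemma Cintegrable_collision (F : RR -> R3 R -> R[i]) x T :
  mcomplex (fun q : RR * R3 R => F q.1 q.2) ->
  measurable_fun setT (fun tau => collision_size F tau x) ->
  (\int[mu]_(tau in `[0%R, T]) collision_size F tau x < +oo)%E ->
  Cintegrable mu `[0, T] (fun tau => collision F tau x).
Proof.
move=> mF mS Soo.
have mc : mcomplex (fun tau : RR => collision F tau x).
  by apply: (mcomplex_collision (f := id) (g := fun _ => x) mF); [exact: measurable_id|exact: measurable_cst].
split=> //; apply: le_lt_trans Soo; apply: ge0_le_integral.
- exact: meas_itv.
- by move=> tau _; rewrite lee_fin normc_ge0.
- by apply: measurable_funTS; apply: mereal_EFin; exact: mreal_normc.
- exact: measurable_funTS.
- by move=> tau _; exact: normc_collision.
Qed.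

Lemma measurable_collision_size (F : RR -> R3 R -> R[i]) d (T : measurableType d)
    (f : T -> RR) (g : T -> R3 R) :
  mcomplex (fun q : RR * R3 R => F q.1 q.2) ->
  measurable_fun setT f -> measurable_fun setT g ->
  measurable_fun setT (fun y => collision_size F (f y) (g y)).
Proof.
move=> mF mf mg; rewrite /collision_size.
refine (@meas_integral _ _ T RR R mu Ihalf (fun y t =>
  (h t * normc (azimuthal (F (f y)) (g y) t))%:E) (@m0pi2 R) _ _).
- apply: mereal_EFin; apply: mreal_mul; first by mfun.
  apply: mreal_normc.
  by apply: (@mcomplex_flow_azimuthal F _ _ (fun q : T * RR => f q.1) (fun q => g q.1) snd mF);
    mfun; exact: measurable_snd.
- by move=> y t; rewrite lee_fin mulr_ge0 ?normc_ge0//; exact: le_trans (kh t).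
Qed.

Lemma decay_ge0 : 0 <= decay.
Proof. by rewrite !mulr_ge0 ?pi_ge0//; apply: Rintegral_ge0 => t _. Qed.

Lemma collision_gap_le tau x T : 0 <= tau <= T -> x != 0 ->
  ((growth tau x * normc (collision Phi tau x - collision Psi tau x
       + decay%:C * (Phi tau x - Psi tau x)))%:E <=
   (growth T x)%:E * tail_term tau x + gain_term tau x)%E.
Proof.
move=> /andP[tau0 tauT] x0.
have [f fE] := Phi_char tau; have [g gE] := Psi_char tau.
have gT : growth tau x <= growth T x.
  by rewrite ler_expR ler_wpM2l// mulr_ge0// powR_ge0.
have := collision_difference f g mh mk k0 kh kN x.
rewrite -fE -gE -/(collision Phi tau x) -/(collision Psi tau x) -/decay -/(tail_term tau x) => cd.
rewrite EFinM; have g0 : (0 <= (growth tau x)%:E)%E by rewrite lee_fin growth_ge0.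
apply: le_trans (lee_wpmul2l g0 cd) _.
have mpg : measurable_fun setT (fun q : RR * RR => (pair_gap f g x q.1 q.2)%:E).
  have m1 : measurable_fun setT (fun p : RR * RR => plus_at x p.1 p.2) by mfun'.
  have m2 : measurable_fun setT (fun p : RR * RR => minus_at x p.1 p.2) by mfun'.
  have mphi := mcomplex_charfun f; have mpsi := mcomplex_charfun g.
  by apply: mereal_EFin; apply: mreal_normc; mcfun.
have pg0 t w : (0 <= (pair_gap f g x t w)%:E)%E by rewrite lee_fin normc_ge0.
have mG : measurable_fun setT (fun t : RR => \int[mu]_(w in Icircle) (pair_gap f g x t w)%:E)%E.
  exact: (@meas_integral _ _ _ _ _ mu _ (fun t w => (pair_gap f g x t w)%:E) (@m02pi R) mpg pg0).
have G0 t : (0 <= \int[mu]_(w in Icircle) (pair_gap f g x t w)%:E)%E by exact: integral_ge0.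
rewrite ge0_muleDr; last 2 first.
- exact: tail_term_ge0.
- by apply: integral_ge0 => t _; rewrite mule_ge0 ?lee_fin.
apply: leeD; first by apply: lee_wpmul2r; [exact: tail_term_ge0|rewrite lee_fin].
have mkG : measurable_fun setT (fun t : RR => (k t)%:E * \int[mu]_(w in Icircle) (pair_gap f g x t w)%:E)%E.
  exact: (mereal_mul (mereal_EFin mk) mG).
rewrite -ge0Zl; last 4 first.
- exact: m0pi2.
- exact: mkG.
- by move=> t; rewrite mule_ge0 ?lee_fin.
- exact: g0.
have mI := measurable_gain_inner (f := fun _ : RR => tau) (g := fun _ : RR => x)
  (@measurable_cst _ _ _ _ _ _) (@measurable_cst _ _ _ _ _ _).
have mdiag : measurable_fun setT (fun t : RR => (t, t)) by mfun.
have mI' := measurableT_comp mI mdiag.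
apply: ge0_le_integral.
- exact: m0pi2.
- by move=> t _; rewrite !mule_ge0 ?lee_fin.
- by apply: measurable_funTS; apply: mereal_mul => //; exact: measurable_cst.
- by apply: measurable_funTS; apply: mereal_mul; [exact: mereal_EFin|exact: mI'].
move=> t _; rewrite muleCA; apply: lee_wpmul2l; first by rewrite lee_fin.
have mpgt : measurable_fun setT (fun w : RR => (pair_gap f g x t w)%:E).
  exact: (measurableT_comp mpg (pair1_measurable t)).
rewrite -ge0Zl; last 4 first.
- exact: m02pi.
- exact: mpgt.
- exact: pg0.
- exact: g0.
have m1 : measurable_fun setT (fun w : RR => plus_at x t w) by mfun'.
have m2 : measurable_fun setT (fun w : RR => minus_at x t w) by mfun'.
have mtau : measurable_fun setT (fun w : RR => tau) by exact: measurable_cst.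
apply: ge0_le_integral.
- exact: m02pi.
- by move=> w _; rewrite mule_ge0.
- by apply: measurable_funTS; apply: mereal_mul => //; exact: measurable_cst.
- apply: measurable_funTS.
  exact: (mereal_add (mereal_EFin (mreal_gap_size mtau m1)) (mereal_EFin (mreal_gap_size mtau m2))).
move=> w _; rewrite -EFinM -EFinD lee_fin /pair_gap -fE -gE.
exact: gap_size_plus_minus.
Qed.

(** Subtracting the loss term frozen at time [s] produces the factor
    [1 - decay * (t - s)]; the price is the oscillation of [gap] between the
    times [s] and [tau]. *)
Lemma gap_growth_step x T s t (phi0 psi0 : R[i]) : x != 0 ->
  0 <= s -> s <= t -> t <= T -> decay * (t - s) <= 1 ->
  (\int[mu]_(tau in `[0%R, T]) collision_size Phi tau x < +oo)%E ->
  (\int[mu]_(tau in `[0%R, T]) collision_size Psi tau x < +oo)%E ->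
  (forall r, 0 <= r -> Phi r x = (expR (- (delta * enorm x `^ p * r)))%:C * phi0 +
     Cintegral mu `[0, r] (fun tau => (expR (- (delta * enorm x `^ p * (r - tau))))%:C *
       collision Phi tau x)) ->
  (forall r, 0 <= r -> Psi r x = (expR (- (delta * enorm x `^ p * r)))%:C * psi0 +
     Cintegral mu `[0, r] (fun tau => (expR (- (delta * enorm x `^ p * (r - tau))))%:C *
       collision Psi tau x)) ->
  ((gap_size t x)%:E <= ((1 - decay * (t - s)) * gap_size s x)%:E +
     \int[mu]_(tau in `]s, t]) ((growth T x)%:E * tail_term tau x + (gain_term tau x +
        (decay * normc (gap s x - gap tau x))%:E)))%E.
Proof.
move=> x0 s0 st tT small Phioo Psioo PhiE PsiE.
have mcid : measurable_fun setT (fun tau : RR => tau) by exact: measurable_id.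
have mcx : measurable_fun setT (fun _ : RR => x) by exact: measurable_cst.
have IPhi := Cintegrable_collision mPhi (measurable_collision_size mPhi mcid mcx) Phioo.
have IPsi := Cintegrable_collision mPsi (measurable_collision_size mPsi mcid mcx) Psioo.
have a0 : 0 <= delta * enorm x `^ p by rewrite mulr_ge0// powR_ge0.
have DPhi : (growth t x)%:C * Phi t x - (growth s x)%:C * Phi s x =
    Cintegral mu `]s, t] (fun tau => (growth tau x)%:C * collision Phi tau x) :=
  duhamel_increment a0 IPhi PhiE s0 st tT.
have DPsi : (growth t x)%:C * Psi t x - (growth s x)%:C * Psi s x =
    Cintegral mu `]s, t] (fun tau => (growth tau x)%:C * collision Psi tau x) :=
  duhamel_increment a0 IPsi PsiE s0 st tT.
have mgr : mreal (fun tau : RR => growth tau x) by apply: mreal_growth.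
have sub : `]s, t]%classic `<=` (`[0, T]%classic : set RR).
  move=> r /=; rewrite !in_itv/= => /andP[sr rt].
  by rewrite (le_trans s0 (ltW sr)) (le_trans rt tT).
have IG (F : RR -> R3 R -> R[i]) : Cintegrable mu `[0, T] (fun tau => collision F tau x) ->
    Cintegrable mu `]s, t] (fun tau => (growth tau x)%:C * collision F tau x).
  move=> IF; apply: (@Cintegrable_scale _ _ _ _ _ _ _ (growth T x)).
  - exact: meas_itv.
  - exact: mgr.
  - exact: growth_ge0.
  - move=> tau /sub; rewrite /= in_itv/= => /andP[_ tauT].
    by rewrite ger0_norm ?growth_ge0// ler_expR ler_wpM2l.
  - exact: (Cintegrable_subset (meas_itv `[0, T]) (meas_itv `]s, t]) sub IF).
have IGd := Cintegrable_sub (meas_itv `]s, t]) (IG _ IPhi) (IG _ IPsi).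
have gapE : gap t x - gap s x = Cintegral mu `]s, t] (fun tau =>
    (growth tau x)%:C * collision Phi tau x - (growth tau x)%:C * collision Psi tau x).
  refine (etrans _ (esym (CintegralB (meas_itv `]s, t]) (IG _ IPhi) (IG _ IPsi)))).
  refine (etrans _ (congr2 (fun u v : R[i] => u - v) DPhi DPsi)); rewrite /gap.
  move: (growth t x)%:C (growth s x)%:C (Phi t x) (Psi t x) (Phi s x) (Psi s x) => a1 a2 a3 a4 a5 a6.
  by ring.
have Ic : mu.-integrable `]s, t] (EFin \o (fun _ : RR => - decay)).
  apply: (Cintegrable_Re (meas_itv `]s, t]) (f := fun=> (- decay)%:C)).
  apply: (Cintegrable_subset (meas_itv `[0, T]) (meas_itv `]s, t]) sub).
  apply: (@Cintegrable_bounded_itv _ _ _ (normc (- decay)%:C)) => //.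
have Icv : Cintegrable mu `]s, t] (fun _ : RR => (- decay)%:C * gap s x).
  apply: (Cintegrable_subset (meas_itv `[0, T]) (meas_itv `]s, t]) sub).
  apply: (@Cintegrable_bounded_itv _ _ _ (normc ((- decay)%:C * gap s x))) => //.
have decE : (- decay * (t - s))%:C * gap s x = Cintegral mu `]s, t] (fun=> (- decay)%:C * gap s x).
  rewrite (Cintegral_realM (meas_itv `]s, t]) (gap s x) Ic); congr (_%:C * _).
  symmetry; refine (etrans (Rintegral_cst mu (meas_itv `]s, t]) (- decay)) _); congr (_ * _).
  rewrite [X in fine X](lebesgue_measure_itv (Interval _ _))/= lte_fin.
  have [//|ts] := ltP s t; by apply/esym/eqP; rewrite subr_eq0 eq_le st ts.
pose H tau : R[i] := (growth tau x)%:C * collision Phi tau x -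
  (growth tau x)%:C * collision Psi tau x - (- decay)%:C * gap s x.
have IH : Cintegrable mu `]s, t] (H : RR -> R[i]) := Cintegrable_sub (meas_itv `]s, t]) IGd Icv.
have gtE : gap t x = (1 - decay * (t - s))%:C * gap s x + Cintegral mu `]s, t] H.
  rewrite /H (CintegralB (meas_itv `]s, t]) IGd Icv) -decE -gapE.
  have -> : (1 - decay * (t - s))%:C = 1 + (- decay * (t - s))%:C :> R[i].
    by rewrite -(rmorph1 (real_complex R)) -rmorphD mulNr.
  by ring.
have nH : ((normc (Cintegral mu `]s, t] H))%:E <=
    \int[mu]_(tau in `]s, t]) (normc (H tau))%:E)%E.
  exact: (normc_Cintegral mu (meas_itv `]s, t]) IH.1).
have nle : ((gap_size t x)%:E <= ((1 - decay * (t - s)) * gap_size s x)%:E +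
    (normc (Cintegral mu `]s, t] H))%:E)%E.
  rewrite -EFinD lee_fin -normc_gap gtE; apply: le_trans (normcD _ _) _.
  by rewrite normcM normc_real normc_gap ger0_norm// subr_ge0.
apply: (le_trans nle); apply: leeD => //; apply: (le_trans nH).
have ml := measurable_tail_term mcid mcx; have mg := measurable_gain_term mcid mcx.
have md : mreal (fun tau : RR => normc (gap s x - gap tau x)).
  apply: mreal_normc; apply: mcomplex_sub; first exact: mcomplex_cst.
  exact: mcomplex_gap.
apply: ge0_le_integral.
- exact: meas_itv.
- by move=> tau _; rewrite lee_fin normc_ge0.
- by apply: measurable_funTS; apply: mereal_EFin; apply: mreal_normc; exact: IH.1.
- apply: measurable_funTS; apply: mereal_add.
    by apply: mereal_mul => //; exact: measurable_cst.
  apply: mereal_add => //; apply: mereal_EFin; apply: mreal_mul => //.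
move=> tau /sub; rewrite /= in_itv/= => tauI.
have HE : H tau = (growth tau x)%:C * (collision Phi tau x - collision Psi tau x +
    decay%:C * (Phi tau x - Psi tau x)) + decay%:C * (gap s x - gap tau x).
  rewrite /H (rmorphN (real_complex R) decay) /gap.
  by move: (collision Phi tau x) (collision Psi tau x) => c1 c2; ring.
rewrite addeA; apply: le_trans (leeD (collision_gap_le tauI x0) (lexx _)).
rewrite -EFinD lee_fin HE; apply: le_trans (normcD _ _) _.
by rewrite !normcM !normc_real !ger0_norm ?growth_ge0 ?decay_ge0.
Qed.

Variables (alpha : R) (al0 : 0 < alpha).

Definition moment (F : RR -> R3 R -> R[i]) tau : \bar R :=
  (\int[leb3 R]_x ((wt alpha x)%:E * (normc (F tau x - 1))%:E))%E.

Definition singular_mass (l : RR -> R) : \bar R :=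
  (\int[mu]_(t in Ihalf) (l t * `|sin (t / 2)| `^ alpha)%:E)%E.

Lemma mreal_wt1 : mreal (wt alpha : R3 R -> R).
Proof. exact: (mreal_wt alpha (@measurable_id _ (R3 R) setT)). Qed.

Lemma moment_ge0 F tau : (0 <= moment F tau)%E.
Proof. by apply: integral_ge0 => x _; rewrite mule_ge0 ?lee_fin ?wt_ge0 ?normc_ge0. Qed.

Lemma singular_mass_ge0 l : (forall t, 0 <= l t) -> (0 <= singular_mass l)%E.
Proof. by move=> l0; apply: integral_ge0 => t _; rewrite lee_fin mulr_ge0 ?powR_ge0. Qed.

Lemma moment_collision_le (F : RR -> R3 R -> R[i]) (l : RR -> R) tau :
  mcomplex (fun q : RR * R3 R => F q.1 q.2) ->
  (exists f : probability (R3 R) R, F tau = charfun f) ->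
  mreal l -> (forall t, 0 <= l t) ->
  (\int[leb3 R]_x ((wt alpha x)%:E *
     \int[mu]_(t in Ihalf) (l t * normc (azimuthal (F tau) x t))%:E) <=
   (16 * pi)%:E * (singular_mass l * moment F tau))%E.
Proof.
move=> mF [f fE] ml l0.
have := azimuthal_integral_le f al0 ml l0.
rewrite /moment fE; apply: le_trans; apply: ereal_eq_le; apply: eq_integral => x _.
have ma := mreal_normc (mreal_azimuthal_charfun f x).
rewrite -ge0Zl; last 4 first.
- exact: m0pi2.
- exact: (mereal_EFin (mreal_mul ml ma)).
- by move=> t; rewrite lee_fin mulr_ge0 ?normc_ge0.
- by rewrite lee_fin wt_ge0.
by apply: eq_integral => t _; rewrite -!EFinM mulrA.
Qed.

(** By [moment_collision_le] the time integral has a finite weighted integral in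
    [x]. *)
Lemma collision_size_ae (F : RR -> R3 R -> R[i]) T (C : R) : 0 <= T ->
  mcomplex (fun q : RR * R3 R => F q.1 q.2) ->
  (forall tau, exists f : probability (R3 R) R, F tau = charfun f) ->
  (singular_mass h < +oo)%E -> (forall tau : R, 0 <= tau <= T -> (moment F tau <= C%:E)%E) ->
  {ae leb3 R, forall x, x != 0 ->
    (\int[mu]_(tau in `[0%R, T]) collision_size F tau x < +oo)%E}.
Proof.
move=> T0 mF Fc hoo FC.
have h0 t : 0 <= h t by apply: le_trans (kh t).
have mS : measurable_fun setT (fun q : RR * R3 R => collision_size F q.1 q.2).
  by apply: (measurable_collision_size mF); [exact: measurable_fst|exact: measurable_snd].
have S0 tau x : (0 <= collision_size F tau x)%E.
  by apply: integral_ge0 => t _; rewrite lee_fin mulr_ge0 ?normc_ge0.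
have mSx x : measurable_fun setT (fun tau : RR => collision_size F tau x).
  exact: (measurableT_comp mS (pair2_measurable x)).
pose G x := ((wt alpha x)%:E * \int[mu]_(tau in `[0%R, T]) collision_size F tau x)%E.
have mI : measurable_fun setT (fun x : R3 R => \int[mu]_(tau in `[0%R, T]) collision_size F tau x)%E.
  refine (@meas_integral _ _ (R3 R) RR R mu _ (fun x tau => collision_size F tau x) (meas_itv `[0, T]) _ _).
    exact: (measurableT_comp mS (meas_pair measurable_snd measurable_fst)).
  by move=> x tau.
have mG : measurable_fun setT G by exact: (mereal_mul (mereal_EFin mreal_wt1) mI).
have G0 x : (0 <= G x)%E.
  by rewrite mule_ge0 ?lee_fin ?wt_ge0//; apply: integral_ge0.
have IG : (leb3 R).-integrable setT G.
  apply/integrableP; split => //.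
  rewrite (eq_integral G); last by move=> x _; rewrite gee0_abs.
  have -> : (\int[leb3 R]_x G x = \int[leb3 R]_x \int[mu]_(tau in `[0%R, T])
      ((wt alpha x)%:E * collision_size F tau x))%E.
    apply: eq_integral => x _; symmetry.
    by refine (ge0Zl mu (meas_itv `[0, T]) (mSx x) (fun tau => S0 tau x) _); rewrite lee_fin wt_ge0.
  have mW : measurable_fun setT (fun q : R3 R * RR => (wt alpha q.1)%:E * collision_size F q.2 q.1)%E.
    apply: mereal_mul; first by apply: mereal_EFin; apply: mreal_wt; exact: measurable_fst.
    exact: (measurableT_comp mS (meas_pair measurable_snd measurable_fst)).
  rewrite [X in (X < _)%E](@tonelli _ _ _ _ R (leb3 R) mu); last 4 first.
  - exact: measurableT.
  - exact: meas_itv.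
  - exact: mW.
  - by move=> x tau _ _; rewrite mule_ge0 ?lee_fin ?wt_ge0.
  have Ch : (0 <= (16 * pi)%:E * (singular_mass h * C%:E))%E.
    have C0 : (0 <= C%:E)%E by apply: le_trans (FC 0 _); rewrite ?moment_ge0// lexx.
    by rewrite !mule_ge0 ?lee_fin ?mulr_ge0 ?pi_ge0// singular_mass_ge0.
  have Choo : ((16 * pi)%:E * (singular_mass h * C%:E) < +oo)%E.
    rewrite lte_mul_pinfty ?lee_fin ?mulr_ge0 ?pi_ge0// lte_mul_pinfty ?ltry// ?singular_mass_ge0//.
    by rewrite ge0_fin_numE// singular_mass_ge0.
  apply: (@le_lt_trans _ _ (\int[mu]_(tau in `[0%R, T]) ((16 * pi)%:E * (singular_mass h * C%:E)))%E).
    apply: ge0_le_integral.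
    - exact: meas_itv.
    - by move=> tau _; apply: integral_ge0 => x _; rewrite mule_ge0 ?lee_fin ?wt_ge0.
    - apply: measurable_funTS.
      refine (@meas_integral _ _ RR (R3 R) R (leb3 R) setT (fun tau x => (wt alpha x)%:E * collision_size F tau x)%E (@measurableT _ _) _ _).
        exact: (measurableT_comp mW (meas_pair measurable_snd measurable_fst)).
      by move=> tau x; rewrite mule_ge0 ?lee_fin ?wt_ge0.
    - exact: measurable_cst.
    - move=> tau /=; rewrite in_itv/= => tauI.
      apply: le_trans (moment_collision_le mF (Fc tau) mh h0) _.
      apply: lee_wpmul2l; first by rewrite lee_fin mulr_ge0 ?pi_ge0.
      by apply: lee_wpmul2l; [exact: singular_mass_ge0|exact: FC].
  refine (le_lt_trans (ereal_eq_le (integral_cst mu (meas_itv `[0, T]) _)) _).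
  apply: lte_mul_pinfty => //; first by rewrite ge0_fin_numE.
  by rewrite [X in (X < _)%E](lebesgue_measure_itv (Interval _ _))/=; case: ifP => _; rewrite ltry.
have := integrable_ae measurableT IG; apply: filterS => x Gx x0.
have wx : 0 < wt alpha x.
  rewrite /wt invr_gt0 powR_gt0// lt_neqAle enorm_ge0 andbT eq_sym.
  by apply: contra x0 => /eqP/enorm_eq0/eqP.
rewrite ltey; apply/negP => /eqP Eoo; have := Gx I.
by rewrite /G Eoo gt0_muley ?lte_fin.
Qed.

Lemma tail_integral_le tau :
  (\int[leb3 R]_x ((wt alpha x)%:E * tail_term tau x) <= (16 * pi)%:E *
     (singular_mass (fun t => (h t - k t)%R) * (moment Phi tau + moment Psi tau)))%E.
Proof.
have mhk : mreal (fun t : RR => h t - k t) by exact: (mreal_add mh (mreal_opp mk)).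
have hk0 t : 0 <= h t - k t by rewrite subr_ge0.
pose L (F : RR -> R3 R -> R[i]) x : \bar R :=
  (\int[mu]_(t in Ihalf) ((h t - k t) * normc (azimuthal (F tau) x t))%:E)%E.
have L0 F x : (0 <= L F x)%E.
  by apply: integral_ge0 => t _; rewrite lee_fin mulr_ge0 ?normc_ge0.
have mtau d (T : measurableType d) : measurable_fun setT (fun _ : T => tau : RR) by exact: measurable_cst.
have ma (F : RR -> R3 R -> R[i]) : mcomplex (fun q : RR * R3 R => F q.1 q.2) ->
    measurable_fun setT (fun q : R3 R * RR => ((h q.2 - k q.2) * normc (azimuthal (F tau) q.1 q.2))%:E).
  move=> mF; apply: mereal_EFin; apply: mreal_mul.
    exact: (measurableT_comp mhk measurable_snd).
  by apply: mreal_normc; apply: (mcomplex_flow_azimuthal mF);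
    [exact: measurable_cst|exact: measurable_fst|exact: measurable_snd].
have mL (F : RR -> R3 R -> R[i]) : mcomplex (fun q : RR * R3 R => F q.1 q.2) ->
    measurable_fun setT (L F).
  move=> mF; refine (@meas_integral _ _ (R3 R) RR R mu Ihalf (fun x t =>
    ((h t - k t) * normc (azimuthal (F tau) x t))%:E) (@m0pi2 R) (ma F mF) _).
  by move=> x t; rewrite lee_fin mulr_ge0 ?normc_ge0.
have tail_termE x : tail_term tau x = (L Phi x + L Psi x)%E.
  rewrite /tail_term /L -ge0_integralD; last 5 first.
  - exact: m0pi2.
  - by move=> t _; rewrite lee_fin mulr_ge0 ?normc_ge0.
  - by apply: measurable_funTS; exact: (measurableT_comp (ma Phi mPhi) (pair1_measurable x)).
  - by move=> t _; rewrite lee_fin mulr_ge0 ?normc_ge0.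
  - by apply: measurable_funTS; exact: (measurableT_comp (ma Psi mPsi) (pair1_measurable x)).
  by apply: eq_integral => t _; rewrite -EFinD mulrDr.
have w0 x : (0 <= (wt alpha x)%:E)%E by rewrite lee_fin wt_ge0.
under eq_integral do rewrite tail_termE (ge0_muleDr (wt alpha _)%:E (L0 Phi _) (L0 Psi _)).
rewrite ge0_integralD; last 5 first.
- exact: measurableT.
- by move=> x _; exact: mule_ge0.
- exact: (mereal_mul (mereal_EFin mreal_wt1) (mL Phi mPhi)).
- by move=> x _; exact: mule_ge0.
- exact: (mereal_mul (mereal_EFin mreal_wt1) (mL Psi mPsi)).
rewrite (ge0_muleDr (singular_mass _) (moment_ge0 Phi tau) (moment_ge0 Psi tau)).
rewrite ge0_muleDr; last 2 first.
- by apply: mule_ge0; [exact: singular_mass_ge0|exact: moment_ge0].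
- by apply: mule_ge0; [exact: singular_mass_ge0|exact: moment_ge0].
by apply: leeD; [exact: (moment_collision_le mPhi (Phi_char tau) mhk hk0)
                |exact: (moment_collision_le mPsi (Psi_char tau) mhk hk0)].
Qed.

(** * Integration over balls *)

Variable M : R.

Definition ball_wt x : R := if enorm x <= M then wt alpha x else 0.

Lemma ball_wt_ge0 x : 0 <= ball_wt x.
Proof. by rewrite /ball_wt; case: ifP => // _; exact: wt_ge0. Qed.

Lemma ball_wt_le x : ball_wt x <= wt alpha x.
Proof. by rewrite /ball_wt; case: ifP => // _; exact: wt_ge0. Qed.

Lemma mreal_ball_wt : mreal (ball_wt : R3 R -> R).
Proof.
apply: mreal_if; [|exact: mreal_wt1|exact: (@measurable_cst _ _ _ _ _ (0 : measurableTypeR R))].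
by apply: mbool_le; [apply: mreal_enorm; exact: measurable_id|exact: measurable_cst].
Qed.

Definition mass tau : \bar R := (\int[leb3 R]_x (ball_wt x * gap_size tau x)%:E)%E.

Definition drift s tau : \bar R :=
  (\int[leb3 R]_x (ball_wt x * normc (gap s x - gap tau x))%:E)%E.

(** Since [|xi+|] and [|xi-|] are at most [|xi|], [gain_plus] and [gain_minus] may
    be applied to the difference cut off outside the ball. *)
Lemma gain_integral_le tau :
  (\int[leb3 R]_x ((ball_wt x)%:E * gain_term tau x) <= (2 * pi)%:E *
     ((\int[mu]_(t in Ihalf) (k t * `|cos (t / 2)| `^ alpha)%:E + singular_mass k)
      * mass tau))%E.
Proof.
pose F y : \bar R := (if enorm y <= M then gap_size tau y else 0)%:E.
have mgs : mreal (gap_size tau : R3 R -> R).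
  by apply: (mreal_gap_size (f := fun _ => tau) (g := id)); [exact: measurable_cst|exact: measurable_id].
have mF : measurable_fun setT F.
  apply: mereal_EFin; apply: mreal_if; [|exact: mgs|exact: (@measurable_cst _ _ _ _ _ (0 : measurableTypeR R))].
  by apply: mbool_le; [apply: mreal_enorm; exact: measurable_id|exact: measurable_cst].
have F0 y : (0 <= F y)%E by rewrite lee_fin; case: ifP => // _; exact: gap_size_ge0.
have massE : mass tau = (\int[leb3 R]_x ((wt alpha x)%:E * F x))%E.
  apply: eq_integral => x _; rewrite /ball_wt /F -EFinM.
  by case: ifP => _; rewrite ?mul0r ?mulr0.
have gp := gain_plus al0 mk k0 mF F0; have gm := gain_minus al0 mk k0 mF F0.
pose Hp x t w := ((wt alpha x * k t)%:E * F (plus_at x t w))%E.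
pose Hm x t w := ((wt alpha x * k t)%:E * F (minus_at x t w))%E.
have mHp : measurable_fun setT (fun q : R3 R * RR * RR => Hp q.1.1 q.1.2 q.2).
  by rewrite /Hp; have mw := mreal_wt1; mfun'.
have mHm : measurable_fun setT (fun q : R3 R * RR * RR => Hm q.1.1 q.1.2 q.2).
  by rewrite /Hm; have mw := mreal_wt1; mfun'.
have wk0 x t : (0 <= (wt alpha x * k t)%:E)%E by rewrite lee_fin mulr_ge0 ?wt_ge0.
have Hp0 x t w : (0 <= Hp x t w)%E by exact: mule_ge0.
have Hm0 x t w : (0 <= Hm x t w)%E by exact: mule_ge0.
have m0 : (0 <= mass tau)%E.
  by apply: integral_ge0 => x _; rewrite lee_fin mulr_ge0 ?ball_wt_ge0 ?gap_size_ge0.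
have c0 : (0 <= \int[mu]_(t in Ihalf) (k t * `|cos (t / 2)| `^ alpha)%:E)%E.
  by apply: integral_ge0 => t _; rewrite lee_fin mulr_ge0 ?powR_ge0.
rewrite (ge0_muleDl _ c0 (singular_mass_ge0 k0)).
rewrite ge0_muleDr; last 2 first.
- exact: (mule_ge0 c0 m0).
- exact: (mule_ge0 (singular_mass_ge0 k0) m0).
rewrite massE -[X in (_ <= X + _)%E]gp -[X in (_ <= _ + X)%E]gm.
rewrite -(angular_integralD mHp mHm Hp0 Hm0) /angular_integral.
have mgi := measurable_gain_inner (f := fun _ : R3 R => tau) (g := id)
  (@measurable_cst _ _ _ _ _ _) (@measurable_id _ _ _).
have mHi : measurable_fun setT (fun q : R3 R * RR => \int[mu]_(w in Icircle) (Hp q.1 q.2 w + Hm q.1 q.2 w))%E.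
  refine (@meas_integral _ _ _ _ _ mu _ (fun (q : R3 R * RR) w => (Hp q.1 q.2 w + Hm q.1 q.2 w)%E) (@m02pi R) _ _).
    exact: (mereal_add mHp mHm).
  by move=> q w; exact: adde_ge0.
have mgt : measurable_fun setT (fun x : R3 R => gain_term tau x).
  by apply: (measurable_gain_term (f := fun _ => tau) (g := id)); [exact: measurable_cst|exact: measurable_id].
apply: ge0_le_integral.
- exact: measurableT.
- by move=> x _; rewrite mule_ge0 ?lee_fin ?ball_wt_ge0 ?gain_term_ge0.
- exact: (mereal_mul (mereal_EFin mreal_ball_wt) mgt).
- refine (@meas_integral _ _ (R3 R) RR R mu Ihalf (fun x t => \int[mu]_(w in Icircle) (Hp x t w + Hm x t w))%E (@m0pi2 R) mHi _).
  by move=> x t; apply: integral_ge0 => w _; exact: adde_ge0.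
move=> x _; rewrite {1}/ball_wt; case: ifPn => xM; last first.
  by rewrite mul0e; do 2 apply: integral_ge0 => ? _; exact: adde_ge0.
have [->|x0] := eqVneq x 0.
  by rewrite wt0// mul0e; do 2 apply: integral_ge0 => ? _; exact: adde_ge0.
have mgix := measurableT_comp mgi (pair1_measurable x).
rewrite /gain_term -ge0Zl; last 4 first.
- exact: m0pi2.
- exact: (mereal_mul (mereal_EFin mk) mgix).
- by move=> t; rewrite mule_ge0 ?lee_fin ?gain_inner_ge0.
- by rewrite lee_fin wt_ge0.
apply: ereal_eq_le; apply: eq_integral => t _.
rewrite muleA -EFinM -ge0Zl; last 4 first.
- exact: m02pi.
- have mt := @measurable_cst _ _ RR RR setT tau.
  have m1 : measurable_fun setT (fun w : RR => plus_at x t w) by mfun'.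
  have m2 : measurable_fun setT (fun w : RR => minus_at x t w) by mfun'.
  exact: (mereal_add (mereal_EFin (mreal_gap_size mt m1)) (mereal_EFin (mreal_gap_size mt m2))).
- by move=> w; rewrite adde_ge0 ?lee_fin ?gap_size_ge0.
- exact: wk0.
apply: eq_integral => w _.
rewrite /Hp /Hm /F (le_trans (enorm_plus_le t w x0) xM) (le_trans (enorm_minus_le t w x0) xM).
by rewrite ge0_muleDr ?lee_fin ?gap_size_ge0.
Qed.

Lemma mass_ge0 tau : (0 <= mass tau)%E.
Proof. by apply: integral_ge0 => x _; rewrite lee_fin mulr_ge0 ?ball_wt_ge0 ?gap_size_ge0. Qed.

Lemma drift_ge0 s tau : (0 <= drift s tau)%E.
Proof. by apply: integral_ge0 => x _; rewrite lee_fin mulr_ge0 ?ball_wt_ge0 ?normc_ge0. Qed.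

Lemma measurable_mass : measurable_fun setT mass.
Proof.
rewrite /mass; refine (@meas_integral _ _ RR (R3 R) R (leb3 R) setT
  (fun tau x => (ball_wt x * gap_size tau x)%:E) (@measurableT _ _) _ _).
- apply: mereal_EFin; apply: mreal_mul; first exact: (measurableT_comp mreal_ball_wt measurable_snd).
  by apply: mreal_gap_size; [exact: measurable_fst|exact: measurable_snd].
- by move=> tau x; rewrite lee_fin mulr_ge0 ?ball_wt_ge0 ?gap_size_ge0.
Qed.

Lemma mreal_gap_diff s : mreal (fun q : R3 R * RR => normc (gap s q.1 - gap q.2 q.1)).
Proof.
apply: mreal_normc; apply: mcomplex_sub; apply: mcomplex_gap.
- exact: measurable_cst.
- exact: measurable_fst.
- exact: measurable_snd.
- exact: measurable_fst.
Qed.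

Lemma measurable_drift s : measurable_fun setT (drift s).
Proof.
rewrite /drift; refine (@meas_integral _ _ RR (R3 R) R (leb3 R) setT
  (fun tau x => (ball_wt x * normc (gap s x - gap tau x))%:E) (@measurableT _ _) _ _).
- apply: mereal_EFin; apply: mreal_mul; first exact: (measurableT_comp mreal_ball_wt measurable_snd).
  exact: (measurableT_comp (mreal_gap_diff s) (meas_pair measurable_snd measurable_fst)).
- by move=> tau x; rewrite lee_fin mulr_ge0 ?ball_wt_ge0 ?normc_ge0.
Qed.

(** This is [gap_growth_step] integrated over the ball, where the exponential
    weight in front of [tail_term] is bounded. *)
Lemma mass_step T s t (C kap Lk : R) (phi0 psi0 : R3 R -> R[i]) :
  0 <= s -> s <= t -> t <= T -> decay * (t - s) <= 1 ->
  (singular_mass h < +oo)%E ->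
  (singular_mass (fun t => (h t - k t)%R) <= kap%:E)%E ->
  (\int[mu]_(t in Ihalf) (k t * `|cos (t / 2)| `^ alpha)%:E + singular_mass k <= Lk%:E)%E ->
  (forall tau : R, 0 <= tau <= T -> (moment Phi tau <= C%:E)%E) ->
  (forall tau : R, 0 <= tau <= T -> (moment Psi tau <= C%:E)%E) ->
  (forall x r, x != 0 -> 0 <= r -> Phi r x = (expR (- (delta * enorm x `^ p * r)))%:C * phi0 x +
     Cintegral mu `[0, r] (fun tau => (expR (- (delta * enorm x `^ p * (r - tau))))%:C *
       collision Phi tau x)) ->
  (forall x r, x != 0 -> 0 <= r -> Psi r x = (expR (- (delta * enorm x `^ p * r)))%:C * psi0 x +
     Cintegral mu `[0, r] (fun tau => (expR (- (delta * enorm x `^ p * (r - tau))))%:C *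
       collision Psi tau x)) ->
  (mass t <= (1 - decay * (t - s))%:E * mass s +
     \int[mu]_(tau in `]s, t]) ((expR (delta * M `^ p * T) * (32 * pi * (kap * C)))%:E +
       ((2 * pi * Lk)%:E * mass tau + decay%:E * drift s tau)))%E.
Proof.
move=> s0 st tT small hoo hkap hLk PhiC PsiC PhiE PsiE.
have T0 : 0 <= T by exact: le_trans s0 (le_trans st tT).
pose GT : R := expR (delta * M `^ p * T).
have GT0 : 0 <= GT by exact: expR_ge0.
have dec0 := decay_ge0.
pose r x tau : \bar R := (GT%:E * tail_term tau x + (gain_term tau x + (decay * normc (gap s x - gap tau x))%:E))%E.
have r0 x tau : (0 <= r x tau)%E.
  rewrite /r; apply: adde_ge0.
    by apply: mule_ge0; [rewrite lee_fin|exact: tail_term_ge0].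
  by apply: adde_ge0; [exact: gain_term_ge0|rewrite lee_fin mulr_ge0 ?normc_ge0].
have ml : measurable_fun setT (fun q : R3 R * RR => tail_term q.2 q.1).
  by apply: (measurable_tail_term (f := snd) (g := fst)); [exact: measurable_snd|exact: measurable_fst].
have mg : measurable_fun setT (fun q : R3 R * RR => gain_term q.2 q.1).
  by apply: (measurable_gain_term (f := snd) (g := fst)); [exact: measurable_snd|exact: measurable_fst].
have md : measurable_fun setT (fun q : R3 R * RR => (decay * normc (gap s q.1 - gap q.2 q.1))%:E).
  apply: mereal_EFin; apply: mreal_mul; first exact: measurable_cst.
  exact: mreal_gap_diff.
have mr : measurable_fun setT (fun q : R3 R * RR => r q.1 q.2).
  apply: mereal_add; first by apply: mereal_mul => //; exact: measurable_cst.
  exact: mereal_add.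
have mwr : measurable_fun setT (fun q : R3 R * RR => (ball_wt q.1)%:E * r q.1 q.2)%E.
  apply: mereal_mul => //; apply: mereal_EFin.
  exact: (measurableT_comp mreal_ball_wt measurable_fst).
have wr0 x tau : (0 <= (ball_wt x)%:E * r x tau)%E.
  by rewrite mule_ge0 ?lee_fin ?ball_wt_ge0.
pose J x : \bar R := (\int[mu]_(tau in `]s, t]) ((ball_wt x)%:E * r x tau))%E.
have J0 x : (0 <= J x)%E by exact: integral_ge0.
have mJ : measurable_fun setT J.
  exact: (@meas_integral _ _ (R3 R) RR R mu _ (fun x tau => (ball_wt x)%:E * r x tau)%E (meas_itv `]s, t]) mwr wr0).
have mgs (tau : RR) : mreal (fun x : R3 R => ball_wt x * gap_size tau x).
  apply: mreal_mul; first exact: mreal_ball_wt.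
  by apply: (mreal_gap_size (f := fun _ => tau) (g := id)); [exact: measurable_cst|exact: measurable_id].
have gs0 tau x : 0 <= ball_wt x * gap_size tau x.
  by rewrite mulr_ge0 ?ball_wt_ge0 ?gap_size_ge0.
have small0 : 0 <= 1 - decay * (t - s) by rewrite subr_ge0.
have mgs' : measurable_fun setT (fun x : R3 R =>
    (1 - decay * (t - s))%:E * (ball_wt x * gap_size s x)%:E)%E.
  by apply: mereal_mul; [exact: measurable_cst|apply: mereal_EFin; exact: mgs].
have gs0' x : (0 <= (1 - decay * (t - s))%:E * (ball_wt x * gap_size s x)%:E)%E.
  by rewrite mule_ge0 ?lee_fin.
have aePhi := collision_size_ae T0 mPhi Phi_char hoo PhiC.
have aePsi := collision_size_ae T0 mPsi Psi_char hoo PsiC.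
have step1 : (mass t <= \int[leb3 R]_x ((1 - decay * (t - s))%:E * (ball_wt x * gap_size s x)%:E + J x))%E.
  apply: ae_ge0_le_integral.
  - exact: measurableT.
  - by move=> x _; rewrite lee_fin.
  - by apply: mereal_EFin; exact: mgs.
  - by move=> x _; exact: adde_ge0.
  - exact: mereal_add.
  have aeF : Filter (nbhs (almost_everywhere (leb3 R))) by exact: ae_filter_ringOfSetsType.
  apply: filterS2 aePhi aePsi => x HPhi HPsi _.
  have [w0|w0] := eqVneq (ball_wt x) 0.
    by rewrite w0 mul0r; apply: adde_ge0; rewrite ?mul0r ?mule0.
  have [xM wx] : enorm x <= M /\ x != 0.
    move: w0; rewrite /ball_wt; case: ifP => [xM w0|_]; last by rewrite eqxx.
    by split=> //; apply: contra w0 => /eqP ->; rewrite wt0.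
  have := gap_growth_step wx s0 st tT small (HPhi wx) (HPsi wx) (fun r => PhiE x r wx) (fun r => PsiE x r wx).
  have bw : (0 <= (ball_wt x)%:E)%E by rewrite lee_fin ball_wt_ge0.
  move=> /(lee_wpmul2l bw); rewrite -EFinM => /le_trans; apply.
  have mrx : measurable_fun setT (fun tau : RR => r x tau).
    exact: (measurableT_comp mr (pair1_measurable x)).
  rewrite ge0_muleDr; last 2 first.
  - by rewrite lee_fin mulr_ge0 ?gap_size_ge0.
  - apply: integral_ge0 => tau _; apply: adde_ge0.
      by apply: mule_ge0; [rewrite lee_fin growth_ge0|exact: tail_term_ge0].
    by apply: adde_ge0; [exact: gain_term_ge0|rewrite lee_fin mulr_ge0 ?normc_ge0].
  apply: leeD; first by rewrite -!EFinM lee_fin mulrCA.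
  rewrite /J (ge0Zl mu (meas_itv `]s, t]) mrx (r0 x) bw).
  apply: (lee_wpmul2l bw).
  have gGT : ((growth T x)%:E <= GT%:E)%E.
    rewrite lee_fin ler_expR ler_wpM2r// ler_wpM2l//.
    case/andP: p02 => p0 _; apply: ge0_ler_powR => //; rewrite ?nnegrE; first exact: ltW.
      exact: enorm_ge0.
    by rewrite (le_trans (enorm_ge0 x) xM).
  have mlx : measurable_fun setT (fun tau : RR => tail_term tau x) := measurableT_comp ml (pair1_measurable x).
  have mgx : measurable_fun setT (fun tau : RR => gain_term tau x) := measurableT_comp mg (pair1_measurable x).
  have mdx : measurable_fun setT (fun tau : RR => (decay * normc (gap s x - gap tau x))%:E) :=
    measurableT_comp md (pair1_measurable x).
  apply: ge0_le_integral.
  - exact: meas_itv.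
  - move=> tau _; apply: adde_ge0.
      by apply: mule_ge0; [rewrite lee_fin growth_ge0|exact: tail_term_ge0].
    by apply: adde_ge0; [exact: gain_term_ge0|rewrite lee_fin mulr_ge0 ?normc_ge0].
  - apply: measurable_funTS; apply: mereal_add; last exact: mereal_add.
    by apply: mereal_mul => //; exact: measurable_cst.
  - exact: measurable_funTS.
  move=> tau _; exact: (leeD (lee_wpmul2r (tail_term_ge0 tau x) gGT) (lexx _)).
apply: le_trans step1 _.
rewrite ge0_integralD; last 5 first.
- exact: measurableT.
- by move=> x _.
- exact: mgs'.
- by move=> x _.
- exact: mJ.
rewrite ge0Zl; last 4 first.
- exact: measurableT.
- by apply: mereal_EFin; exact: mgs.
- by move=> x; rewrite lee_fin.
- by rewrite lee_fin.
apply: leeD => //.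
rewrite /J [X in (X <= _)%E](@tonelli _ _ _ _ R (leb3 R) mu); last 4 first.
- exact: measurableT.
- exact: meas_itv.
- exact: mwr.
- by move=> x tau _ _.
have kap0 : 0 <= kap.
  rewrite -lee_fin; apply: le_trans hkap; apply: singular_mass_ge0 => q.
  by rewrite subr_ge0.
have C0 : 0 <= C.
  by rewrite -lee_fin; apply: le_trans (PhiC 0 _); rewrite ?moment_ge0// lexx.
have Lk0 : 0 <= Lk.
  rewrite -lee_fin; apply: le_trans hLk; apply: adde_ge0; last exact: singular_mass_ge0.
  by apply: integral_ge0 => q _; rewrite lee_fin mulr_ge0 ?powR_ge0.
have mmass := measurable_mass; have mdrift := measurable_drift s.
apply: ge0_le_integral.
- exact: meas_itv.
- by move=> tau _; exact: integral_ge0.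
- apply: measurable_funTS.
  refine (@meas_integral _ _ RR (R3 R) R (leb3 R) setT (fun tau x => (ball_wt x)%:E * r x tau)%E (@measurableT _ _) _ _).
    exact: (measurableT_comp mwr (meas_pair measurable_snd measurable_fst)).
  by move=> tau x.
- apply: measurable_funTS; apply: mereal_add; first exact: measurable_cst.
  by apply: mereal_add; apply: mereal_mul => //; exact: measurable_cst.
move=> tau; rewrite /= in_itv/= => /andP[stau taut].
have tauI : 0 <= tau <= T by rewrite (le_trans s0 (ltW stau)) (le_trans taut tT).
have mlx : measurable_fun setT (fun x : R3 R => tail_term tau x) := measurableT_comp ml (pair2_measurable tau).
have mgx : measurable_fun setT (fun x : R3 R => gain_term tau x) := measurableT_comp mg (pair2_measurable tau).
have mdx : measurable_fun setT (fun x : R3 R => (decay * normc (gap s x - gap tau x))%:E) :=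
  measurableT_comp md (pair2_measurable tau).
have mw : measurable_fun setT (fun x : R3 R => (ball_wt x)%:E) := mereal_EFin mreal_ball_wt.
have w0 x : (0 <= (ball_wt x)%:E)%E by rewrite lee_fin ball_wt_ge0.
have GTe : (0 <= GT%:E)%E by rewrite lee_fin.
have L0 x : (0 <= GT%:E * ((ball_wt x)%:E * tail_term tau x))%E.
  exact: (mule_ge0 GTe (mule_ge0 (w0 x) (tail_term_ge0 tau x))).
have G0 x : (0 <= (ball_wt x)%:E * gain_term tau x)%E.
  exact: (mule_ge0 (w0 x) (gain_term_ge0 tau x)).
have de : (0 <= decay%:E)%E by rewrite lee_fin.
have d0 x : (0 <= (ball_wt x * normc (gap s x - gap tau x))%:E)%E.
  by rewrite lee_fin mulr_ge0 ?ball_wt_ge0 ?normc_ge0.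
have D0 x : (0 <= decay%:E * (ball_wt x * normc (gap s x - gap tau x))%:E)%E.
  exact: mule_ge0.
have mwl : measurable_fun setT (fun x : R3 R => (ball_wt x)%:E * tail_term tau x)%E by exact: mereal_mul.
have mL : measurable_fun setT (fun x : R3 R => GT%:E * ((ball_wt x)%:E * tail_term tau x))%E.
  by apply: mereal_mul => //; exact: measurable_cst.
have mG : measurable_fun setT (fun x : R3 R => (ball_wt x)%:E * gain_term tau x)%E by exact: mereal_mul.
have md1 : measurable_fun setT (fun x : R3 R => (ball_wt x * normc (gap s x - gap tau x))%:E).
  apply: mereal_EFin; apply: mreal_mul; first exact: mreal_ball_wt.
  exact: (measurableT_comp (mreal_gap_diff s) (pair2_measurable tau)).
have mD : measurable_fun setT (fun x : R3 R => decay%:E * (ball_wt x * normc (gap s x - gap tau x))%:E)%E.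
  by apply: mereal_mul => //; exact: measurable_cst.
have split_r x : ((ball_wt x)%:E * r x tau = GT%:E * ((ball_wt x)%:E * tail_term tau x) +
    ((ball_wt x)%:E * gain_term tau x + decay%:E * (ball_wt x * normc (gap s x - gap tau x))%:E))%E.
  have l1 : (0 <= GT%:E * tail_term tau x)%E := mule_ge0 GTe (tail_term_ge0 tau x).
  have l2 : (0 <= (decay * normc (gap s x - gap tau x))%:E)%E by rewrite lee_fin mulr_ge0 ?normc_ge0.
  have l3 := adde_ge0 (gain_term_ge0 tau x) l2.
  refine (etrans (ge0_muleDr _ l1 l3) _); congr (_ + _)%E; first exact: muleCA.
  refine (etrans (ge0_muleDr _ (gain_term_ge0 tau x) l2) _); congr (_ + _)%E.
  by rewrite -!EFinM mulrCA.
rewrite (eq_integral _ _ (fun x _ => split_r x)).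
rewrite ge0_integralD; last 5 first.
- exact: measurableT.
- by move=> x _; exact: L0.
- exact: mL.
- by move=> x _; exact: (adde_ge0 (G0 x) (D0 x)).
- exact: mereal_add.
have wl0 x : (0 <= (ball_wt x)%:E * tail_term tau x)%E := mule_ge0 (w0 x) (tail_term_ge0 tau x).
apply: leeD.
  rewrite (ge0Zl _ (@measurableT _ _) mwl wl0 GTe) (EFinM GT); apply: (lee_wpmul2l GTe).
  apply: (@le_trans _ _ (\int[leb3 R]_x ((wt alpha x)%:E * tail_term tau x))%E).
    apply: ge0_le_integral.
    - exact: measurableT.
    - by move=> x _; exact: wl0.
    - exact: mwl.
    - by apply: mereal_mul => //; apply: mereal_EFin; exact: mreal_wt1.
    - move=> x _; apply: lee_wpmul2r; first exact: tail_term_ge0.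
      by rewrite lee_fin ball_wt_le.
  apply: le_trans (tail_integral_le tau) _.
  have -> : 32 * pi * (kap * C) = 16 * pi * (kap * (C + C)) by ring.
  rewrite (EFinM (16 * pi) (kap * (C + C))); apply: lee_wpmul2l; first by rewrite lee_fin mulr_ge0 ?pi_ge0.
  have hk0 : (0 <= singular_mass (fun t => (h t - k t)%R))%E.
    by apply: singular_mass_ge0 => q; rewrite subr_ge0.
  have mm := leeD (PhiC tau tauI) (PsiC tau tauI).
  apply: le_trans (lee_wpmul2l hk0 mm) _; rewrite -EFinD (EFinM kap (C + C)).
  by apply: lee_wpmul2r => //; rewrite lee_fin addr_ge0.
rewrite ge0_integralD; last 5 first.
- exact: measurableT.
- by move=> x _; exact: G0.
- exact: mG.
- by move=> x _; exact: D0.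
- exact: mD.
apply: leeD; last first.
  by rewrite (ge0Zl _ (@measurableT _ _) md1 d0 de).
apply: le_trans (gain_integral_le tau) _.
rewrite (EFinM (2 * pi) Lk) -muleA; apply: lee_wpmul2l; first by rewrite lee_fin mulr_ge0 ?pi_ge0.
by apply: lee_wpmul2r => //; exact: mass_ge0.
Qed.

End GapGrowth.

(** * Truncated kernels *)

Section CutoffKernels.
Context (R : realType) (alpha : R) (h : measurableTypeR R -> R).
Notation mu := (@lebesgue_measure R).
Notation RR := (measurableTypeR R).
Notation Ihalf := (`[0, pi / 2]%classic : set RR).
Hypotheses (al02 : 0 < alpha <= 2) (mh : mreal h) (h0 : forall t, 0 <= h t)
  (hoo : (singular_mass alpha h < +oo)%E).

Definition cutoff (n : nat) (t : RR) : R := Num.min (h t) n%:R.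

Lemma cutoff_ge0 n t : 0 <= cutoff n t.
Proof. by rewrite le_min h0/=. Qed.

Lemma cutoff_le n t : cutoff n t <= h t.
Proof. by rewrite ge_min lexx. Qed.

Lemma cutoff_bounded n t : cutoff n t <= n%:R.
Proof. by rewrite ge_min lexx orbT. Qed.

Lemma mreal_cutoff n : mreal (cutoff n).
Proof. by apply: measurable_minr => //; exact: measurable_cst. Qed.

Lemma mreal_sin_half : mreal (fun t : RR => `|sin (t / 2)| `^ alpha).
Proof. by mfun. Qed.

Lemma mreal_cos_half : mreal (fun t : RR => `|cos (t / 2)| `^ alpha).
Proof. by mfun. Qed.

(** The tail is dominated by [h], and at each point it is [0] for large [n]. *)
Lemma cutoff_tail (kap : R) : 0 < kap ->
  exists n, (singular_mass alpha (fun t => (h t - cutoff n t)%R) <= kap%:E)%E.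
Proof.
move=> kap0.
have ms := mreal_sin_half.
have mf n : measurable_fun Ihalf (fun t => ((h t - cutoff n t) * `|sin (t / 2)| `^ alpha)%:E).
  apply: measurable_funTS; apply: mereal_EFin; apply: mreal_mul => //.
  by apply: mreal_add => //; apply: mreal_opp; exact: mreal_cutoff.
have ig : mu.-integrable Ihalf (fun t => (h t * `|sin (t / 2)| `^ alpha)%:E).
  apply/integrableP; split.
    by apply: measurable_funTS; apply: mereal_EFin; exact: mreal_mul.
  rewrite (eq_integral (fun t => (h t * `|sin (t / 2)| `^ alpha)%:E)) // => t _.
  by rewrite gee0_abs// lee_fin mulr_ge0 ?powR_ge0.
have h1 : {ae mu, forall t : RR, Ihalf t ->
    ((h t - cutoff n t) * `|sin (t / 2)| `^ alpha)%:E @[n --> \oo] --> (0 : \bar R)}.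
  apply: aeW => t _; apply: cvg_near_cst.
  exists (Num.truncn (h t)).+1 => // n /= hn.
  have hn' : h t <= n%:R by apply: ltW; apply: lt_le_trans (truncnS_gt (h t)) _; rewrite ler_nat.
  by rewrite /cutoff min_l// subrr mul0r.
have h2 : {ae mu, forall (t : RR) (n : nat), Ihalf t ->
    (`|((h t - cutoff n t) * `|sin (t / 2)| `^ alpha)%:E| <= (h t * `|sin (t / 2)| `^ alpha)%:E)%E}.
  apply: aeW => t n _.
  rewrite gee0_abs ?lee_fin ?mulr_ge0 ?powR_ge0 ?subr_ge0 ?cutoff_le//.
  by rewrite ler_wpM2r ?powR_ge0// gerBl cutoff_ge0.
have [_ _ cv] := @dominated_convergence _ _ _ mu Ihalf (@m0pi2 R) _ (fun=> 0%E) _ mf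
  (@measurable_cst _ _ _ _ _ _) h1 ig h2.
rewrite integral0 in cv.
have [|n _ Hn] := cv [set y | (y < kap%:E)%E].
  by apply: open_nbhs_nbhs; split; [exact: open_ereal_lt_ereal|rewrite /= lte_fin].
by exists n; apply: ltW; exact: (Hn n (leqnn n)).
Qed.

Lemma half_angle_powers t : 0 <= t <= pi / 2 ->
  let c := `|cos (t / 2)| `^ alpha in let s := `|sin (t / 2)| `^ alpha in
  1 <= c + s /\ c <= 1.
Proof.
move=> /andP[t0 t2] c s.
have := pi_gt0 R => pi0.
have c1 : `|cos (t / 2)| <= 1 by rewrite ler_norml cos_geN1 cos_le1.
have s1 : `|sin (t / 2)| <= 1 by rewrite ler_norml sin_geN1 sin_le1.
split.
  have h1 := @powR_ge_sqr R `|cos (t / 2)| alpha; have h2 := @powR_ge_sqr R `|sin (t / 2)| alpha.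
  rewrite normr_ge0 c1 real_normK ?num_real// in h1.
  rewrite normr_ge0 s1 real_normK ?num_real// in h2.
  by rewrite -[leLHS](cos2Dsin2 (t / 2)); apply: lerD; [exact: h1|exact: h2].
have <- : 1 `^ alpha = 1 :> R by rewrite powR1.
by case/andP: al02 => al0 _; rewrite ge0_ler_powR// ?nnegrE// ltW.
Qed.

(** Up to the factor [2 * pi], this is the rate [lambda]. *)
Definition excess : \bar R := (\int[mu]_(t in Ihalf)
  (h t * (`|cos (t / 2)| `^ alpha + `|sin (t / 2)| `^ alpha - 1))%:E)%E.

Lemma excess_ge0 : (0 <= excess)%E.
Proof.
apply: integral_ge0 => t /=; rewrite in_itv/= => /half_angle_powers[cs _].
by rewrite lee_fin mulr_ge0// subr_ge0.
Qed.

Lemma excess_fin : (excess < +oo)%E.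
Proof.
apply: le_lt_trans hoo; apply: ge0_le_integral.
- exact: m0pi2.
- move=> t /=; rewrite in_itv/= => /half_angle_powers[cs _].
  by rewrite lee_fin mulr_ge0// subr_ge0.
- apply: measurable_funTS; apply: mereal_EFin; apply: mreal_mul => //.
  apply: mreal_add; last exact: (@measurable_cst _ _ _ _ _ (- 1 : measurableTypeR R)).
  by apply: mreal_add; [exact: mreal_cos_half|exact: mreal_sin_half].
- by apply: measurable_funTS; apply: mereal_EFin; apply: mreal_mul => //; exact: mreal_sin_half.
- move=> t /=; rewrite in_itv/= => /half_angle_powers[_ c1].
  by rewrite lee_fin ler_wpM2l//; lra.
Qed.

(** For [alpha <= 2] the bracket of [excess] is nonnegative, so the balance of
    gain and loss for the truncated kernel does not exceed that for [h]. *)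
Lemma cutoff_balance n :
  (\int[mu]_(t in Ihalf) (cutoff n t * `|cos (t / 2)| `^ alpha)%:E
     + singular_mass alpha (cutoff n) <=
   (\int[mu]_(t in Ihalf) cutoff n t + fine excess)%:E)%E.
Proof.
have mk := mreal_cutoff n; have mc := mreal_cos_half; have ms := mreal_sin_half.
have k0 := cutoff_ge0 n.
have mcs : mreal (fun t : RR => `|cos (t / 2)| `^ alpha + `|sin (t / 2)| `^ alpha - 1).
  apply: mreal_add; last exact: (@measurable_cst _ _ _ _ _ (- 1 : measurableTypeR R)).
  exact: mreal_add.
have Ik : (\int[mu]_(t in Ihalf) (cutoff n t)%:E)%E \is a fin_num.
  apply: (integrable_fin_num (@m0pi2 R)).
  exact: (Cintegrable_Re (@m0pi2 R) (truncation_integrable mk k0 (cutoff_bounded n))).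
rewrite EFinD /Rintegral (fineK Ik) fineK; last first.
  by rewrite ge0_fin_numE ?excess_ge0 ?excess_fin.
rewrite /singular_mass -ge0_integralD; last 5 first.
- exact: m0pi2.
- by move=> t _; rewrite lee_fin mulr_ge0 ?powR_ge0.
- by apply: measurable_funTS; apply: mereal_EFin; exact: mreal_mul.
- by move=> t _; rewrite lee_fin mulr_ge0 ?powR_ge0.
- by apply: measurable_funTS; apply: mereal_EFin; exact: mreal_mul.
rewrite /excess -ge0_integralD; last 5 first.
- exact: m0pi2.
- by move=> t _; rewrite lee_fin.
- by apply: measurable_funTS; exact: mereal_EFin.
- move=> t /=; rewrite in_itv/= => /half_angle_powers[cs _].
  by rewrite lee_fin mulr_ge0// subr_ge0.
- by apply: measurable_funTS; apply: mereal_EFin; exact: mreal_mul.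
apply: ge0_le_integral.
- exact: m0pi2.
- by move=> t _; rewrite -EFinD lee_fin addr_ge0// mulr_ge0 ?powR_ge0.
- by apply: measurable_funTS; apply: mereal_add; apply: mereal_EFin; exact: mreal_mul.
- by apply: measurable_funTS; apply: mereal_add; apply: mereal_EFin => //; exact: mreal_mul.
move=> t /=; rewrite in_itv/= => /half_angle_powers[cs _].
rewrite -!EFinD lee_fin -mulrDr.
set d := _ + _ - 1 in cs *.
have d0 : 0 <= d by rewrite subr_ge0.
have -> : `|cos (t / 2)| `^ alpha + `|sin (t / 2)| `^ alpha = 1 + d by rewrite /d; ring.
by rewrite mulrDr mulr1 lerD2l ler_wpM2r// cutoff_le.
Qed.

End CutoffKernels.

(** * Exponential bound on balls *)

(** The properties of a solution on which the estimate rests; the time ranges over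
    the whole line so that joint measurability makes sense without restriction. *)
Record regular_flow (R : realType) (p delta alpha : R) (h : measurableTypeR R -> R)
    (phi0 : R3 R -> R[i]) (F : measurableTypeR R -> R3 R -> R[i]) : Prop := RegularFlow {
  flow_charfun : forall tau, exists f : probability (R3 R) R, F tau = charfun f;
  flow_measurable : mcomplex (fun q : measurableTypeR R * R3 R => F q.1 q.2);
  flow_decay : forall (tau : R) x, 0 <= tau -> growth p delta tau x * normc (F tau x) <= 1;
  flow_moment : forall T : R, exists C : R, forall tau : R, 0 <= tau <= T ->
    (moment alpha F tau <= C%:E)%E;
  flow_continuous : forall s e : R, 0 <= s -> 0 < e -> exists2 d : R, 0 < d &
    forall t : R, 0 <= t -> `|t - s| < d ->
    (\int[leb3 R]_x ((wt alpha x)%:E * (normc (F t x - F s x))%:E) <= e%:E)%E;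
  flow_duhamel : forall x (r : R), x != 0 -> 0 <= r ->
    F r x = (expR (- (delta * enorm x `^ p * r)))%:C * phi0 x +
     Cintegral (@lebesgue_measure R) `[0, r] (fun tau =>
       (expR (- (delta * enorm x `^ p * (r - tau))))%:C * collision h F tau x) }.

Section MassGrowth.
Context (R : realType) (p delta alpha M : R) (h : measurableTypeR R -> R)
  (phi0 psi0 : R3 R -> R[i]) (Phi Psi : measurableTypeR R -> R3 R -> R[i]).
Notation mu := (@lebesgue_measure R).
Notation RR := (measurableTypeR R).
Hypotheses (p02 : 0 < p <= 2) (delta0 : 0 <= delta) (al02 : 0 < alpha <= 2)
  (mh : mreal h) (h0 : forall t, 0 <= h t) (hoo : (singular_mass alpha h < +oo)%E)
  (FPhi : regular_flow p delta alpha h phi0 Phi)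
  (FPsi : regular_flow p delta alpha h psi0 Psi).

Let al0 : 0 < alpha. Proof. by case/andP: al02. Qed.

Notation mass := (mass p delta Phi Psi alpha M).
Notation drift := (drift p delta Phi Psi alpha M).
Notation gap := (gap p delta Phi Psi).
Notation gap_size := (gap_size p delta Phi Psi).
Notation growth := (growth p delta).

Lemma wt_integral_comb (c1 c2 : R) (a b : R3 R -> R) : 0 <= c1 -> 0 <= c2 ->
  mreal a -> mreal b -> (forall x, 0 <= a x) -> (forall x, 0 <= b x) ->
  (\int[leb3 R]_x ((wt alpha x)%:E * (c1 * a x + c2 * b x)%:E) =
   c1%:E * \int[leb3 R]_x ((wt alpha x)%:E * (a x)%:E) +
   c2%:E * \int[leb3 R]_x ((wt alpha x)%:E * (b x)%:E))%E.
Proof.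
move=> c10 c20 ma mb a0 b0.
have mw := mreal_wt1 alpha; have w0 := wt_ge0 alpha.
have m1 (g : R3 R -> R) : mreal g -> measurable_fun setT (fun x => (wt alpha x)%:E * (g x)%:E)%E.
  by move=> mg; apply: mereal_mul; exact: mereal_EFin.
have p1 (g : R3 R -> R) : (forall x, 0 <= g x) -> forall x, (0 <= (wt alpha x)%:E * (g x)%:E)%E.
  by move=> g0 x; rewrite mule_ge0 ?lee_fin.
have mc c (g : R3 R -> R) : mreal g -> measurable_fun setT (fun x => c%:E * ((wt alpha x)%:E * (g x)%:E))%E.
  by move=> mg; apply: mereal_mul; [exact: measurable_cst|exact: m1].
have pc c (g : R3 R -> R) : 0 <= c -> (forall x, 0 <= g x) ->
    forall x, (0 <= c%:E * ((wt alpha x)%:E * (g x)%:E))%E.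
  by move=> c0 g0 x; apply: mule_ge0; [rewrite lee_fin|exact: p1].
rewrite -(ge0Zl _ (@measurableT _ _) (m1 a ma) (p1 a a0)) ?lee_fin//.
rewrite -(ge0Zl _ (@measurableT _ _) (m1 b mb) (p1 b b0)) ?lee_fin//.
rewrite -ge0_integralD; last 5 first.
- exact: measurableT.
- by move=> x _; exact: pc.
- exact: mc.
- by move=> x _; exact: pc.
- exact: mc.
by apply: eq_integral => x _; rewrite -!EFinM -EFinD mulrDr (mulrCA c1) (mulrCA c2).
Qed.

Definition growth_max (T : R) : R := expR (delta * M `^ p * T).

Lemma rate_le x : enorm x <= M -> 0 <= delta * enorm x `^ p <= delta * M `^ p.
Proof.
move=> xM; rewrite mulr_ge0 ?powR_ge0//=; apply: ler_wpM2l => //.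
case/andP: p02 => pP _; apply: ge0_ler_powR => //; rewrite ?nnegrE; first exact: ltW.
  exact: enorm_ge0.
exact: le_trans (enorm_ge0 x) xM.
Qed.

Lemma growth_le_max x tau T : enorm x <= M -> 0 <= tau <= T -> growth tau x <= growth_max T.
Proof.
move=> /rate_le/andP[r0 rM] /andP[tau0 tauT]; rewrite ler_expR.
by apply: ler_pM.
Qed.

Lemma growth_lipschitz x s tau T : enorm x <= M -> 0 <= s <= T -> 0 <= tau <= T ->
  `|growth s x - growth tau x| <= growth_max T * (delta * M `^ p) * `|s - tau|.
Proof.
move=> xM.
wlog st : s tau / tau <= s => [H sT tT|].
  have [ts|st] := leP tau s; first exact: H.
  by rewrite distrC (distrC s); apply: H => //; exact: ltW.
move=> sT tT; have gs := growth_le_max xM sT.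
have /andP[r0 rM] := rate_le xM.
have st0 : 0 <= s - tau by rewrite subr_ge0.
rewrite ger0_norm; last by rewrite subr_ge0 ler_expR ler_wpM2l.
rewrite (ger0_norm st0).
have -> : growth s x - growth tau x =
    growth s x * (1 - expR (- (delta * enorm x `^ p * (s - tau)))).
  by rewrite mulrBr mulr1 /growth -expRD; congr (_ - expR _); ring.
rewrite -[leRHS]mulrA; apply: ler_pM => //; first exact: expR_ge0.
  by rewrite subr_ge0 -[leRHS]expR0 ler_expR oppr_le0 mulr_ge0.
have := expR_ge1Dx (- (delta * enorm x `^ p * (s - tau))).
have : delta * enorm x `^ p * (s - tau) <= delta * M `^ p * (s - tau) by rewrite ler_wpM2r.
by lra.
Qed.

Lemma mreal_slice (F : RR -> R3 R -> R[i]) tau : mcomplex (fun q : RR * R3 R => F q.1 q.2) ->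
  mcomplex (F tau).
Proof.
move=> mF; apply: (mcomplex_comp (g := fun x : R3 R => (tau, x)) mF).
by apply: meas_pair; [exact: measurable_cst|exact: measurable_id].
Qed.

Lemma mass_le_moments tau T : 0 <= tau <= T ->
  (mass tau <= (growth_max T)%:E * (moment alpha Phi tau + moment alpha Psi tau))%E.
Proof.
move=> tauT.
have mP := mreal_slice tau (flow_measurable FPhi); have mQ := mreal_slice tau (flow_measurable FPsi).
have m1 : mreal (fun x => normc (Phi tau x - 1)).
  by apply: mreal_normc; apply: mcomplex_sub => //; exact: mcomplex_cst.
have m2 : mreal (fun x => normc (Psi tau x - 1)).
  by apply: mreal_normc; apply: mcomplex_sub => //; exact: mcomplex_cst.
have g0 : 0 <= growth_max T by exact: expR_ge0.
have n0 (F : R3 R -> R[i]) x : 0 <= normc (F x) by exact: normc_ge0.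
rewrite ge0_muleDr; [|exact: moment_ge0|exact: moment_ge0].
rewrite -(wt_integral_comb g0 g0 m1 m2 (n0 _) (n0 _)).
apply: ge0_le_integral.
- exact: measurableT.
- by move=> x _; rewrite lee_fin mulr_ge0 ?ball_wt_ge0 ?gap_size_ge0.
- apply: mereal_EFin; apply: mreal_mul; first exact: mreal_ball_wt.
  by apply: (mreal_gap_size (f := fun _ => tau) (g := id) p delta (flow_measurable FPhi) (flow_measurable FPsi));
    [exact: measurable_cst|exact: measurable_id].
- apply: mereal_mul; first by apply: mereal_EFin; exact: mreal_wt1.
  by apply: mereal_EFin; apply: mreal_add; apply: mreal_mul => //; exact: measurable_cst.
move=> x _; rewrite -EFinM lee_fin /ball_wt; case: ifP => xM; last first.
  rewrite mul0r; apply: mulr_ge0; first exact: wt_ge0.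
  by apply: addr_ge0; apply: mulr_ge0 => //; exact: normc_ge0.
apply: ler_wpM2l; first exact: wt_ge0.
rewrite -mulrDr; apply: ler_pM.
- exact: growth_ge0.
- exact: normc_ge0.
- exact: growth_le_max.
have -> : Phi tau x - Psi tau x = (Phi tau x - 1) - (Psi tau x - 1) by ring.
exact: normcB.
Qed.

Lemma mass_fin tau : 0 <= tau -> mass tau \is a fin_num.
Proof.
move=> tau0; have tauT : 0 <= tau <= tau by rewrite tau0 lexx.
have [C1 H1] := flow_moment FPhi tau; have [C2 H2] := flow_moment FPsi tau.
rewrite ge0_fin_numE; last exact: mass_ge0.
apply: le_lt_trans (mass_le_moments tauT) _.
apply: (@le_lt_trans _ _ ((growth_max tau)%:E * (C1%:E + C2%:E))%E); last by rewrite -EFinD -EFinM ltry.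
by apply: lee_wpmul2l; [rewrite lee_fin expR_ge0|exact: (leeD (H1 tau tauT) (H2 tau tauT))].
Qed.

Lemma mass_le_drift s tau : (mass tau <= mass s + drift s tau)%E.
Proof.
have mPhi := flow_measurable FPhi; have mPsi := flow_measurable FPsi.
have mg u : mreal (fun x : R3 R => ball_wt alpha M x * gap_size u x).
  apply: mreal_mul; first exact: mreal_ball_wt.
  by apply: (mreal_gap_size (f := fun _ => u) (g := id) p delta mPhi mPsi);
    [exact: measurable_cst|exact: measurable_id].
have md : mreal (fun x : R3 R => ball_wt alpha M x * normc (gap s x - gap tau x)).
  apply: mreal_mul; first exact: mreal_ball_wt.
  exact: (measurableT_comp (mreal_gap_diff p delta mPhi mPsi s) (pair2_measurable tau)).
rewrite -ge0_integralD; last 5 first.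
- exact: measurableT.
- by move=> x _; rewrite lee_fin mulr_ge0 ?ball_wt_ge0 ?gap_size_ge0.
- exact: mereal_EFin.
- by move=> x _; rewrite lee_fin mulr_ge0 ?ball_wt_ge0 ?normc_ge0.
- exact: mereal_EFin.
apply: ge0_le_integral.
- exact: measurableT.
- by move=> x _; rewrite lee_fin mulr_ge0 ?ball_wt_ge0 ?gap_size_ge0.
- exact: mereal_EFin.
- by apply: mereal_add; exact: mereal_EFin.
move=> x _; rewrite -EFinD lee_fin -mulrDr; apply: ler_wpM2l; first exact: ball_wt_ge0.
rewrite -!normc_gap {1}(_ : gap tau x = gap s x - (gap s x - gap tau x)); last by ring.
exact: normcB.
Qed.

(** The oscillation of [gap] comes from that of the two flows, multiplied by a
    bounded weight, and from that of the weight, multiplied by the distances of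
    the flows to [1]. *)
Lemma drift_small s e : 0 <= s -> 0 < e -> exists2 d : R, 0 < d &
  forall tau, 0 <= tau -> `|tau - s| < d -> (drift s tau <= e%:E)%E.
Proof.
move=> s0 e0.
have mPhi := flow_measurable FPhi; have mPsi := flow_measurable FPsi.
have [C1 H1] := flow_moment FPhi s; have [C2 H2] := flow_moment FPsi s.
have sI : 0 <= s <= s by rewrite s0 lexx.
pose G := growth_max (s + 1); have G0 : 0 < G by exact: expR_gt0.
pose B := G * (delta * M `^ p) * (`|C1| + `|C2|).
have B0 : 0 <= B by rewrite !mulr_ge0 ?addr_ge0 ?powR_ge0// ltW.
have e1 : 0 < e / (4 * G) by rewrite divr_gt0// mulr_gt0.
have [d1 d10 D1] := flow_continuous FPhi s0 e1.
have [d2 d20 D2] := flow_continuous FPsi s0 e1.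
have e3 : 0 < e / (2 * B + 1) by rewrite divr_gt0// ltr_wpDl// mulr_ge0.
exists (Num.min (Num.min 1 (e / (2 * B + 1))) (Num.min d1 d2)).
  by rewrite !lt_min ltr01 e3 d10 d20.
move=> tau tau0; rewrite !lt_min => /andP[/andP[h1 h3] /andP[hd1 hd2]].
have tauT : 0 <= tau <= s + 1.
  by rewrite tau0/=; move: h1; rewrite ltr_norml => /andP[_ ?]; lra.
have sT : 0 <= s <= s + 1 by rewrite s0/= lerDl.
pose c := G * (delta * M `^ p) * `|s - tau|.
have c0 : 0 <= c by rewrite !mulr_ge0 ?powR_ge0// ltW.
have n0 (F : R3 R -> R[i]) x : 0 <= normc (F x) by exact: normc_ge0.
have mm (F F' : R3 R -> R[i]) : mcomplex F -> mcomplex F' -> mreal (fun x => normc (F x - F' x)).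
  by move=> mF mF'; apply: mreal_normc; exact: mcomplex_sub.
have mP u := mreal_slice u mPhi; have mQ u := mreal_slice u mPsi.
have m1c : mcomplex (fun _ : R3 R => 1 : R[i]) by exact: mcomplex_cst.
pose a x := 1 * normc (Phi tau x - Phi s x) + 1 * normc (Psi tau x - Psi s x).
pose b x := 1 * normc (Phi s x - 1) + 1 * normc (Psi s x - 1).
have ma : mreal a by apply: mreal_add; apply: mreal_mul; try exact: mm; exact: measurable_cst.
have mb : mreal b by apply: mreal_add; apply: mreal_mul; try exact: (mm _ _ _ m1c); exact: measurable_cst.
have a0 x : 0 <= a x by rewrite /a !mul1r addr_ge0 ?normc_ge0.
have b0 x : 0 <= b x by rewrite /b !mul1r addr_ge0 ?normc_ge0.
have md : mreal (fun x : R3 R => ball_wt alpha M x * normc (gap s x - gap tau x)).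
  apply: mreal_mul; first exact: mreal_ball_wt.
  exact: (measurableT_comp (mreal_gap_diff p delta mPhi mPsi s) (pair2_measurable tau)).
apply: (@le_trans _ _ (\int[leb3 R]_x ((wt alpha x)%:E * (G * a x + c * b x)%:E))%E).
  apply: ge0_le_integral.
  - exact: measurableT.
  - by move=> x _; rewrite lee_fin mulr_ge0 ?ball_wt_ge0 ?normc_ge0.
  - exact: mereal_EFin.
  - apply: mereal_mul; first by apply: mereal_EFin; exact: mreal_wt1.
    by apply: mereal_EFin; apply: mreal_add; apply: mreal_mul => //; exact: measurable_cst.
  move=> x _; rewrite -EFinM lee_fin /ball_wt; case: ifP => xM; last first.
    rewrite mul0r; apply: mulr_ge0; first exact: wt_ge0.
    by apply: addr_ge0; apply: mulr_ge0 => //; exact: ltW.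
  apply: ler_wpM2l; first exact: wt_ge0.
  have -> : gap s x - gap tau x =
      (growth tau x)%:C * ((Phi s x - Phi tau x) - (Psi s x - Psi tau x)) +
      (growth s x - growth tau x)%:C * ((Phi s x - 1) - (Psi s x - 1)).
    have gE u : gap u x = (growth u x)%:C * (Phi u x - Psi u x) by [].
    rewrite !gE (rmorphB (real_complex R) (growth s x) (growth tau x)).
    by move: (Phi s x) (Psi s x) (Phi tau x) (Psi tau x) => *; ring.
  apply: le_trans (normcD _ _) _; rewrite !normcM !normc_real; apply: lerD.
    apply: ler_pM; [exact: normr_ge0|exact: normc_ge0| |].
      by rewrite ger0_norm ?growth_ge0//; exact: growth_le_max.
    apply: le_trans (normcB _ _) _; rewrite /a !mul1r -normcN opprB.
    by rewrite -(normcN (Psi s x - _)) opprB.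
  apply: ler_pM; [exact: normr_ge0|exact: normc_ge0| |].
    exact: growth_lipschitz.
  by apply: le_trans (normcB _ _) _; rewrite /b !mul1r.
rewrite (wt_integral_comb (ltW G0) c0 ma mb a0 b0).
rewrite (wt_integral_comb ler01 ler01 (mm _ _ (mP tau) (mP s)) (mm _ _ (mQ tau) (mQ s)) (n0 _) (n0 _)).
rewrite (wt_integral_comb ler01 ler01 (mm _ _ (mP s) m1c) (mm _ _ (mQ s) m1c) (n0 _) (n0 _)).
rewrite !mul1e.
apply: (@le_trans _ _ (G%:E * ((e / (4 * G))%:E + (e / (4 * G))%:E) + c%:E * (`|C1|%:E + `|C2|%:E))%E).
  apply: leeD.
    apply: lee_wpmul2l; first by rewrite lee_fin ltW.
    exact: (leeD (D1 tau tau0 hd1) (D2 tau tau0 hd2)).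
  apply: lee_wpmul2l; first by rewrite lee_fin.
  apply: leeD.
    by apply: le_trans (H1 s sI) _; rewrite lee_fin ler_norm.
  by apply: le_trans (H2 s sI) _; rewrite lee_fin ler_norm.
change ((G * (e / (4 * G) + e / (4 * G)) + c * (`|C1| + `|C2|))%:E <= e%:E)%E.
rewrite lee_fin.
have -> : G * (e / (4 * G) + e / (4 * G)) = e / 2 by field; rewrite gt_eqF.
have -> : c * (`|C1| + `|C2|) = B * `|tau - s| by rewrite distrC /c /B; ring.
have : B * `|tau - s| <= B * (e / (2 * B + 1)) by apply: ler_wpM2l => //; exact: ltW.
have : B * (e / (2 * B + 1)) <= e / 2.
  rewrite mulrA ler_pdivrMr; last by rewrite ltr_wpDl// mulr_ge0.
  by lra.
by lra.
Qed.

Lemma drift_sym s tau : drift s tau = drift tau s.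
Proof. by apply: eq_integral => x _; rewrite -normcN opprB. Qed.

(** The truncation level may depend on the time [s] and on the error [e] of
    [dini_gronwall], because [cutoff_balance] gives the same rate for all
    levels. *)
Lemma mass_growth t : 0 <= t ->
  (mass t <= (expR (2 * pi * fine (excess alpha h) * t))%:E * mass 0%R)%E.
Proof.
pose l := 2 * pi * fine (excess alpha h).
pose m (tau : R) : R := fine (mass tau).
have massE tau : 0 <= tau -> mass tau = (m tau)%:E by move=> tau0; rewrite /m fineK// mass_fin.
have exc0 := excess_ge0 al02 h0.
have l0 : 0 <= l by rewrite !mulr_ge0 ?pi_ge0 ?fine_ge0.
have m0 tau : 0 <= m tau by rewrite fine_ge0 ?mass_ge0.
suff H : forall t, 0 <= t -> m t <= expR (l * t) * m 0.
  by move=> t0; rewrite !massE// -EFinM lee_fin; exact: H.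
apply: dini_gronwall => //.
  move=> s e s0 e0; have [d d0 Hd] := drift_small s0 e0.
  exists d => // t1 t10 /Hd - /(_ t10) dr.
  rewrite ler_distlC; apply/andP; split.
    rewrite lerBlDr -lee_fin EFinD -!massE//.
    exact: (le_trans (mass_le_drift s t1) (leeD (lexx _) dr)).
  rewrite -lee_fin EFinD -!massE//.
  have dr' : (drift t1 s <= e%:E)%E by rewrite (drift_sym t1 s).
  exact: (le_trans (mass_le_drift t1 s) (leeD (lexx _) dr')).
move=> s e s0 e0.
pose T := s + 1; pose G := growth_max T; have G0 : 0 < G by exact: expR_gt0.
have [C1 H1] := flow_moment FPhi T; have [C2 H2] := flow_moment FPsi T.
pose C := `|C1| + `|C2| + 1.
have C0 : 0 < C by rewrite ltr_wpDl// addr_ge0.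
have HC1 (tau : R) : 0 <= tau <= T -> (moment alpha Phi tau <= C%:E)%E.
  move=> /H1 /le_trans; apply; rewrite lee_fin /C; have := ler_norm C1; have := normr_ge0 C2; lra.
have HC2 (tau : R) : 0 <= tau <= T -> (moment alpha Psi tau <= C%:E)%E.
  move=> /H2 /le_trans; apply; rewrite lee_fin /C; have := ler_norm C2; have := normr_ge0 C1; lra.
have pi0 := pi_gt0 R.
pose kap := e / (3 * (G * (32 * pi * C))).
have kap0 : 0 < kap by rewrite divr_gt0// !mulr_gt0.
have kapE : G * (32 * pi * (kap * C)) = e / 3.
  have X0 : G * (32 * pi * C) != 0 by rewrite gt_eqF// !mulr_gt0.
  have -> : G * (32 * pi * (kap * C)) = kap * (G * (32 * pi * C)) by ring.
  by rewrite /kap; move: (G * _) X0 => X X0; field.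
have [n hkap] := cutoff_tail mh h0 hoo kap0.
pose k := cutoff h n; pose A := decay k.
have k0 := cutoff_ge0 h0 n; have kh := cutoff_le h n; have kN := cutoff_bounded h n.
have mk := mreal_cutoff mh n.
have A0 : 0 <= A by exact: decay_ge0.
pose Lk := \int[mu]_(t in `[0, pi / 2]) k t + fine (excess alpha h).
have hLk := cutoff_balance al02 mh h0 hoo n.
have LkE : 2 * pi * Lk = A + l by rewrite /Lk /A /decay /l mulrDr.
have Lk0 : 0 <= 2 * pi * Lk by rewrite LkE addr_ge0.
pose eta := e / (3 * (2 * pi * Lk + A) + 1).
have den0 : 0 < 3 * (2 * pi * Lk + A) + 1 by rewrite ltr_wpDl// mulr_ge0// addr_ge0.
have eta0 : 0 < eta by rewrite divr_gt0.
have etaE : (2 * pi * Lk + A) * eta <= e / 3.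
  rewrite /eta mulrA ler_pdivrMr//.
  have : e / 3 * (3 * (2 * pi * Lk + A) + 1) = (2 * pi * Lk + A) * e + e / 3 by field.
  by lra.
have [d d0 Hd] := drift_small s0 eta0.
have A1 : 0 < (A + 1)^-1 by rewrite invr_gt0 ltr_wpDl.
exists (Num.min d (Num.min 1 (A + 1)^-1)); first by rewrite !lt_min d0 ltr01 A1.
move=> t1 /andP[st1]; rewrite -ltrBlDl !lt_min => /andP[td /andP[t11 tA]].
have ts0 : 0 <= t1 - s by rewrite subr_ge0.
have t10 : 0 <= t1 by exact: le_trans st1.
have t1T : t1 <= T by rewrite /T -lerBlDl ltW.
have small : A * (t1 - s) <= 1.
  apply: (@le_trans _ _ (A * (A + 1)^-1)); first by rewrite ler_wpM2l// ltW.
  by rewrite ler_pdivrMr ?mul1r ?ltr_wpDl// lerDl.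
have step := mass_step p02 delta0 mh mk k0 kh kN (flow_charfun FPhi) (flow_charfun FPsi)
  (flow_measurable FPhi) (flow_measurable FPsi) (@flow_decay _ _ _ _ _ _ _ FPhi)
  (@flow_decay _ _ _ _ _ _ _ FPsi) al0 M s0 st1 t1T small hoo hkap hLk HC1 HC2
  (flow_duhamel FPhi) (flow_duhamel FPsi).
pose K := e / 3 + (2 * pi * Lk * (m s + eta) + A * eta).
have intK : (\int[mu]_(tau in `]s, t1]) ((expR (delta * M `^ p * T) * (32 * pi * (kap * C)))%:E +
       ((2 * pi * Lk)%:E * mass tau + A%:E * drift s tau)) <= (K * (t1 - s))%:E)%E.
  apply: (@le_trans _ _ (\int[mu]_(tau in `]s, t1]) K%:E)%E); last first.
    apply: ereal_eq_le; refine (etrans (integral_cst mu (meas_itv `]s, t1]) K%:E) _).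
    rewrite [X in (_ * X)%E](lebesgue_measure_itv (Interval _ _))/= lte_fin.
    have [_|ts] := ltP s t1; first by rewrite -EFinB -EFinM.
    have -> : t1 - s = 0 by apply/eqP; rewrite subr_eq0 eq_le st1 ts.
    by rewrite mule0 mulr0.
  have mmass := measurable_mass p delta (flow_measurable FPhi) (flow_measurable FPsi) alpha M.
  have mdrift := measurable_drift p delta (flow_measurable FPhi) (flow_measurable FPsi) alpha M s.
  apply: ge0_le_integral.
  - exact: meas_itv.
  - move=> tau _; apply: adde_ge0.
      rewrite lee_fin; have k1 := ltW kap0; have c1 := ltW C0; have p1 := ltW pi0.
      apply: mulr_ge0; first exact: expR_ge0.
      by apply: mulr_ge0; exact: mulr_ge0.
    apply: adde_ge0; apply: mule_ge0; rewrite ?lee_fin; [exact: Lk0|exact: mass_ge0|exact: A0|exact: drift_ge0].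
  - apply: measurable_funTS; apply: mereal_add; first exact: measurable_cst.
    by apply: mereal_add; apply: mereal_mul => //; exact: measurable_cst.
  - exact: measurable_cst.
  move=> tau; rewrite /= in_itv/= => /andP[stau taut].
  have tau0 : 0 <= tau by rewrite (le_trans s0 (ltW stau)).
  have dtau : `|tau - s| < d.
    by rewrite ger0_norm ?subr_ge0 1?ltW//; apply: le_lt_trans td; rewrite lerD2r.
  have dr := Hd tau tau0 dtau.
  have ms : (mass tau <= (m s + eta)%:E)%E.
    by rewrite EFinD -massE//; exact: (le_trans (mass_le_drift s tau) (leeD (lexx _) dr)).
  have h1 : ((2 * pi * Lk)%:E * mass tau <= (2 * pi * Lk * (m s + eta))%:E)%E.
    by rewrite (EFinM (2 * pi * Lk) (m s + eta)); apply: lee_wpmul2l => //; rewrite lee_fin.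
  have h2 : (A%:E * drift s tau <= (A * eta)%:E)%E.
    by rewrite (EFinM A eta); apply: lee_wpmul2l => //; rewrite lee_fin.
  apply: le_trans (leeD (lexx _) (leeD h1 h2)) _.
  rewrite -!EFinD lee_fin /K lerD2r le_eqVlt; apply/orP; left; apply/eqP.
  by rewrite -/(growth_max T) -/G kapE.
have : (mass t1 <= ((1 - A * (t1 - s)) * m s + K * (t1 - s))%:E)%E.
  rewrite (EFinD ((1 - A * (t1 - s)) * m s) (K * (t1 - s))) (EFinM (1 - A * (t1 - s)) (m s)).
  rewrite -(massE s s0); exact: (le_trans step (leeD (lexx _) intK)).
rewrite (massE t1 t10) lee_fin => /le_trans; apply.
have -> : (1 - A * (t1 - s)) * m s + K * (t1 - s) =
    m s + (t1 - s) * ((2 * pi * Lk - A) * m s + (e / 3 + (2 * pi * Lk + A) * eta)).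
  by rewrite /K; ring.
rewrite lerD2l ler_wpM2l// LkE (addrC A) addrK lerD2l; rewrite LkE in etaE.
by move: etaE; lra.
Qed.

End MassGrowth.

(** * Solutions are regular flows *)

Section FlowsOfSolutions.
Context (R : realType).
Notation mu := (@lebesgue_measure R).
Notation RR := (measurableTypeR R).

Lemma Mnorm_leb3 alpha (g : R3 R -> R[i]) :
  Mnorm alpha g = (\int[leb3 R]_x ((wt alpha x)%:E * (normc (g x))%:E))%E.
Proof. by apply: eq_integral => x _; rewrite -EFinM mulrC. Qed.

Lemma time_continuity (u : R -> R[i]^o) t e : {within `[0, +oo[, continuous u} ->
  0 <= t -> 0 < e ->
  exists2 d : R, 0 < d & forall s, 0 <= s -> `|s - t| < d -> normc (u s - u t) <= e.
Proof.
move=> /subspace_continuousP uc t0 e0.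
have tI : `[0, +oo[%classic t by rewrite /= in_itv/= t0.
have e0' : 0 < e%:C by rewrite ltcR.
have /cvgrPdist_lt/(_ _ e0') := uc t tI.
rewrite near_withinE => /nbhs_ballP[d /= d0 H].
exists d => // s s0 std.
have : `|u t - u s| < e%:C.
  by apply: H; [rewrite /ball/= distrC|rewrite /= in_itv/= s0].
by rewrite distrC => /ltW; rewrite (_ : `|u s - u t| = (normc (u s - u t))%:C)// lecR.
Qed.

Lemma supnorm_ge0 alpha (g : R3 R -> R[i]) : (0 <= supnorm alpha g)%E.
Proof.
pose x : R3 R := vec3 1 0 0.
have x0 : x != 0 by apply/eqP => /(congr1 (fun y : R3 R => y.1.1)) /eqP; rewrite /= oner_eq0.
apply: (@le_trans _ _ (normc (g x) / enorm x `^ alpha)%:E).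
  by rewrite lee_fin divr_ge0 ?normc_ge0 ?powR_ge0.
by apply: ereal_sup_ubound; exists x.
Qed.

Lemma M_continuity alpha (phi : R3 R -> R -> R[i]) t e : M_continuous alpha phi ->
  0 <= t -> 0 < e -> exists2 d : R, 0 < d &
    forall s, 0 <= s -> `|s - t| < d -> (Mnorm alpha (fun x => phi x s - phi x t)%R <= e%:E)%E.
Proof.
move=> [_ cont] t0 e0.
have : nbhs (0 : \bar R)%E [set y | (y < e%:E)%E].
  by apply: open_nbhs_nbhs; split; [exact: open_ereal_lt_ereal|rewrite /= lte_fin].
move=> U0; have : \forall s \near within `[0, +oo[ (nbhs t), (dis alpha (phi^~ s) (phi^~ t) < e%:E)%E.
  exact: (cont t t0 _ U0).
rewrite near_withinE => /nbhs_ballP[d /= d0 H].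
exists d => // s s0 std.
have : (dis alpha (phi^~ s) (phi^~ t) < e%:E)%E.
  by apply: H; [rewrite /ball/= distrC|rewrite /= in_itv/= s0].
move=> /ltW; apply: le_trans; rewrite /dis leeDl//; exact: supnorm_ge0.
Qed.


(** This makes the distance to [1] locally bounded in time, and hence bounded on
    compact intervals by [locally_bounded]. *)
Lemma near_moment alpha (phi : R3 R -> R -> R[i]) s t e :
  in_M alpha (phi^~ s) -> in_M alpha (phi^~ t) ->
  (Mnorm alpha (fun x => phi x s - phi x t)%R <= e%:E)%E ->
  fine (Mnorm alpha (fun x => phi x s - 1)%R) <= fine (Mnorm alpha (fun x => phi x t - 1)%R) + e.
Proof.
move=> [[f fE] fs] [[g gE] ft] ste.
have mf : mcomplex (phi^~ s).
  by rewrite (_ : phi^~ s = charfun f); [exact: mcomplex_charfun|apply/funext].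
have mg : mcomplex (phi^~ t).
  by rewrite (_ : phi^~ t = charfun g); [exact: mcomplex_charfun|apply/funext].
have M0 (F : R3 R -> R[i]) : (0 <= Mnorm alpha F)%E.
  by apply: integral_ge0 => x _; rewrite lee_fin divr_ge0 ?normc_ge0 ?powR_ge0.
have finM (F : R3 R -> R[i]) : (Mnorm alpha F < +oo)%E -> Mnorm alpha F = (fine (Mnorm alpha F))%:E.
  by move=> Foo; rewrite fineK// ge0_fin_numE.
rewrite -lee_fin EFinD -(finM _ fs) -(finM _ ft).
apply: le_trans (leeD (lexx _) ste).
have m1 (F : R3 R -> R[i]) : mcomplex F -> measurable_fun setT (fun x => (wt alpha x)%:E * (normc (F x))%:E)%E.
  by move=> mF; apply: mereal_mul; apply: mereal_EFin; [exact: mreal_wt1|exact: mreal_normc].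
have p1 (F : R3 R -> R[i]) x : (0 <= (wt alpha x)%:E * (normc (F x))%:E)%E.
  by rewrite mule_ge0 ?lee_fin ?wt_ge0 ?normc_ge0.
have ms1 := m1 _ (mcomplex_sub mf (@mcomplex_cst _ _ _ 1)).
have mt1 := m1 _ (mcomplex_sub mg (@mcomplex_cst _ _ _ 1)).
have mst := m1 _ (mcomplex_sub mf mg).
rewrite !Mnorm_leb3 -ge0_integralD; last 5 first.
- exact: measurableT.
- by move=> x _; exact: (p1 (fun x => phi x t - 1) x).
- exact: mt1.
- by move=> x _; exact: (p1 (fun x => phi x s - phi x t) x).
- exact: mst.
apply: ge0_le_integral.
- exact: measurableT.
- by move=> x _; exact: (p1 (fun x => phi x s - 1) x).
- exact: ms1.
- exact: mereal_add.
move=> x _; rewrite -!EFinM -EFinD lee_fin -mulrDr; apply: ler_wpM2l; first exact: wt_ge0.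
rewrite {1}(_ : phi x s - 1 = (phi x t - 1) + (phi x s - phi x t)); last by ring.
exact: normcD.
Qed.

Variables (p delta alpha : R) (b : R -> R).
Hypotheses
  (b_meas : measurable_fun (`[0, pi] : set R) (fun theta : R => b (cos theta)))
  (b_ge0 : forall theta : R, 0 <= theta <= pi -> 0 <= b (cos theta))
  (b_supp : forall theta : R, pi / 2 < theta <= pi -> b (cos theta) = 0).

Definition clipped (phi : R3 R -> R -> R[i]) (tau : RR) (x : R3 R) : R[i] :=
  phi x (Num.max 0 tau).

Lemma clippedE phi tau x : 0 <= tau -> clipped phi tau x = phi x tau.
Proof. by move=> tau0; rewrite /clipped max_r. Qed.

Lemma clipped_measurable phi : in_T alpha phi ->
  mcomplex (fun q : RR * R3 R => clipped phi q.1 q.2).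
Proof.
move=> [[inM _] reg].
have mt t : 0 <= t -> mcomplex (phi^~ t).
  move=> t0; have [[f fE] _] := inM t t0.
  by rewrite (_ : phi^~ t = charfun f); [exact: mcomplex_charfun|apply/funext].
have ct x t e : 0 <= t -> 0 < e -> exists2 d : R, 0 < d &
    forall s, 0 <= s -> `|s - t| < d -> normc (phi x s - phi x t) <= e.
  by move=> t0 e0; have [c _] := reg x; exact: (time_continuity c t0 e0).
split.
- apply: (@caratheodory_measurable R _ (R3 R) (fun t x => complex.Re (phi x t))).
    by move=> t t0; exact: (mt t t0).1.
  move=> x t e t0 e0; have [d d0 H] := ct x t e t0 e0; exists d => // s s0 /(H s s0).
  by apply: le_trans; rewrite -ReB; exact: normc_Re.
- apply: (@caratheodory_measurable R _ (R3 R) (fun t x => complex.Im (phi x t))).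
    by move=> t t0; exact: (mt t t0).2.
  move=> x t e t0 e0; have [d d0 H] := ct x t e t0 e0; exists d => // s s0 /(H s s0).
  by apply: le_trans; rewrite -ImB; exact: normc_Im.
Qed.

Lemma solution_flow (phi0 : R3 R -> R[i]) (phi : R3 R -> R -> R[i]) :
  in_Tp p delta alpha phi -> is_solution p delta b phi0 phi ->
  regular_flow p delta alpha (angular_kernel b) phi0 (clipped phi).
Proof.
move=> [inT bound] sol; have [[inM cont] _] := inT.
have max0 (tau : R) : 0 <= Num.max 0 tau by rewrite le_max lexx.
split.
- move=> tau; have [[f fE] _] := inM _ (max0 tau).
  by exists f; apply/funext => x; exact: fE.
- exact: clipped_measurable.
- move=> tau x tau0; rewrite clippedE//.
  rewrite -lee_fin; apply: le_trans (bound tau tau0).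
  by apply: ereal_sup_ubound; exists x.
- move=> T; have [T0|T0] := leP 0 T; last first.
    by exists 0 => tau /andP[t0 tT]; move: (le_lt_trans (le_trans t0 tT) T0); rewrite ltxx.
  have [|C HC] := @locally_bounded R (fun t => fine (Mnorm alpha (fun x => phi x t - 1)%R)) T T0.
    move=> s s0; have [d d0 H] := M_continuity (conj inM cont) s0 ltr01.
    exists d => // t t0 ts; exact: (near_moment (inM t t0) (inM s s0) (H t t0 ts)).
  exists C => tau tauT; have /andP[tau0 _] := tauT.
  have := HC tau tauT; rewrite -lee_fin fineK; last first.
    rewrite ge0_fin_numE; first exact: (inM tau tau0).2.
    by apply: integral_ge0 => x _; rewrite lee_fin divr_ge0 ?normc_ge0 ?powR_ge0.
  apply: le_trans; rewrite Mnorm_leb3; apply: ereal_eq_le; apply: eq_integral => x _.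
  by rewrite clippedE.
- move=> s e s0 e0; have [d d0 H] := M_continuity (conj inM cont) s0 e0.
  exists d => // t t0 ts; have := H t t0 ts; rewrite Mnorm_leb3.
  apply: le_trans; apply: ereal_eq_le; apply: eq_integral => x _.
  by rewrite !clippedE.
- move=> x r x0 r0; rewrite clippedE// sol//; congr (_ + _).
  apply: eq_Cintegral => tau /=; rewrite in_itv/= => /andP[tau0 _]; congr (_ * _).
  have [[f fE] _] := inM tau tau0.
  have -> : phi^~ tau = charfun f by apply/funext.
  rewrite (Bop_azimuthal b_supp f x0) /collision.
  apply: eq_Cintegral => t _; congr (_ * azimuthal _ x t).
  by apply/funext => y; rewrite clippedE// fE.
Qed.

End FlowsOfSolutions.

(** * From balls to the whole space, and uniqueness *)

Section MonotoneBalls.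
Context (R : realType) (alpha : R).

Lemma ball_exhaustion (g : R3 R -> R) (B : \bar R) : mreal g -> (forall x, 0 <= g x) ->
  (forall n : nat, (\int[leb3 R]_x (ball_wt alpha n%:R x * g x)%:E <= B)%E) ->
  (\int[leb3 R]_x (wt alpha x * g x)%:E <= B)%E.
Proof.
move=> mg g0 HB.
pose G (n : nat) (x : R3 R) := (ball_wt alpha n%:R x * g x)%:E.
have mG n : measurable_fun setT (G n).
  by apply: mereal_EFin; apply: mreal_mul => //; exact: mreal_ball_wt.
have G0 n x : setT x -> (0 <= G n x)%E by move=> _; rewrite lee_fin mulr_ge0 ?ball_wt_ge0.
have ndG x : setT x -> {homo G^~ x : n m / (n <= m)%N >-> (n <= m)%E}.
  move=> _ n m nm; rewrite lee_fin; apply: ler_wpM2r => //.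
  rewrite /ball_wt; case: ifP => xn; last by case: ifP => _ //; exact: wt_ge0.
  by rewrite (le_trans xn)// ler_nat.
have cv := @cvg_monotone_convergence _ _ _ (leb3 R) setT (@measurableT _ _) G mG G0 ndG.
have -> : (\int[leb3 R]_x (wt alpha x * g x)%:E = \int[leb3 R]_x limn (G^~ x))%E.
  apply: eq_integral => x _; symmetry; apply: cvg_lim => //; apply: cvg_near_cst.
  exists (Num.truncn (enorm x)).+1 => // n /= hn.
  rewrite /G /ball_wt ifT//; apply: ltW; apply: lt_le_trans (truncnS_gt (enorm x)) _.
  by rewrite ler_nat.
have <- : limn (fun n => \int[leb3 R]_x G n x)%E = (\int[leb3 R]_x limn (G^~ x))%E.
  by apply: cvg_lim => //; exact: cv.
apply: lime_le; first by apply/cvg_ex; eexists; exact: cv.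
by apply: nearW => n; exact: HB.
Qed.

End MonotoneBalls.

Section CharfunDensity.
Context (R : realType).
Notation mu := (@lebesgue_measure R).
Notation RR := (measurableTypeR R).

Lemma expectation_cvg (f : probability (R3 R) R) (g : R -> R) (y : nat -> R3 R) x :
  continuous g -> (forall r, `|g r| <= 1) ->
  (forall v, dot v (y n) @[n --> \oo] --> dot v x) ->
  (\int[f]_v g (dot v (y n))) @[n --> \oo] --> \int[f]_v g (dot v x).
Proof.
move=> gc g1 yx.
have mg z : mreal (fun v : R3 R => g (dot v z)).
  apply: (mreal_comp (h := g)); first exact: continuous_measurable_fun.
  exact: mreal_dotl.
have Ig z : f.-integrable setT (EFin \o (fun v => g (dot v z))).
  exact: (@integrable_bounded R f _ 1 (mg z) (fun v => g1 _)).
have I1 : f.-integrable setT (EFin \o (fun _ : R3 R => 1 : R)).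
  apply: (@integrable_bounded R f _ 1); first exact: (@measurable_cst _ _ _ _ _ _).
  by move=> v; rewrite normr1.
have h1 : {ae f, forall v : R3 R, setT v ->
    (g (dot v (y n)))%:E @[n --> \oo] --> (g (dot v x))%:E}.
  apply: aeW => v _; apply: cvg_EFin; first exact: nearW.
  exact: (continuous_cvg _ (gc _) (yx v)).
have h2 : {ae f, forall (v : R3 R) (n : nat), setT v ->
    (`|(g (dot v (y n)))%:E| <= (EFin \o (fun _ : R3 R => 1%R : R)) v)%E}.
  by apply: aeW => v n _; rewrite /= lee_fin.
have [_ _ cv] := @dominated_convergence _ _ _ f setT (@measurableT _ _) _ _ _
  (fun n => mereal_EFin (mg (y n))) (mereal_EFin (mg x)) h1 I1 h2.
apply: fine_cvg; rewrite fineK; first exact: cv.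
exact: (integrable_fin_num measurableT (Ig x)).
Qed.

(** Characteristic functions are continuous, by dominated convergence. *)
Lemma charfun_eq_of_cvg (f g : probability (R3 R) R) (y : nat -> R3 R) x :
  (forall v, dot v (y n) @[n --> \oo] --> dot v x) ->
  (forall n, charfun f (y n) = charfun g (y n)) -> charfun f x = charfun g x.
Proof.
move=> yx fg.
have cosC : continuous (fun r : R => cos (- r)).
  by move=> r; apply: continuous_comp; [exact: opp_continuous|exact: continuous_cos].
have sinC : continuous (fun r : R => sin (- r)).
  by move=> r; apply: continuous_comp; [exact: opp_continuous|exact: continuous_sin].
have cos1 (r : R) : `|cos (- r)| <= 1 by rewrite ler_norml cos_geN1 cos_le1.
have sin1 (r : R) : `|sin (- r)| <= 1 by rewrite ler_norml sin_geN1 sin_le1.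
apply: complex_eq.
- have cf := @expectation_cvg f _ _ _ cosC cos1 yx; have cg := @expectation_cvg g _ _ _ cosC cos1 yx.
  have E : (fun n => \int[f]_v cos (- dot v (y n))) = (fun n => \int[g]_v cos (- dot v (y n))).
    by apply/funext => n; exact: (congr1 (@complex.Re R) (fg n)).
  by rewrite E in cf; exact: (cvg_unique _ cf cg).
- have cf := @expectation_cvg f _ _ _ sinC sin1 yx; have cg := @expectation_cvg g _ _ _ sinC sin1 yx.
  have E : (fun n => \int[f]_v sin (- dot v (y n))) = (fun n => \int[g]_v sin (- dot v (y n))).
    by apply/funext => n; exact: (congr1 (@complex.Im R) (fg n)).
  by rewrite E in cf; exact: (cvg_unique _ cf cg).
Qed.

(** A negligible set contains no box, so [P] holds somewhere in each of the boxes
    of side [1 / n.+1] at [x]. *)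
Lemma ae_dense (P : R3 R -> Prop) x : {ae leb3 R, forall z, P z} ->
  exists2 y : nat -> R3 R, forall n, P (y n) & forall v, dot v (y n) @[n --> \oo] --> dot v x.
Proof.
move=> aeP.
pose I (a : R) (n : nat) : set RR := [set` `]a, a + n.+1%:R^-1[].
pose box n : set (R3 R) := (I x.1.1 n `*` I x.1.2 n) `*` I x.2 n.
have mI a n : measurable (I a n) by exact: meas_itv.
have lI a n : mu (I a n) = (n.+1%:R^-1)%:E.
  rewrite [LHS](lebesgue_measure_itv (Interval _ _))/= lte_fin ltrDl invr_gt0 ltr0Sn.
  by rewrite -EFinB addrC addKr.
have lbox n : (0 < leb3 R (box n))%E.
  have -> : leb3 R (box n) = (mu (I x.1.1 n) * mu (I x.1.2 n) * mu (I x.2 n))%E.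
    refine (etrans (product_measure1E (prod_measure mu mu) mu (measurableX (mI _ n) (mI _ n)) (mI _ n)) _).
    congr (_ * _)%E; exact: (product_measure1E mu mu (mI _ n) (mI _ n)).
  by rewrite !lI -!EFinM lte_fin !mulr_gt0.
have ex n : exists y, box n y /\ P y.
  apply: contrapT => no; have : (leb3 R).-negligible (box n).
    by apply: negligibleS aeP => y by_ Py; apply: no; exists y.
  have mbox : measurable (box n) by apply: measurableX => //; exact: measurableX.
  move=> /(measure_negligible mbox) b0; have := lbox n; rewrite b0.
  by rewrite ltxx.
pose y n := projT1 (cid (ex n)).
have yP n : box n (y n) /\ P (y n) by exact: (projT2 (cid (ex n))).
exists y => [n|v]; first by case: (yP n).
have icv (c : nat -> R) (a : R) : (forall n, I a n (c n)) -> c n @[n --> \oo] --> a.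
  move=> cI; apply/cvgrPdist_lt => e e0; near=> n.
  have := cI n; rewrite /I/= in_itv/= => /andP[ac can].
  rewrite distrC gtr0_norm ?subr_gt0// ltrBlDl; apply: lt_trans can _; rewrite ltrD2l.
  by near: n; exact: near_infty_natSinv_lt (PosNum e0).
have c1 : (y n).1.1 @[n --> \oo] --> x.1.1 by apply: icv => n; have [[[]]] := yP n.
have c2 : (y n).1.2 @[n --> \oo] --> x.1.2 by apply: icv => n; have [[[]]] := yP n.
have c3 : (y n).2 @[n --> \oo] --> x.2 by apply: icv => n; have [[]] := yP n.
rewrite /dot; apply: cvgD; first apply: cvgD.
- by apply: cvgMr; exact: c1.
- by apply: cvgMr; exact: c2.
- by apply: cvgMr; exact: c3.
Unshelve. all: by end_near.
Qed.

End CharfunDensity.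

Section KernelMoments.
Context (R : realType) (alpha0 alpha : R) (b : R -> R).
Notation mu := (@lebesgue_measure R).
Notation RR := (measurableTypeR R).
Notation Ihalf := (`[0, pi / 2]%classic : set RR).
Notation h := (angular_kernel b).
Hypotheses
  (b_meas : measurable_fun (`[0, pi] : set R) (fun theta : R => b (cos theta)))
  (b_ge0 : forall theta : R, 0 <= theta <= pi -> 0 <= b (cos theta))
  (al0 : 0 < alpha0) (al0al : alpha0 <= alpha)
  (b_sing : (\int[@lebesgue_measure R]_(theta in `[0%R, (pi / 2)%R])
               (b (cos theta) * sin theta * sin (theta / 2) `^ alpha0)%:E < +oo)%E).

Lemma half_range (t : R) : 0 <= t <= pi / 2 ->
  [/\ h t = b (cos t) * sin t, 0 <= sin (t / 2), 0 <= cos (t / 2) & sin (t / 2) <= 1].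
Proof.
move=> tI; have /andP[t0 t2] := tI; have := pi_gt0 R => pi0; split.
- by rewrite /h tI.
- by apply: sin_ge0_pi; apply/andP; split; lra.
- by apply: cos_ge0_pihalf; apply/andP; split; lra.
- exact: sin_le1.
Qed.

Lemma singular_mass_kernel : (singular_mass alpha h < +oo)%E.
Proof.
have mh := mreal_angular_kernel b_meas; have h0 := angular_kernel_ge0 b_ge0.
apply: le_lt_trans b_sing.
have -> : (\int[mu]_(theta in `[0%R, (pi / 2)%R])
     (b (cos theta) * sin theta * sin (theta / 2) `^ alpha0)%:E =
   \int[mu]_(t in Ihalf) (h t * `|sin (t / 2)| `^ alpha0)%:E)%E.
  apply: eq_integral => t; rewrite inE/= in_itv/= => /half_range[-> s0 _ _].
  by rewrite (ger0_norm s0).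
have ms a : mreal (fun t : RR => `|sin (t / 2)| `^ a) by mfun.
apply: ge0_le_integral.
- exact: m0pi2.
- by move=> t _; rewrite lee_fin mulr_ge0 ?powR_ge0.
- by apply: measurable_funTS; apply: mereal_EFin; apply: mreal_mul.
- by apply: measurable_funTS; apply: mereal_EFin; apply: mreal_mul.
move=> t /=; rewrite in_itv/= => /half_range[_ s0 _ s1].
rewrite lee_fin; apply: ler_wpM2l => //; rewrite (ger0_norm s0).
have alP : 0 < alpha by exact: lt_le_trans al0al.
have [->|sn0] := eqVneq (sin (t / 2)) 0.
  by rewrite !powR0 ?gt_eqF.
by apply: ger_powR => //; rewrite lt_neqAle eq_sym sn0 s0.
Qed.

Lemma lambda_excess : 2 * pi * fine (excess alpha h) = lambda b alpha.
Proof.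
apply: (congr1 (fun z => 2 * pi * fine z)).
apply: eq_integral => t; rewrite inE/= in_itv/= => /half_range[-> s0 c0 _].
by rewrite (ger0_norm s0) (ger0_norm c0).
Qed.

End KernelMoments.

Section InitialTime.
Context (R : realType) (p delta alpha : R) (h : measurableTypeR R -> R)
  (phi0 psi0 : R3 R -> R[i]) (Phi Psi : measurableTypeR R -> R3 R -> R[i]).
Hypotheses (al0 : 0 < alpha)
  (FPhi : regular_flow p delta alpha h phi0 Phi)
  (FPsi : regular_flow p delta alpha h psi0 Psi)
  (mphi0 : mcomplex phi0) (mpsi0 : mcomplex psi0).

Lemma flow_initial (F : measurableTypeR R -> R3 R -> R[i]) f0 x :
  regular_flow p delta alpha h f0 F -> x != 0 -> F 0 x = f0 x.
Proof.
move=> FF x0; rewrite (flow_duhamel FF x0 (lexx 0)).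
rewrite mulr0 oppr0 expR0 mul1r /Cintegral /Rintegral set_itv1.
by rewrite !integral_set1/= addr0.
Qed.

Lemma mass_initial M :
  (mass p delta Phi Psi alpha M 0%R <= Mnorm alpha (fun x => phi0 x - psi0 x)%R)%E.
Proof.
have md : mreal (fun x => normc (phi0 x - psi0 x)) by apply: mreal_normc; exact: mcomplex_sub.
rewrite Mnorm_leb3; apply: ge0_le_integral.
- exact: measurableT.
- by move=> x _; rewrite lee_fin mulr_ge0 ?ball_wt_ge0 ?gap_size_ge0.
- apply: mereal_EFin; apply: mreal_mul; first exact: mreal_ball_wt.
  apply: (mreal_gap_size (f := fun _ => 0) (g := id) p delta (flow_measurable FPhi) (flow_measurable FPsi)).
    exact: measurable_cst.
  exact: measurable_id.
- by apply: mereal_mul; apply: mereal_EFin => //; exact: mreal_wt1.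
move=> x _; have [->|x0] := eqVneq x 0.
  by rewrite -EFinM wt0// mul0r lee_fin /ball_wt wt0// if_same mul0r.
rewrite -EFinM lee_fin /gap_size (flow_initial FPhi x0) (flow_initial FPsi x0).
rewrite /growth mulr0 expR0 mul1r; apply: ler_wpM2r; first exact: normc_ge0.
exact: ball_wt_le.
Qed.

End InitialTime.

Lemma in_M_mcomplex (R : realType) alpha (phi0 : R3 R -> R[i]) : in_M alpha phi0 -> mcomplex phi0.
Proof.
move=> [[f fE] _].
by rewrite (_ : phi0 = charfun f); [exact: mcomplex_charfun|apply/funext].
Qed.

Section Stability.
Context (R : realType) (p delta alpha0 alpha : R) (b : R -> R).
Hypotheses (p02 : 0 < p <= 2) (delta0 : 0 <= delta) (alpha00 : 0 < alpha0)
  (b_meas : measurable_fun (`[0, pi] : set R) (fun theta : R => b (cos theta)))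
  (b_ge0 : forall theta : R, 0 <= theta <= pi -> 0 <= b (cos theta))
  (b_supp : forall theta : R, pi / 2 < theta <= pi -> b (cos theta) = 0)
  (b_sing : (\int[@lebesgue_measure R]_(theta in `[0%R, (pi / 2)%R])
               (b (cos theta) * sin theta * sin (theta / 2) `^ alpha0)%:E < +oo)%E)
  (alphaI : alpha0 <= alpha < p).

Lemma weighted_stability (phi0 psi0 : R3 R -> R[i]) (phi psi : R3 R -> R -> R[i]) t :
  in_M alpha phi0 -> in_M alpha psi0 ->
  in_Tp p delta alpha phi -> in_Tp p delta alpha psi ->
  is_solution p delta b phi0 phi -> is_solution p delta b psi0 psi -> 0 <= t ->
  (Mnorm alpha (fun xi => (expR (delta * enorm xi `^ p * t))%:C * (phi xi t - psi xi t))%R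
   <= (expR (lambda b alpha * t))%:E * Mnorm alpha (fun xi => phi0 xi - psi0 xi)%R)%E.
Proof.
move=> Mphi0 Mpsi0 Tphi Tpsi Sphi Spsi t0.
have /andP[al0al alp] := alphaI; have /andP[p0 p2] := p02.
have al0 : 0 < alpha by exact: lt_le_trans al0al.
have al02 : 0 < alpha <= 2 by rewrite al0 (le_trans (ltW alp) p2).
have FPhi := solution_flow b_supp Tphi Sphi; have FPsi := solution_flow b_supp Tpsi Spsi.
have mh := mreal_angular_kernel b_meas; have h0 := angular_kernel_ge0 b_ge0.
have hoo := singular_mass_kernel b_meas b_ge0 alpha00 al0al b_sing.
have mphi0 := in_M_mcomplex Mphi0; have mpsi0 := in_M_mcomplex Mpsi0.
pose gs := gap_size p delta (clipped phi) (clipped psi) t.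
have mgs : mreal gs.
  apply: (mreal_gap_size (f := fun _ => t) (g := id) p delta (flow_measurable FPhi) (flow_measurable FPsi)).
    exact: measurable_cst.
  exact: measurable_id.
have gs0 x : 0 <= gs x by exact: gap_size_ge0.
rewrite Mnorm_leb3.
have -> : (\int[leb3 R]_x ((wt alpha x)%:E * (normc ((expR (delta * enorm x `^ p * t))%:C *
    (phi x t - psi x t)))%:E) = \int[leb3 R]_x (wt alpha x * gs x)%:E)%E.
  apply: eq_integral => x _; rewrite -EFinM normcM normc_real ger0_norm ?expR_ge0//.
  by rewrite /gs /gap_size !clippedE.
apply: ball_exhaustion => // n.
apply: le_trans (mass_growth n%:R p02 delta0 al02 mh h0 hoo FPhi FPsi t0) _.
rewrite lambda_excess; apply: lee_wpmul2l; first by rewrite lee_fin expR_ge0.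
exact: (mass_initial al0 FPhi FPsi mphi0 mpsi0).
Qed.

(** The norm of the difference vanishes, so equality holds almost everywhere, and
    in particular along a sequence converging to any given point. *)
Lemma uniqueness (phi0 : R3 R -> R[i]) (phi psi : R3 R -> R -> R[i]) xi t :
  in_M alpha phi0 -> in_Tp p delta alpha phi -> in_Tp p delta alpha psi ->
  is_solution p delta b phi0 phi -> is_solution p delta b phi0 psi -> 0 <= t ->
  phi xi t = psi xi t.
Proof.
move=> Mphi0 Tphi Tpsi Sphi Spsi t0.
have := weighted_stability Mphi0 Mphi0 Tphi Tpsi Sphi Spsi t0.
have [[[inMphi _] _] _] := Tphi; have [[[inMpsi _] _] _] := Tpsi.
have [[f fE] _] := inMphi t t0; have [[g gE] _] := inMpsi t t0.
have -> : Mnorm alpha (fun x => phi0 x - phi0 x)%R = 0%E.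
  rewrite Mnorm_leb3; rewrite (eq_integral (fun=> 0%E)) ?integral0// => x _.
  by rewrite subrr (_ : normc 0 = 0) ?mule0//= expr0n addr0 sqrtr0.
rewrite mule0 Mnorm_leb3 => le0.
have mf : mcomplex (phi^~ t) := in_M_mcomplex (inMphi t t0).
have mg : mcomplex (psi^~ t) := in_M_mcomplex (inMpsi t t0).
pose W x : R[i] := (expR (delta * enorm x `^ p * t))%:C * (phi x t - psi x t).
have mW : mcomplex W.
  apply: mcomplex_mul; last exact: mcomplex_sub.
  by apply: mcomplex_real; have m1 := @measurable_id _ (R3 R) setT; mfun.
pose H x := ((wt alpha x)%:E * (normc (W x))%:E)%E.
have mH : measurable_fun setT H.
  by apply: mereal_mul; apply: mereal_EFin; [exact: mreal_wt1|exact: mreal_normc].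
have H0 x : (0 <= H x)%E by rewrite mule_ge0 ?lee_fin ?wt_ge0 ?normc_ge0.
have IH : (\int[leb3 R]_x `|H x| = 0)%E.
  rewrite (eq_integral H) => [|x _]; last by rewrite gee0_abs.
  by apply/eqP; rewrite eq_le le0 integral_ge0.
have aeH : {ae leb3 R, forall z, charfun f z = charfun g z}.
  have aeF : Filter (nbhs (almost_everywhere (leb3 R))) by exact: ae_filter_ringOfSetsType.
  have := (ae_eq_integral_abs (leb3 R) measurableT mH).1 IH.
  apply: filterS => z /(_ I) Hz.
  have [->|z0] := eqVneq z 0; first by rewrite !charfun0.
  have wz : wt alpha z != 0.
    rewrite gt_eqF// /wt invr_gt0 powR_gt0// lt_neqAle enorm_ge0 andbT eq_sym.
    by apply: contra z0 => /eqP/enorm_eq0/eqP.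
  move: Hz; rewrite /H -EFinM => -[/eqP]; rewrite mulf_eq0 (negbTE wz)/= => /eqP/Normc.eq0_normc/eqP.
  rewrite /W mulf_eq0 subr_eq0 -fE -gE => /orP[|/eqP//].
  by rewrite eq_complex/= gt_eqF ?expR_gt0.
have [y yP yx] := ae_dense xi aeH.
by rewrite fE gE; exact: (charfun_eq_of_cvg yx yP).
Qed.

End Stability.

Unset Implicit Arguments.

Theorem theorem1p2 (R : realType) (p delta alpha0 alpha : R) (b : R -> R)
    (hp : 0 < p <= 2) (hdelta : 0 <= delta)
    (halpha0 : 0 < alpha0 <= 2)
    (b_meas : measurable_fun (`[0, pi] : set R) (fun theta : R => b (cos theta)))
    (b_ge0 : forall theta : R, 0 <= theta <= pi -> 0 <= b (cos theta))
    (b_supp : forall theta : R, pi / 2 < theta <= pi -> b (cos theta) = 0)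
    (b_sing : (\int[@lebesgue_measure R]_(theta in `[0%R, (pi / 2)%R])
                 (b (cos theta) * sin theta * sin (theta / 2) `^ alpha0)%:E
               < +oo)%E)
    (halpha : alpha0 <= alpha < p) :
  (forall (phi0 psi0 : R3 R -> R[i]) (phi psi : R3 R -> R -> R[i]),
     in_M alpha phi0 -> in_M alpha psi0 ->
     in_Tp p delta alpha phi -> in_Tp p delta alpha psi ->
     is_solution p delta b phi0 phi -> is_solution p delta b psi0 psi ->
     forall t : R, 0 <= t ->
       (Mnorm alpha (fun xi => (expR (delta * enorm xi `^ p * t))%:C
                               * (phi xi t - psi xi t))%R
        <= (expR (lambda b alpha * t))%:E
           * Mnorm alpha (fun xi => phi0 xi - psi0 xi)%R)%E)
  /\
  (forall (phi0 : R3 R -> R[i]) (phi psi : R3 R -> R -> R[i]),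
     in_M alpha phi0 ->
     in_Tp p delta alpha phi -> in_Tp p delta alpha psi ->
     is_solution p delta b phi0 phi -> is_solution p delta b phi0 psi ->
     forall (xi : R3 R) (t : R), 0 <= t -> phi xi t = psi xi t).
Proof.
have [alpha00 _] := andP halpha0.
split.
- move=> phi0 psi0 phi psi Mphi0 Mpsi0 Tphi Tpsi Sphi Spsi t t0.
  exact: (weighted_stability hp hdelta alpha00 b_meas b_ge0 b_supp b_sing halpha
    Mphi0 Mpsi0 Tphi Tpsi Sphi Spsi t0).
- move=> phi0 phi psi Mphi0 Tphi Tpsi Sphi Spsi xi t t0.
  exact: (uniqueness hp hdelta alpha00 b_meas b_ge0 b_supp b_sing halpha
    xi Mphi0 Tphi Tpsi Sphi Spsi t0).
Qed.
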